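(* Let $X$ be a standard Brownian motion, let $\lambda>0$, and let $T$ be an exponential random variable with parameter $\lambda$ independent of $X$. Then for $\alpha,\beta>0$ $$\mathbf{P}(D^+_T\in d\alpha,\ D^-_T\in d\beta)=f_{+,-}(\alpha\vee\beta,\alpha\wedge\beta)\,d\alpha\,d\beta,$$ where for $x>y>0$ $$f_{+,-}(x,y):=\frac{2\lambda}{(\cosh(y\sqrt{2\lambda})+1)^2}\left(2+\frac{(x-y)\sqrt{2\lambda}}{\sinh(y\sqrt{2\lambda})}\right)\exp\left(-(x-y)\sqrt{2\lambda}\,\coth(y\sqrt{2\lambda})\right).$$
   Context: For $t\ge0$, the maximum increase and the maximum decrease of $X$ up to time $t$ are $D^+_t:=\sup_{0\le u\le v\le t}(X_v-X_u)$ and $D^-_t:=\sup_{0\le u\le v\le t}(X_u-X_v)$. The law of $(D^+_T,D^-_T)$ does not depend on the starting point of $X$. The formula means that $(D^+_T,D^-_T)$ has a joint density with respect to Lebesgue measure on $(0,\infty)^2$. *)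

(* Defs.v *)
From HB Require Import structures.
From mathcomp Require Import all_boot all_order all_algebra.
From mathcomp Require Import all_classical all_reals all_analysis.

Set Implicit Arguments.
Unset Strict Implicit.
Unset Printing Implicit Defensive.

Import Order.TTheory GRing.Theory Num.Theory.
Import numFieldNormedType.Exports.

Local Open Scope classical_set_scope.
Local Open Scope ring_scope.

Definition coshR {R : realType} (x : R) : R := (expR x + expR (- x)) / 2.
Definition sinhR {R : realType} (x : R) : R := (expR x - expR (- x)) / 2.
Definition cothR {R : realType} (x : R) : R := coshR x / sinhR x.

Section processes.
Context d (Omega : measurableType d) (R : realType) (P : probability Omega R).

(* The sets A i may be the whole line, so the product rule over all indices
   contains the product rules over the subfamilies. *)
Definition mutually_independent (n : nat) (Y : 'I_n -> Omega -> R) : Prop :=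
  forall A : 'I_n -> set R, (forall i, measurable (A i)) ->
    P (\bigcap_i Y i @^-1` A i) = (\prod_(i < n) P (Y i @^-1` A i))%E.

(* Time is [0, +oo[: the variables X t with t < 0 are unconstrained.
   [normal_prob m s] has standard deviation s, and is not a Dirac mass at
   s = 0, whence s < t in [bm_normal]. *)
Record standard_brownian_motion_from (x0 : R) (X : R -> {RV P >-> R}) : Prop := {
  bm_start : forall w, X 0 w = x0;
  bm_continuous : forall w,
    {within `[(0 : R), +oo[, continuous (fun t : R => X t w : R)};
  bm_normal : forall s t : R, 0 <= s -> s < t ->
    forall A : set R, measurable A ->
      P ((fun w => X t w - X s w) @^-1` A) =
      normal_prob 0 (Num.sqrt (t - s)) A;
  bm_independent : forall (n : nat) (t : nat -> R),
    0 <= t 0%N -> (forall i, t i <= t i.+1) ->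
    mutually_independent (fun (i : 'I_n) w => X (t i.+1) w - X (t i) w) }.

Definition process_sigma_algebra (X : R -> {RV P >-> R}) : set (set Omega) :=
  <<s \bigcup_(t in `[(0 : R), +oo[) preimage_set_system setT (X t) measurable >>.

Definition independent_of_process (T : {RV P >-> R}) (X : R -> {RV P >-> R}) :
    Prop :=
  forall (A : set R) (E : set Omega),
    measurable A -> process_sigma_algebra X E ->
    P (T @^-1` A `&` E) = (P (T @^-1` A) * P E)%E.

Definition exponentially_distributed (lambda : R) (T : {RV P >-> R}) : Prop :=
  forall A : set R, measurable A ->
    distribution P T A = exponential_prob lambda A.

End processes.

(* For a continuous path x and t >= 0 the suprema below are over nonempty
   bounded sets; for t < 0 they are over the empty set, of supremum 0. *)
Definition max_increase {R : realType} (x : R -> R) (t : R) : R :=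
  sup [set x uv.2 - x uv.1 | uv in
    [set uv : R * R | [/\ 0 <= uv.1, uv.1 <= uv.2 & uv.2 <= t]]].

Definition max_decrease {R : realType} (x : R -> R) (t : R) : R :=
  sup [set x uv.1 - x uv.2 | uv in
    [set uv : R * R | [/\ 0 <= uv.1, uv.1 <= uv.2 & uv.2 <= t]]].

Definition f_plus_minus {R : realType} (lambda x y : R) : R :=
  let c := Num.sqrt (2 * lambda) in
  2 * lambda / (coshR (y * c) + 1) ^+ 2 *
  (2 + (x - y) * c / sinhR (y * c)) *
  expR (- ((x - y) * c * cothR (y * c))).

(* Main.v *)
(** Put c = sqrt (2 lambda). By the symmetry X -> -X take b <= a; then the path
    has maximum increase at most a and maximum decrease at most b exactly when
    its range stays below a and its drawdown below b. The pair (range, drawdown)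
    is Markov, and the probability that it leaves this region before the
    exponential time is an explicit function G(r, z) satisfying G'' = c^2 G in
    the drawdown. Sampling X on a dyadic grid gives a Gaussian walk killed on
    leaving the region, and perturbing G by a small multiple of the range gives
    super- and subsolutions of the discounted walk; they pin down
    P(D^+_T <= a, D^-_T <= b) in the limit. Tonelli's theorem, integrating the
    density over y and then over x, gives the same value for the mass of the
    quadrant, and finite measures on the plane are determined by quadrants. *)

Require Import Defs.
From HB Require Import structures.
From mathcomp Require Import all_boot all_order all_algebra.
From mathcomp Require Import all_classical all_reals all_analysis.
From mathcomp Require Import measurable_realfun ring lra.

Set Implicit Arguments.
Unset Strict Implicit.
Unset Printing Implicit Defensive.

Import Order.TTheory GRing.Theory Num.Theory.
Import numFieldNormedType.Exports.

Local Open Scope classical_set_scope.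
Local Open Scope ring_scope.

(** * Hyperbolic functions *)

(** [exit_value] splits the event by whether the drawdown reaches b. The drawdown is a reflected
    Brownian motion, so from z it reaches b in time with probability cosh(cz)/cosh(bc). If it does
    not, the range must pass a; as b <= a this happens at a new maximum, with drawdown 0, and b is
    then missed with probability 1 - 1/cosh(bc). The remaining factor is the probability that the
    range passes a first: once the range exceeds b only new maxima increase it, and per unit growth
    of the maximum the excursions that reach b or contain the exponential time have rate c coth(bc),
    which is [exit_rate]. For a Gaussian step d the discount is 1/E[exp(cd)], so inside the region
    the discounted walk preserves G exactly, without Taylor remainder. All errors come from steps
    that change the range or leave the region. Their first-order parts cancel, since the
    r-derivative of G is minus its z-derivative at z = 0 and vanishes at z = r. The obstacle is the
    second-order part: O(h) on each of O(1/h) steps does not vanish by counting. But the range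
    increments of a surviving walk sum to at most a, so a small multiple of the range pays for
    them. *)

Section hyperbolic_functions.
Context {R : realType}.
Implicit Types x y q M : R.

Lemma coshR0 : coshR (0 : R) = 1.
Proof. by rewrite /coshR oppr0 expR0; lra. Qed.

Lemma sinhR0 : sinhR (0 : R) = 0.
Proof. by rewrite /sinhR oppr0 expR0; lra. Qed.

Lemma coshRN x : coshR (- x) = coshR x.
Proof. by rewrite /coshR opprK addrC. Qed.

Lemma sinhRN x : sinhR (- x) = - sinhR x.
Proof. by rewrite /sinhR opprK; lra. Qed.

Lemma coshRD x y : coshR (x + y) = coshR x * coshR y + sinhR x * sinhR y.
Proof. by rewrite /coshR /sinhR opprD !expRD; field. Qed.

Lemma sinhRD x y : sinhR (x + y) = sinhR x * coshR y + coshR x * sinhR y.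
Proof. by rewrite /coshR /sinhR opprD !expRD; field. Qed.

Lemma sqr_sinhR x : sinhR x ^+ 2 = coshR x ^+ 2 - 1.
Proof. by have := expRxMexpNx_1 x; rewrite /coshR /sinhR; nra. Qed.

Lemma coshR_ge1 x : 1 <= coshR x.
Proof.
have h := expRxMexpNx_1 x; rewrite /coshR.
have := sqr_ge0 (expR x - 1); have := expR_gt0 (- x); have := expR_gt0 x.
by nra.
Qed.

Lemma coshR_gt0 x : 0 < coshR x.
Proof. exact: lt_le_trans (coshR_ge1 x). Qed.

Global Instance is_derive_sinhR x : is_derive x 1 (@sinhR R) (coshR x).
Proof.
rewrite (_ : sinhR = 2^-1 \*: (expR - (expR \o -%R) : R -> R)); last first.
  by apply/funext => y; rewrite /sinhR /= mulrC.
by apply: is_derive_eq; rewrite /coshR /GRing.scale/=; lra.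
Qed.

Global Instance is_derive_coshR x : is_derive x 1 (@coshR R) (sinhR x).
Proof.
rewrite (_ : coshR = 2^-1 \*: (expR + (expR \o -%R) : R -> R)); last first.
  by apply/funext => y; rewrite /coshR /= mulrC.
by apply: is_derive_eq; rewrite /sinhR /GRing.scale/=; lra.
Qed.

Lemma continuous_sinhR : continuous (@sinhR R).
Proof. by move=> x; apply/differentiable_continuous/derivable1_diffP. Qed.

Lemma continuous_coshR : continuous (@coshR R).
Proof. by move=> x; apply/differentiable_continuous/derivable1_diffP. Qed.

Lemma sinhR_ge x : 0 <= x -> x <= sinhR x.
Proof.
move=> x0.
have [|y _] := MVT_segment x0 (fun y _ => is_derive_sinhR y).
  exact/continuous_subspaceT/continuous_sinhR.
by rewrite sinhR0 !subr0 => ->; rewrite ler_peMl// coshR_ge1.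
Qed.

Lemma sinhR_gt0 x : 0 < x -> 0 < sinhR x.
Proof. by move=> x0; rewrite (lt_le_trans x0)// sinhR_ge// ltW. Qed.

Lemma sinhR_ge0 x : 0 <= x -> 0 <= sinhR x.
Proof. by move=> x0; rewrite (le_trans x0)// sinhR_ge. Qed.

Lemma expR_sub1_le x : expR x - 1 <= x * expR x.
Proof.
have := expR_ge1Dx (- x); have := expRxMexpNx_1 x; have := expR_gt0 x.
by nra.
Qed.

Lemma expR_subDx_le x : 0 <= x -> expR x - 1 - x <= x ^+ 2 * expR x.
Proof. by move=> x0; have := expR_sub1_le x; nra. Qed.

Lemma coshR_sub1_le x : 0 <= x -> coshR x - 1 <= x ^+ 2 * expR x.
Proof.
move=> x0; have := expR_sub1_le x; have := expRxMexpNx_1 x.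
have : 1 <= expR x by rewrite -expR0 ler_expR.
have : coshR x - 1 = expR (- x) * (expR x - 1) ^+ 2 / 2.
  rewrite (_ : expR (- x) * _ = expR x * expR (- x) * expR x -
    2 * (expR x * expR (- x)) + expR (- x)); last by ring.
  by rewrite expRxMexpNx_1 /coshR; lra.
move=> ->.
have := expR_gt0 (- x).
set e := expR x; set e' := expR (- x) => e'0 e1 ee' h.
have h2 : (e - 1) ^+ 2 <= (x * e) ^+ 2 by rewrite ler_pXn2r// nnegrE; nra.
have -> : x ^+ 2 * e = e' * (x * e) ^+ 2.
  by rewrite -[LHS]mul1r -ee'; ring.
nra.
Qed.

Lemma coshR_le_expR x : 0 <= x -> coshR x <= expR x.
Proof.
move=> x0; have : expR (- x) <= expR x by rewrite ler_expR; lra.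
by rewrite /coshR; lra.
Qed.

Lemma ler_coshR x y : 0 <= x -> x <= y -> coshR x <= coshR y.
Proof.
move=> x0 xy; rewrite -[y](subrKC x) coshRD.
have := coshR_ge1 (y - x); have := coshR_ge1 x; have := sinhR_ge0 x0.
by have := @sinhR_ge0 (y - x); rewrite subr_ge0 => /(_ xy); nra.
Qed.

Lemma coshRD_le x y : 0 <= x -> 0 <= y -> coshR (x + y) <= coshR x * expR y.
Proof.
move=> x0 y0; rewrite coshRD (_ : expR y = coshR y + sinhR y); last first.
  by rewrite /coshR /sinhR; lra.
rewrite mulrDr lerD2l ler_wpM2r ?sinhR_ge0//.
by rewrite /coshR /sinhR; have := expR_gt0 (- x); lra.
Qed.

Lemma sinhR_le x : 0 <= x -> sinhR x <= x * expR x.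
Proof.
move=> x0; apply: le_trans (expR_sub1_le x).
by have := coshR_ge1 x; rewrite /coshR /sinhR; lra.
Qed.

(** With q = coth(bc) and x = ct, the left-hand side is what [exit_value] continued to drawdown -t
    contains, and the right-hand side is its counterpart after the range has grown by t. The
    left-hand side is exp x + (q - 1) sinh x, and sinh x <= x exp x. *)
Lemma coshRDsinhR_le q x : 1 <= q -> 0 <= x ->
  coshR x + q * sinhR x <= expR (q * x).
Proof.
move=> q1 x0; have h := sinhR_le x0.
have h2 : 1 + (q - 1) * x <= expR ((q - 1) * x) by exact: expR_ge1Dx.
rewrite (_ : q * x = x + (q - 1) * x); last by ring.
rewrite expRD.
have -> : coshR x + q * sinhR x = expR x + (q - 1) * sinhR x.
  by rewrite /coshR /sinhR; lra.
by have := expR_gt0 x; nra.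
Qed.

(* The left-hand side vanishes to second order at 0. *)
Lemma coshRDsinhR_subexpR_le q x : 1 <= q -> 0 <= x ->
  `|coshR x + q * sinhR x - expR (q * x)| <= (q * x) ^+ 2 * expR (q * x).
Proof.
move=> q1 x0; rewrite ler0_norm ?subr_le0 ?coshRDsinhR_le//.
have qx0 : 0 <= q * x by nra.
have := expR_subDx_le qx0; have := coshR_ge1 x; have := sinhR_ge x0.
have := expR_gt0 (q * x).
set e := expR _ => e0 s ch h.
have : q * x <= q * sinhR x by nra.
lra.
Qed.

End hyperbolic_functions.

(** * The exit probability and its one-step estimates *)

Section exit_value.
Local Opaque coshR sinhR cothR.
Context {R : realType}.
Variables c a b : R.
Implicit Types r t w x z y d : R.

Definition exit_rate := c * cothR (b * c).

(* With c = sqrt (2 lambda): the probability that Brownian motion, started with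
   range [r] and drawdown (running maximum minus current value) [z], makes its
   range exceed [a] or its drawdown exceed [b] before the exponential time.
   For [z] outside [0, min r b] it is the analytic continuation of that formula,
   so that averaging [exit_value r (z - d)] over a centered Gaussian step [d]
   multiplies it by a constant. *)
Definition exit_value (r z : R) :=
  let C := coshR (b * c) in let S := sinhR (b * c) in
  coshR (c * z) / C + (1 - C^-1) *
    if r <= b then
      expR (- ((a - b) * exit_rate)) * (C * coshR (c * (r - z)) - coshR (c * z)) / S ^+ 2
    else expR (- ((a - r) * exit_rate)) * sinhR (c * (b - z)) / S.

Lemma exit_rateE : exit_rate = c * (coshR (b * c) / sinhR (b * c)).
Proof. by []. Qed.

Local Opaque exit_rate.

Hypotheses (c0 : 0 < c) (b0 : 0 < b) (ba : b <= a).

Local Notation C := (coshR (b * c)).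
Local Notation S := (sinhR (b * c)).
Local Notation g := exit_rate.
Local Notation G := exit_value.
Local Notation E := (expR (- ((a - b) * g))).

Let bc0 : 0 < b * c. Proof. exact: mulr_gt0. Qed.
Let S0 : 0 < S. Proof. exact: sinhR_gt0. Qed.
Let C1 : 1 < C.
Proof.
have := sqr_sinhR (b * c); have := coshR_ge1 (b * c); have := S0.
by nra.
Qed.
Let SS : S ^+ 2 = C ^+ 2 - 1. Proof. exact: sqr_sinhR. Qed.
Let C0 : 0 < C. Proof. exact: coshR_gt0. Qed.
Let CS : S < C. Proof. by have := SS; have := S0; have := C0; nra. Qed.
Let q1 : 1 <= C / S. Proof. by rewrite ler_pdivlMr// mul1r ltW. Qed.
Let gE : g = C / S * c.
Proof. by rewrite exit_rateE mulrC. Qed.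
Let g0 : 0 < g. Proof. by rewrite gE mulr_gt0// divr_gt0. Qed.
Let cg : c <= g. Proof. by rewrite gE ler_peMl// ltW. Qed.
Let k0 : 0 < 1 - C^-1. Proof. by rewrite subr_gt0 invf_lt1. Qed.
Let E0 : 0 < E. Proof. exact: expR_gt0. Qed.
Let E1 : E <= 1.
Proof. by rewrite -expR0 ler_expR oppr_le0 mulr_ge0 ?subr_ge0// ltW. Qed.

(** The mismatch at a new maximum when the range exceeds b: drawdown continued to -t against range
    increased by t. The choice g = c C / S cancels the linear terms. *)
Let D (t : R) := coshR (c * t) + C / S * sinhR (c * t) - expR (g * t).

Let gtE t : C / S * (c * t) = g * t. Proof. by rewrite gE mulrA. Qed.

Let D_le t : 0 <= t -> t <= a ->
  `|D t| <= g ^+ 2 * expR (g * a) * t ^+ 2.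
Proof.
move=> t0 ta; have ct0 : 0 <= c * t by rewrite mulr_ge0// ltW.
have := coshRDsinhR_subexpR_le q1 ct0; rewrite gtE -/(D t) => /le_trans; apply.
rewrite exprMn mulrAC ler_wpM2r ?sqr_ge0// ler_wpM2l ?sqr_ge0//.
by rewrite ler_expR ler_wpM2l// ltW.
Qed.

Let cosh_le t : 0 <= t -> t <= a ->
  coshR (c * t) - 1 <= g ^+ 2 * expR (g * a) * t ^+ 2.
Proof.
move=> t0 ta; have ct0 : 0 <= c * t by rewrite mulr_ge0// ltW.
apply: (le_trans (coshR_sub1_le ct0)).
rewrite exprMn mulrAC ler_wpM2r ?sqr_ge0//.
rewrite ler_pM ?sqr_ge0 ?expR_ge0//; first by rewrite ler_pXn2r// nnegrE ltW.
by rewrite ler_expR ler_pM// ltW.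
Qed.

(** For r <= b, G is alpha cosh(c(r - z)) + beta cosh(cz). With coefficients independent of r, this
    form satisfies the boundary conditions at z = 0 and at z = r. The two identities below fix the
    values at range b: [alpha_beta] says that G is 1 at drawdown b, and [alphaC_beta] matches the
    formula for larger ranges at drawdown 0. *)
Let alpha := (1 - C^-1) * E * C / S ^+ 2.
Let beta := C^-1 - (1 - C^-1) * E / S ^+ 2.

Let alpha0 : 0 <= alpha.
Proof. by rewrite /alpha divr_ge0 ?sqr_ge0// !mulr_ge0// ltW. Qed.

Let Cn0 : C != 0. Proof. by rewrite gt_eqF. Qed.
Let Sn0 : S != 0. Proof. by rewrite gt_eqF. Qed.
Let C1n0 : C + 1 != 0. Proof. by rewrite gt_eqF// addr_gt0. Qed.
Let CCn0 : C ^+ 2 - 1 != 0. Proof. by rewrite -SS expf_neq0. Qed.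

Let alphaE : alpha = E / (C + 1).
Proof. by rewrite /alpha SS; field; rewrite Cn0 C1n0 CCn0. Qed.

Let betaE : beta = (C + 1 - E) / (C * (C + 1)).
Proof. by rewrite /beta SS; field; rewrite Cn0 C1n0 CCn0. Qed.

Let beta0 : 0 <= beta.
Proof.
have C0' := C0; have E1' := E1.
by rewrite betaE divr_ge0 ?mulr_ge0//; lra.
Qed.

Let alpha_beta : alpha + beta * C = 1.
Proof. by rewrite alphaE betaE; field; rewrite Cn0 C1n0. Qed.

Let alphaC_beta : alpha * C + beta = C^-1 + (1 - C^-1) * E.
Proof. by rewrite alphaE betaE; field; rewrite Cn0 C1n0. Qed.

Let G1 r z : r <= b ->
  G r z = alpha * coshR (c * (r - z)) + beta * coshR (c * z).
Proof. by rewrite /G => ->; rewrite /alpha /beta; field; rewrite Cn0 Sn0. Qed.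

Let G2 r z : b < r -> G r z = coshR (c * z) / C +
  (1 - C^-1) * (expR (- ((a - r) * g)) * sinhR (c * (b - z)) / S).
Proof. by rewrite /G leNgt => ->. Qed.

Let G2N r t : b < r -> G r (- t) = coshR (c * t) / C +
  (1 - C^-1) * (expR (- ((a - r) * g)) *
   (coshR (c * t) + C / S * sinhR (c * t))).
Proof.
move=> br; rewrite G2// mulrN coshRN opprK mulrDr sinhRD (mulrC c b).
by congr (_ + _ * _); field; rewrite Sn0.
Qed.

Let alphaC : alpha * C = (1 - C^-1) * E * (1 + S ^- 2).
Proof.
have CCE : C ^+ 2 = S ^+ 2 + 1 by rewrite SS subrK.
rewrite /alpha (_ : _ * C = (1 - C^-1) * E * (C ^+ 2 / S ^+ 2)); last first.
  by field; rewrite Cn0 Sn0.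
by rewrite CCE; field; rewrite Cn0 Sn0.
Qed.

Let alphaS : alpha * S = (1 - C^-1) * E * (C / S).
Proof. by rewrite /alpha; field; rewrite Cn0 Sn0. Qed.

(** Continuation across the change of formula at range b, for a new maximum of height t that carries
    the range to b + w. Expressed through the excess w, it can be compared with the exponential in
    the formula beyond b; the terms in cosh - 1 are nonnegative and of second order. *)
Let G1N r t w : r <= b -> r + t = b + w ->
  G r (- t) = beta * (coshR (c * t) - 1) + C^-1 + (1 - C^-1) * E *
    (coshR (c * w) + C / S * sinhR (c * w) + S ^- 2 * (coshR (c * w) - 1)).
Proof.
move=> rb rt; rewrite G1// opprK rt mulrDr coshRD (mulrC c b) mulrN coshRN.
set x := coshR (c * w); set y := sinhR (c * w); set z := coshR (c * t).
transitivity (alpha * C * x + alpha * S * y + beta * z); first by ring.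
by rewrite alphaC alphaS /beta; field; rewrite Cn0 Sn0.
Qed.

Let K := g ^+ 2 * expR (g * a).

Let K0 : 0 <= K.
Proof. by rewrite mulr_ge0 ?sqr_ge0 ?expR_ge0. Qed.

Let beta1 : beta <= 1.
Proof. by have := alpha_beta; have := alpha0; have := beta0; have := C1; nra. Qed.

Let expR_le1 x : 0 <= x -> expR (- x) <= 1.
Proof. by rewrite -expR0 ler_expR oppr_le0. Qed.

(** Here z is the drawdown measured from the old maximum after the step, and it may leave [0, r]: if
    z < 0, a new maximum raises the range to r - z; if z > r, a new minimum raises it to z. *)
Definition next_range (r z : R) := Num.max r (Num.max (r - z) z).

Variant next_range_spec r z : R -> R -> Type :=
| NextRangeIn of 0 <= z & z <= r : next_range_spec r z r z
| NextRangeMax t of 0 < t & z = - t : next_range_spec r z (r + t) 0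
| NextRangeMin of r < z & 0 <= z : next_range_spec r z z z.

Lemma next_rangeP r z : 0 <= r ->
  next_range_spec r z (next_range r z) (Num.max z 0).
Proof.
move=> r0; rewrite /next_range; have [z0|z0] := ltP z 0.
- have -> : Num.max r (Num.max (r - z) z) = r + - z.
    rewrite (max_idPl (_ : z <= r - z)); last by lra.
    by apply/max_idPr; lra.
  by apply: NextRangeMax; rewrite ?opprK ?oppr_gt0.
- have [rz|rz] := ltP r z.
  + rewrite (max_idPr (_ : r - z <= z)); last by lra.
    by rewrite (max_idPr (ltW rz)); exact: NextRangeMin.
  + have -> : Num.max r (Num.max (r - z) z) = r.
      by apply/max_idPl; rewrite ge_max; apply/andP; split; lra.
    exact: NextRangeIn.
Qed.

Let normM_le (k x M : R) : 0 <= k -> k <= 1 -> `|x| <= M -> `|k * x| <= M.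
Proof.
move=> k0' k1 xM; rewrite normrM (ger0_norm k0').
by apply: le_trans xM; rewrite ler_piMl.
Qed.

Let kE1 x : 0 <= x -> (1 - C^-1) * expR (- x) <= 1.
Proof.
move=> /expR_le1 x1; have : 0 < C^-1 by rewrite invr_gt0.
by have := expR_gt0 (- x); have := k0; nra.
Qed.

Let kE0 x : 0 <= (1 - C^-1) * expR (- x).
Proof. by rewrite mulr_ge0 ?expR_ge0// ltW. Qed.

Let Ci0 : 0 <= C^-1. Proof. by rewrite invr_ge0 ltW. Qed.
Let Ci1 : C^-1 <= 1. Proof. by rewrite invf_le1// ltW. Qed.
Let Si0 : 0 <= S ^- 2. Proof. by rewrite invr_ge0 sqr_ge0. Qed.

Let G20 r : b < r -> G r 0 = C^-1 + (1 - C^-1) * expR (- ((a - r) * g)).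
Proof.
move=> br; rewrite -oppr0 (G2N _ br) !mulr0 coshR0 sinhR0 !mulr0 addr0 mul1r.
by rewrite mulr1.
Qed.

Let step_norm_le (x u v M N : R) : `|u| <= M -> `|v| <= N -> x = - u - v ->
  `|x| <= M + N.
Proof.
move=> uM vM ->; rewrite -opprD normrN (le_trans (ler_normD _ _))//.
exact: lerD.
Qed.

(** Compares the value at the new state with the continuation of the old formula. They agree if the
    range does not change; otherwise the boundary conditions cancel the terms linear in the growth
    of the range. *)
Lemma exit_value_step_alive : exists2 M, 0 <= M & forall r z, 0 <= r -> z <= b ->
  next_range r z <= a ->
  `|G (next_range r z) (Num.max z 0) - G r z| <= M * (next_range r z - r) ^+ 2.
Proof.
exists (K + (1 + S ^- 2) * K) => [|r z r0 zb].
  by rewrite addr_ge0// mulr_ge0// addr_ge0.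
have S2K : K <= (1 + S ^- 2) * K by rewrite ler_peMl// lerDl.
case: next_rangeP => // [z0 zr ra|t t0 zt ra|rz z0 za].
- by rewrite !subrr normr0 expr0n/= mulr0.
- have t0' := ltW t0; have ta : t <= a by lra.
  rewrite zt (_ : r + t - r = t); last by ring.
  have chK : `|coshR (c * t) - 1| <= K * t ^+ 2.
    by rewrite ger0_norm ?cosh_le// subr_ge0 coshR_ge1.
  have Kt0 : 0 <= K * t ^+ 2 by rewrite mulr_ge0// sqr_ge0.
  apply: (@le_trans _ _ (K * t ^+ 2 + (1 + S ^- 2) * K * t ^+ 2)); last first.
    by rewrite [leRHS]mulrDl.
  have KK : K * t ^+ 2 <= (1 + S ^- 2) * K * t ^+ 2.
    by rewrite ler_wpM2r ?sqr_ge0.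
  (* A new maximum leaves three cases: the range already exceeds b, it stays at most b, or it
     crosses b. *)
  have [rb|br] := leP r b; last first.
    apply: (@le_trans _ _ (K * t ^+ 2 + K * t ^+ 2)); last by rewrite lerD2l.
    apply: step_norm_le.
    + exact: (normM_le Ci0 Ci1 chK).
    + apply: (normM_le (kE0 ((a - r) * g)) _ (D_le t0' ta)).
      by apply: kE1; rewrite mulr_ge0 ?(ltW g0)//; lra.
    + rewrite (G2N t br) G20 ?ltr_wpDr//.
      rewrite (_ : - ((a - (r + t)) * g) = - ((a - r) * g) + g * t); last by ring.
      rewrite expRD /D.
      by field; rewrite Cn0 Sn0.
  have [rtb|brt] := leP (r + t) b.
    rewrite !G1// subr0 opprK mulr0 coshR0 mulrN coshRN.
    rewrite (_ : _ - _ = - (beta * (coshR (c * t) - 1))); last by ring.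
    by rewrite normrN (le_trans (normM_le beta0 beta1 chK))// lerDl (le_trans Kt0).
  (* In the crossing case the exponential regime acts only on the excess w over b, and w <= t. *)
  pose w := r + t - b.
  have rtw : r + t = b + w by rewrite /w; ring.
  have w0 : 0 <= w by rewrite /w; lra.
  have wt : w <= t by rewrite /w; lra.
  have wa : w <= a by lra.
  have wwtt : w ^+ 2 <= t ^+ 2 by rewrite ler_pXn2r.
  have chw0 : 0 <= coshR (c * w) - 1 by rewrite subr_ge0 coshR_ge1.
  apply: (step_norm_le (normM_le beta0 beta1 chK)
    (v := (1 - C^-1) * E * (D w + S ^- 2 * (coshR (c * w) - 1)))).
    apply: normM_le; first exact: kE0.
      by apply: kE1; rewrite mulr_ge0 ?subr_ge0// ltW.
    rewrite (le_trans (ler_normD _ _))//.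
    rewrite (_ : (1 + _) * _ * _ = K * t ^+ 2 + S ^- 2 * (K * t ^+ 2)); last by ring.
    rewrite lerD//; first by rewrite (le_trans (D_le w0 wa))// ler_wpM2l.
    rewrite normrM (ger0_norm Si0) (ger0_norm chw0) ler_wpM2l//.
    by rewrite (le_trans (cosh_le w0 wa))// ler_wpM2l.
  rewrite (G1N rb rtw) G20// rtw.
  rewrite (_ : - ((a - (b + w)) * g) = - ((a - b) * g) + g * w); last by ring.
  by rewrite expRD /D; ring.
- have rb : r <= b by lra.
  rewrite !G1// subrr mulr0 coshR0 (_ : c * (r - z) = - (c * (z - r))); last by ring.
  rewrite coshRN.
  rewrite (_ : _ - _ = - (alpha * (coshR (c * (z - r)) - 1))); last by ring.
  have zr0 : 0 <= z - r by lra.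
  have zra : z - r <= a by lra.
  rewrite normrN mulrDl.
  have alpha1 : alpha <= 1.
    by have := alpha_beta; have := beta0; have := C0; nra.
  have chK : `|coshR (c * (z - r)) - 1| <= K * (z - r) ^+ 2.
    by rewrite ger0_norm ?cosh_le// subr_ge0 coshR_ge1.
  rewrite (le_trans (normM_le alpha0 alpha1 chK))// lerDl.
  have := Si0; have := K0; set s := S ^- 2 => k0s s0.
  by rewrite mulr_ge0 ?sqr_ge0// mulr_ge0//; lra.
Qed.

(** The continuation equals 1 at drawdown b and does not drop below it beyond. For r <= b this is
    alpha + beta C = 1; for r > b the negative sinh term is dominated because C - 1 <= S ^+ 2. *)
Let exit_value_ge1 r z : r <= a -> b < z -> 1 <= G r z.
Proof.
move=> ra bz.
have cbz : 0 <= c * (z - b) by rewrite mulr_ge0 ?subr_ge0// ltW.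
have cz : c * z = b * c + c * (z - b) by ring.
have [rb|br] := leP r b.
  rewrite G1// -alpha_beta lerD// ?ler_peMr ?coshR_ge1//.
  by rewrite ler_wpM2l// cz ler_coshR ?(ltW bc0)// lerDl.
rewrite G2// (_ : c * (b - z) = - (c * (z - b))) ?sinhRN ?cz ?coshRD; last by ring.
have := coshR_ge1 (c * (z - b)); have := sinhR_ge0 cbz.
set x := coshR (c * (z - b)); set y := sinhR (c * (z - b)) => y0 x1.
set e := expR _.
have e1 : e <= 1 by rewrite /e expR_le1// mulr_ge0 ?subr_ge0// ltW.
have e0 : 0 < e by exact: expR_gt0.
have h : C - 1 <= S ^+ 2 by rewrite SS; have := C1; nra.
rewrite (_ : _ + _ = x + (S ^+ 2 - (C - 1) * e) * y / (C * S)); last first.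
  by field; rewrite Cn0 Sn0.
rewrite (le_trans x1)// lerDl divr_ge0//; last by rewrite mulr_ge0// ltW.
by rewrite mulr_ge0// subr_ge0 (le_trans _ h)// ler_piMr// subr_ge0 ltW.
Qed.

(** After leaving the region the true value is 1, so a supersolution needs the continuation not to
    fall much below 1. Only an exit past a through a new maximum costs anything, and the cost is
    quadratic. *)
Lemma exit_value_step_dead_ge r z : 0 <= r -> r <= a ->
  (a < next_range r z) || (b < z) ->
  1 - g ^+ 2 * (next_range r z - r) ^+ 2 <= G r z.
Proof.
move=> r0 ra; case: next_rangeP => // [z0 zr|t t0 ->|rz z0].
- by rewrite ltNge ra/= subrr expr0n mulr0 subr0; exact: exit_value_ge1.
- case/orP => [art|bt]; last by move: b0 t0; lra.
  have t0' := ltW t0; rewrite (_ : r + t - r = t); last by ring.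
  (* The damping factor e is at least 1 - wg and the hyperbolic factor x at least 1 + wg: in the
     product the linear terms cancel. *)
  have main w x e : 0 <= w -> w <= t -> 0 <= e -> 1 - w * g <= e ->
      coshR (c * w) + C / S * sinhR (c * w) <= x ->
      1 - g ^+ 2 * t ^+ 2 <= C^-1 + (1 - C^-1) * (e * x).
    move=> w0 wt e0 e1 hx.
    have cw0 : 0 <= c * w by rewrite mulr_ge0// ltW.
    have gw0 : 0 <= w * g by rewrite mulr_ge0// ltW.
    have x1 : 1 + w * g <= x.
      apply: le_trans hx; rewrite lerD ?coshR_ge1//.
      by rewrite mulrC -gtE ler_wpM2l ?sinhR_ge// divr_ge0// ltW.
    have ex : (1 - w * g) * (1 + w * g) <= e * x.
      apply: (@le_trans _ _ (e * (1 + w * g))); last by rewrite ler_wpM2l.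
      by rewrite ler_wpM2r// addr_ge0.
    have wt2 : (w * g) ^+ 2 <= g ^+ 2 * t ^+ 2.
      have wtg : w * g <= t * g by rewrite ler_wpM2r// ltW.
      rewrite (_ : g ^+ 2 * t ^+ 2 = (t * g) ^+ 2); last by ring.
      by rewrite ler_sqr ?nnegrE// (le_trans gw0).
    have ex' : (1 - C^-1) * (1 - (w * g) ^+ 2) <= (1 - C^-1) * (e * x).
      by rewrite ler_wpM2l ?(ltW k0)// (le_trans _ ex)// le_eqVlt; apply/orP; left; apply/eqP; ring.
    have := sqr_ge0 (w * g); have := Ci0; have := Ci1; nra.
  have ct1 : 1 <= coshR (c * t) by exact: coshR_ge1.
  have [rb|br] := leP r b.
    pose w := r + t - b.
    have rtw : r + t = b + w by rewrite /w; ring.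
    have w0 : 0 <= w by rewrite /w; move: ba art; lra.
    have wt : w <= t by rewrite /w; move: rb; lra.
    rewrite (G1N rb rtw) -mulrA.
    apply: (@le_trans _ _ (0 + C^-1 + (1 - C^-1) * (E *
      (coshR (c * w) + C / S * sinhR (c * w) +
       S ^- 2 * (coshR (c * w) - 1))))); last first.
      by rewrite !lerD// mulr_ge0// subr_ge0.
    rewrite add0r; apply: (main w) => //.
      apply: (@le_trans _ _ (1 - (a - b) * g)); last exact: expR_ge1Dx.
      by rewrite lerD2l lerN2 ler_wpM2r ?(ltW g0)//; move: art rb ba; rewrite /w; lra.
    by rewrite lerDl mulr_ge0// subr_ge0 coshR_ge1.
  rewrite (G2N t br).
  apply: (@le_trans _ _ (C^-1 + (1 - C^-1) * (expR (- ((a - r) * g)) *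
    (coshR (c * t) + C / S * sinhR (c * t))))); last first.
    by rewrite lerD2r ler_peMl.
  apply: (main t) => //.
  apply: (@le_trans _ _ (1 - (a - r) * g)); last exact: expR_ge1Dx.
  by rewrite lerD2l lerN2 ler_wpM2r ?(ltW g0)//; lra.
- move=> h; apply: (@le_trans _ _ 1); last first.
    by apply: exit_value_ge1 => //; case/orP: h => // /(le_lt_trans ba).
  by rewrite lerBlDr lerDl mulr_ge0 ?sqr_ge0.
Qed.

(** The overshoot of the continuation above 1 is of first order in the step, which is too large for
    an additive correction. Its multiplicative form is what the factor 1 - eps of the subsolution
    absorbs. *)
Lemma exit_value_step_dead_le r y d : 0 <= y -> y <= r -> r <= a -> y <= b ->
  (a < next_range r (y - d)) || (b < y - d) ->
  G r (y - d) <= expR (g * `|d|).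
Proof.
move=> y0 yr ra yb.
have coshz z m : b <= z -> z - b <= m -> coshR (c * z) <= C * expR (c * m).
  move=> bz zm; rewrite (_ : c * z = b * c + c * (z - b)); last by ring.
  have cbz : 0 <= c * (z - b) by rewrite mulr_ge0 ?subr_ge0// ltW.
  apply: le_trans (coshRD_le (ltW bc0) cbz) _.
  by rewrite ler_wpM2l ?(ltW C0)// ler_expR ler_wpM2l// ltW.
have Gb : b < y - d -> G r (y - d) <= expR (g * `|d|).
  move=> byd.
  have dd : `|d| = - d by rewrite ler0_norm//; lra.
  apply: (@le_trans _ _ (expR (c * `|d|))); last by rewrite ler_expR ler_wpM2r.
  have hz := coshz (y - d) `|d| (ltW byd); rewrite dd in hz *.
  have {hz}hz : coshR (c * (y - d)) <= C * expR (c * - d) by apply: hz; lra.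
  have [rb|br] := leP r b.
    have -> : expR (c * - d) =
        alpha * expR (c * - d) + beta * (C * expR (c * - d)).
      by rewrite mulrA -mulrDl alpha_beta mul1r.
    rewrite G1// lerD// ler_wpM2l//.
    rewrite (_ : c * (r - (y - d)) = - (c * (y - d - r))) ?coshRN; last by ring.
    have h : 0 <= c * (y - d - r) by rewrite mulr_ge0 ?ltW//; lra.
    rewrite (le_trans (coshR_le_expR h))// ler_expR ler_wpM2l ?(ltW c0)//; lra.
  rewrite G2// -[leRHS]addr0 lerD//; first by rewrite ler_pdivrMr// [leRHS]mulrC.
  rewrite (_ : c * (b - (y - d)) = - (c * (y - d - b))) ?sinhRN; last by ring.
  rewrite mulrN mulNr mulrN oppr_le0.
  have h : 0 <= sinhR (c * (y - d - b)).
    by rewrite sinhR_ge0// mulr_ge0 ?subr_ge0// ltW.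
  by rewrite mulr_ge0 ?(ltW k0)// divr_ge0 ?(ltW S0)// mulr_ge0 ?expR_ge0.
have r0 := le_trans y0 yr.
case: (next_rangeP (y - d) r0) Gb => // [z0 zr Gb|t t0 zt _|rz z0 Gb].
- by rewrite ltNge ra/=.
- rewrite zt => /orP[art|bt]; last by move: b0 t0; lra.
  have t0' := ltW t0.
  apply: (@le_trans _ _ (expR (g * t))); last first.
    by rewrite ler_expR ler_wpM2l ?(ltW g0)// ger0_norm; lra.
  have ctgt : expR (c * t) <= expR (g * t) by rewrite ler_expR ler_wpM2r.
  have ct0 : 0 <= c * t by rewrite mulr_ge0// ltW.
  have cht : coshR (c * t) <= expR (g * t).
    exact: le_trans (coshR_le_expR ct0) _.
  have [rb|br] := leP r b.
    rewrite G1// opprK mulrN coshRN mulrDr.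
    have cr0 : 0 <= c * r by rewrite mulr_ge0// ltW.
    have h : coshR (c * r + c * t) <= C * expR (g * t).
      rewrite (le_trans (coshRD_le cr0 ct0))// ler_pM ?expR_ge0//.
        by rewrite ltW// coshR_gt0.
      by rewrite ler_coshR// [leRHS]mulrC ler_wpM2l// ltW.
    apply: (@le_trans _ _ ((alpha * C + beta) * expR (g * t))).
      rewrite [leRHS](_ : _ = alpha * (C * expR (g * t)) + beta * expR (g * t)).
        by rewrite lerD// ler_wpM2l.
      by ring.
    rewrite ler_piMl ?expR_ge0// alphaC_beta.
    by have := E1; have := k0; nra.
  have -> : expR (g * t) =
      expR (g * t) / C + (1 - C^-1) * expR (g * t) by ring.
  rewrite (G2N t br); apply: lerD; first by rewrite ler_wpM2r.
  rewrite ler_wpM2l ?(ltW k0)// -[leRHS]mul1r ler_pM ?expR_ge0//.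
  + by rewrite addr_ge0 ?(ltW (coshR_gt0 _))// mulr_ge0 ?sinhR_ge0// divr_ge0// ltW.
  + by rewrite expR_le1// mulr_ge0 ?subr_ge0// ltW.
  + by rewrite -gtE coshRDsinhR_le.
- by case/orP => [/(le_lt_trans ba)|]; exact: Gb.
Qed.

(* A state is a pair (range, drawdown). *)
Definition alive (s : R * R) :=
  [&& 0 <= s.2, s.2 <= s.1, s.1 <= a & s.2 <= b].

Definition next_state (s : R * R) (d : R) : R * R :=
  (next_range s.1 (s.2 - d), Num.max (s.2 - d) 0).

Lemma next_range_ge r z : r <= next_range r z.
Proof. by rewrite /next_range le_max lexx. Qed.

Lemma next_range_sub_le r y d : 0 <= y -> y <= r ->
  next_range r (y - d) - r <= `|d|.
Proof.
move=> y0 yr; have d1 := ler_norm d; have d2 : - d <= `|d|.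
  by rewrite -normrN ler_norm.
by case: (next_rangeP (y - d) (le_trans y0 yr)) => [? ?|t ? ?|? ?]; lra.
Qed.

Lemma alive_next s d : alive s ->
  alive (next_state s d) = (next_range s.1 (s.2 - d) <= a) && (s.2 - d <= b).
Proof.
case: s => r y; rewrite /alive/= => /and4P[y0 yr ra yb].
have r0 := le_trans y0 yr; have b0' := ltW b0.
case: (next_rangeP (y - d) r0) => [z0 zr|t t0 zt|rz z0].
- by rewrite z0 zr ra.
- have -> : y - d <= b.
    by rewrite zt (le_trans _ b0')// oppr_le0 ltW.
  by rewrite lexx b0' addr_ge0 ?(ltW t0)//= !andbT.
- by rewrite z0 lexx.
Qed.

(** Up to M t = eps the linear term suffices; beyond, the factor (M t / eps)^2 exceeds 1 and turns
    the square into a quartic. *)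
Lemma sqr_le_linear_quartic (M eps t x : R) : 0 <= M -> 0 < eps -> 0 <= t -> t <= x ->
  M * t ^+ 2 <= eps * t + M ^+ 3 / eps ^+ 2 * x ^+ 4.
Proof.
move=> M0 e0 t0 tx; have x4 : t ^+ 4 <= x ^+ 4.
  by rewrite ler_pXn2r// nnegrE (le_trans t0).
have Me : 0 <= M ^+ 3 / eps ^+ 2 by rewrite divr_ge0 ?sqr_ge0 ?exprn_ge0.
apply: (@le_trans _ _ (eps * t + M ^+ 3 / eps ^+ 2 * t ^+ 4)); last first.
  by rewrite lerD2l ler_wpM2l.
have [h|h] := leP (M * t) eps.
  rewrite (le_trans _ (_ : eps * t <= _))//.
    by rewrite expr2 mulrA ler_wpM2r.
  by rewrite lerDl mulr_ge0// exprn_ge0.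
rewrite (le_trans _ (_ : M ^+ 3 / eps ^+ 2 * t ^+ 4 <= _))//; last first.
  by rewrite lerDr mulr_ge0// ltW.
rewrite [leRHS](_ : _ = M * t ^+ 2 * ((M * t) ^+ 2 / eps ^+ 2)); last first.
  by field; rewrite gt_eqF.
rewrite ler_peMr ?mulr_ge0 ?sqr_ge0// ler_pdivlMr ?exprn_gt0// mul1r.
by rewrite ler_pXn2r ?nnegrE ?(ltW h)// ?ltW// (lt_trans e0).
Qed.

(* Subtracting [eps] times the range absorbs the quadratic errors of the one-step
   estimates, so that only a quartic error per step remains; a walk of variance h
   per step makes O(1/h) steps, hence a total error O(h). *)
Lemma exit_value_supersolution (eps : R) : 0 < eps -> exists2 K, 0 <= K &
  forall s d, alive s -> let s' := next_state s d in
  (if alive s' then G s'.1 s'.2 - eps * s'.1 else 1 - eps * (a + 1)) <=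
  G s.1 (s.2 - d) - eps * s.1 + K * d ^+ 4 * expR (g * `|d|).
Proof.
move=> e0; have [M M0 hM] := exit_value_step_alive.
pose L := M ^+ 3 / eps ^+ 2 + ((g ^+ 2) ^+ 3 / eps ^+ 2 + g ^+ 2).
have L1 : 0 <= M ^+ 3 / eps ^+ 2 by rewrite divr_ge0 ?exprn_ge0// ltW.
have L2 : 0 <= (g ^+ 2) ^+ 3 / eps ^+ 2.
  by rewrite divr_ge0 ?exprn_ge0// ?ltW// exprn_gt0.
have g20 : 0 <= g ^+ 2 by exact: sqr_ge0.
exists L => [|[r y] d als]; first by rewrite !addr_ge0.
cbv zeta; rewrite alive_next//=; move: als => /and4P[/= y0 yr ra yb].
have r0 := le_trans y0 yr.
set t := next_range r (y - d) - r.
have t0 : 0 <= t by rewrite subr_ge0 next_range_ge.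
have td : t <= `|d| by exact: next_range_sub_le.
have d4 : `|d| ^+ 4 = d ^+ 4 by rewrite -normrX ger0_norm// exprn_even_ge0.
have d40 : 0 <= d ^+ 4 by rewrite exprn_even_ge0.
have ed1 : 1 <= expR (g * `|d|).
  by rewrite -expR0 ler_expR mulr_ge0// ltW.
have Le : L * d ^+ 4 <= L * d ^+ 4 * expR (g * `|d|).
  by rewrite ler_peMr// mulr_ge0// !addr_ge0.
have LE : L * d ^+ 4 = M ^+ 3 / eps ^+ 2 * d ^+ 4 +
  (g ^+ 2) ^+ 3 / eps ^+ 2 * d ^+ 4 + g ^+ 2 * d ^+ 4 by rewrite /L; ring.
have p1 : 0 <= M ^+ 3 / eps ^+ 2 * d ^+ 4 by exact: mulr_ge0.
have p2 : 0 <= (g ^+ 2) ^+ 3 / eps ^+ 2 * d ^+ 4 by exact: mulr_ge0.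
have p3 : 0 <= g ^+ 2 * d ^+ 4 by exact: mulr_ge0.
have nr : next_range r (y - d) = r + t by rewrite /t; ring.
case: ifPn => [/andP[ra' zb]|].
  have := hM _ _ r0 zb ra'; rewrite -/t => /(le_trans (ler_norm _)) h.
  have := sqr_le_linear_quartic M0 e0 t0 td; rewrite d4 nr in h *; lra.
rewrite negb_and -!ltNge => dead.
have := exit_value_step_dead_ge r0 ra dead; rewrite -/t => h.
have er : eps * r <= eps * a by rewrite ler_wpM2l// ltW.
(* The killed value 1 - eps (a + 1) leaves a slack: eps a covers eps r, and the further eps covers
   eps t for t <= 1. For t > 1 the square is below the quartic. *)
have [t1|t1] := leP t 1.
  have et : eps * t <= eps by rewrite ler_piMr// ltW.
  have := sqr_le_linear_quartic g20 e0 t0 td; rewrite d4; lra.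
have t4 : g ^+ 2 * t ^+ 2 <= g ^+ 2 * d ^+ 4.
  rewrite ler_wpM2l// -d4 (@le_trans _ _ (t ^+ 4))//; first by rewrite ler_eXn2l.
  by rewrite ler_pXn2r// nnegrE.
lra.
Qed.

(** Stated for -(1 - eps) G, so that lower bounds are obtained from the same inequality as upper
    ones. *)
Lemma exit_value_subsolution (eps : R) : 0 < eps -> eps < 1 -> exists2 K, 0 <= K &
  forall s d, alive s -> let s' := next_state s d in
  (if alive s' then - (1 - eps) * G s'.1 s'.2 - eps * s'.1 else - (1 + eps * a)) <=
  - (1 - eps) * G s.1 (s.2 - d) - eps * s.1 + K * d ^+ 4 * expR (g * `|d|).
Proof.
move=> e0 e1; have [M M0 hM] := exit_value_step_alive.
pose L := M ^+ 3 / eps ^+ 2 + g ^+ 4 / eps ^+ 4.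
have L1 : 0 <= M ^+ 3 / eps ^+ 2 by rewrite divr_ge0 ?exprn_ge0// ltW.
have L2 : 0 <= g ^+ 4 / eps ^+ 4 by rewrite divr_ge0 ?exprn_ge0// ltW.
exists L => [|[r y] d als]; first by rewrite !addr_ge0.
cbv zeta; rewrite alive_next//=; move: als => /and4P[/= y0 yr ra yb].
have r0 := le_trans y0 yr.
set t := next_range r (y - d) - r.
have t0 : 0 <= t by rewrite subr_ge0 next_range_ge.
have td : t <= `|d| by exact: next_range_sub_le.
have d4 : `|d| ^+ 4 = d ^+ 4 by rewrite -normrX ger0_norm// exprn_even_ge0.
have d40 : 0 <= d ^+ 4 by rewrite exprn_even_ge0.
have gd0 : 0 <= g * `|d| by rewrite mulr_ge0// ltW.
have ed1 : 1 <= expR (g * `|d|) by rewrite -expR0 ler_expR.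
have p1 : M ^+ 3 / eps ^+ 2 * d ^+ 4 <=
    M ^+ 3 / eps ^+ 2 * d ^+ 4 * expR (g * `|d|).
  by rewrite ler_peMr// mulr_ge0.
have p2 : 0 <= g ^+ 4 / eps ^+ 4 * d ^+ 4 * expR (g * `|d|).
  by rewrite mulr_ge0 ?expR_ge0// mulr_ge0.
have p3 : 0 <= M ^+ 3 / eps ^+ 2 * d ^+ 4 by exact: mulr_ge0.
have LE : L * d ^+ 4 * expR (g * `|d|) =
  M ^+ 3 / eps ^+ 2 * d ^+ 4 * expR (g * `|d|) +
  g ^+ 4 / eps ^+ 4 * d ^+ 4 * expR (g * `|d|) by rewrite /L; ring.
have nr : next_range r (y - d) = r + t by rewrite /t; ring.
case: ifPn => [/andP[ra' zb]|].
  have := hM _ _ r0 zb ra'; rewrite -/t distrC => /(le_trans (ler_norm _)) h.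
  have := sqr_le_linear_quartic M0 e0 t0 td; rewrite d4 nr in h *.
  have : 0 <= M * t ^+ 2 by rewrite mulr_ge0// sqr_ge0.
  rewrite LE; have := ed1; nra.
rewrite negb_and -!ltNge => dead.
have := exit_value_step_dead_le y0 yr ra yb dead => h.
have er : eps * r <= eps * a by rewrite ler_wpM2l// ltW.
have h2 : (1 - eps) * expR (g * `|d|) <=
    1 + g ^+ 4 / eps ^+ 4 * d ^+ 4 * expR (g * `|d|).
  (* Small steps use (1 - eps) exp(eps) <= 1; for large ones (g|d| / eps)^4 exceeds 1 and the
     quartic term takes over. *)
  have [gde|gde] := leP (g * `|d|) eps.
    apply: (@le_trans _ _ 1); last by rewrite lerDl.
    have : expR (g * `|d|) <= expR eps by rewrite ler_expR.
    have := expR_sub1_le eps; have : 0 < 1 - eps by lra.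
    nra.
  have : 1 <= g ^+ 4 / eps ^+ 4 * d ^+ 4.
    rewrite [leRHS](_ : _ = (g * `|d|) ^+ 4 / eps ^+ 4); last first.
      by rewrite -d4; field; rewrite gt_eqF.
    rewrite ler_pdivlMr ?exprn_gt0// mul1r ler_pXn2r ?nnegrE//; exact: ltW.
  have : 0 <= eps * expR (g * `|d|) by rewrite mulr_ge0 ?expR_ge0// ltW.
  nra.
have : (1 - eps) * G r (y - d) <= (1 - eps) * expR (g * `|d|).
  by rewrite ler_wpM2l//; lra.
lra.
Qed.

End exit_value.

(** * Separation of variables in the exit probability *)

Section exit_value_decomposition.
Context {R : realType}.
Variables c a b : R.
Hypotheses (c0 : 0 < c) (b0 : 0 < b) (ba : b <= a).

Let profile (p q1 q2 q3 th u r : R) :=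
  p + if r <= b then q1 * expR (th * r) + q2 else q3 * expR (u * r).

Let measurable_profile p q1 q2 q3 th u :
  measurable_fun setT (profile p q1 q2 q3 th u).
Proof.
apply: measurable_funD => //; apply: measurable_fun_ifT.
- exact: measurable_fun_ler.
- apply: measurable_funD => //; apply: measurable_funM => //.
  by apply: measurableT_comp => //; exact: measurable_funM.
- apply: measurable_funM => //.
  by apply: measurableT_comp => //; exact: measurable_funM.
Qed.

Let profile_le p q1 q2 q3 th u r : 0 <= r -> r <= a ->
  `|profile p q1 q2 q3 th u r| <=
  `|p| + (`|q1| * expR (`|th| * a) + `|q2| + `|q3| * expR (`|u| * a)).
Proof.
move=> r0 ra; have ex v : `|expR (v * r)| <= expR (`|v| * a).
  rewrite ger0_norm ?expR_ge0// ler_expR.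
  by rewrite (le_trans (ler_norm _))// normrM ler_wpM2l// ger0_norm.
rewrite (le_trans (ler_normD _ _))// lerD2l; case: ifPn => _.
  rewrite (le_trans (ler_normD _ _))// normrM.
  by rewrite -addrA lerD ?ler_wpM2l// lerDl mulr_ge0// expR_ge0.
rewrite normrM (@le_trans _ _ (`|q3| * expR (`|u| * a)))// ?ler_wpM2l//.
by rewrite lerDr addr_ge0// mulr_ge0// expR_ge0.
Qed.

(** Separates the range from the drawdown. Averaging over the next increment then acts only on
    exp(cz) and exp(-cz), through the moment generating function, while A and B depend on the
    current state alone. *)
Lemma exit_value_decomposition : exists A B : R -> R, [/\
  measurable_fun setT A, measurable_fun setT B,
  exists M, forall r, 0 <= r -> r <= a -> `|A r| <= M /\ `|B r| <= M &
  forall r z, exit_value c a b r z = A r * expR (c * z) + B r * expR (- (c * z))].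
Proof.
pose C := coshR (b * c); pose S := sinhR (b * c).
pose g := exit_rate c b; pose k := 1 - C^-1; pose E := expR (- ((a - b) * g)).
pose A := profile (C^-1 / 2) (k * E * C / S ^+ 2 / 2) (- (k * E / S ^+ 2 / 2))
  (- (k * expR (- (a * g)) * expR (- (c * b)) / S / 2)) (- c) g.
pose B := profile (C^-1 / 2) (k * E * C / S ^+ 2 / 2) (- (k * E / S ^+ 2 / 2))
  (k * expR (- (a * g)) * expR (c * b) / S / 2) c g.
exists A, B; split => //; first exact: measurable_profile.
- exact: measurable_profile.
- pose M1 := `|C^-1 / 2| + (`|k * E * C / S ^+ 2 / 2| * expR (`|c| * a) +
    `|k * E / S ^+ 2 / 2| +
    `|k * expR (- (a * g)) * expR (- (c * b)) / S / 2| * expR (`|g| * a)).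
  pose M2 := `|C^-1 / 2| + (`|k * E * C / S ^+ 2 / 2| * expR (`|c| * a) +
    `|k * E / S ^+ 2 / 2| +
    `|k * expR (- (a * g)) * expR (c * b) / S / 2| * expR (`|g| * a)).
  exists (Num.max M1 M2) => r r0 ra; rewrite !le_max; split; apply/orP.
  + by left; rewrite (le_trans (profile_le _ _ _ _ _ _ _ _))// !normrN.
  + by right; rewrite (le_trans (profile_le _ _ _ _ _ _ _ _))// !normrN.
- move=> r z; rewrite /exit_value -/C -/S -/g /A /B /profile.
  have Cn0 : C != 0 by rewrite gt_eqF// coshR_gt0.
  have Sn0 : S != 0 by rewrite gt_eqF// sinhR_gt0// mulr_gt0.
  case: ifPn => _; rewrite -/k -/E.
  + rewrite /coshR (_ : c * (r - z) = c * r - c * z); last by ring.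
    rewrite opprB (addrC _ (- (c * r))) !expRD mulNr.
    by field; rewrite Cn0 Sn0.
  + rewrite /coshR /sinhR (_ : c * (b - z) = c * b - c * z); last by ring.
    rewrite opprB (addrC _ (- (c * b))) (_ : - ((a - r) * g) = g * r - a * g); last by ring.
    rewrite !expRD.
    by field; rewrite Cn0 Sn0.
Qed.

(** The candidate for the probability that the range is at most a and the largest drawdown at most b
    at the exponential time, for b <= a. *)
Definition range_cdf := 1 - (coshR (b * c))^-1 -
  (coshR (b * c) - 1) / (coshR (b * c) * (coshR (b * c) + 1)) *
  expR (- ((a - b) * exit_rate c b)).

Lemma exit_value0 : exit_value c a b 0 0 = 1 - range_cdf.
Proof.
rewrite /exit_value (ltW b0) subrr !mulr0 coshR0 sqr_sinhR /range_cdf.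
have C1 : 1 < coshR (b * c).
  have := sinhR_gt0 (mulr_gt0 b0 c0); have := sqr_sinhR (b * c).
  by have := coshR_ge1 (b * c); nra.
have C0 := coshR_gt0 (b * c); move: C1 C0; set C := coshR _ => C1 C0.
have h1 : C != 0 by rewrite gt_eqF.
have h2 : C + 1 != 0 by rewrite gt_eqF// addr_gt0.
have h3 : C ^+ 2 - 1 != 0 by rewrite gt_eqF//; nra.
by field; rewrite h1 h2 h3.
Qed.

End exit_value_decomposition.

Section quartic_exponential.
Context {R : realType}.
Implicit Types x g sg d : R.

Lemma quartic_le_expR x : 0 <= x -> x ^+ 4 <= 256 * expR x.
Proof.
move=> x0; have h : x / 4 <= expR (x / 4).
  by apply: le_trans (expR_ge1Dx _); lra.
have x40 : 0 <= x / 4 by lra.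
have -> : expR x = expR (x / 4) ^+ 4.
  by rewrite -expRM_natl; congr expR; field.
have : (x / 4) ^+ 4 <= expR (x / 4) ^+ 4 by rewrite ler_pXn2r// nnegrE expR_ge0.
rewrite expr_div_n.
have : (4 : R) ^+ 4 = 256 by ring.
move=> -> ; rewrite ler_pdivrMr//; lra.
Qed.

(** Replaces the quartic error by exponentials of the increment, whose expectations are known.
    Adding 1/sg to the rate is harmless for an increment of standard deviation sg, and gains the
    factor sg^4. The constant 256 is 4^4, from x/4 <= exp(x/4). *)
Lemma quartic_expR_le g sg d : 0 <= g -> 0 < sg ->
  d ^+ 4 * expR (g * `|d|) <= 256 * sg ^+ 4 *
    (expR ((g + sg^-1) * d) + expR (- ((g + sg^-1) * d))).
Proof.
move=> g0 sg0; set k := g + sg^-1.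
have k0 : 0 <= k by rewrite addr_ge0// invr_ge0 ltW.
have x0 : 0 <= `|d| / sg by rewrite divr_ge0// ltW.
have h := quartic_le_expR x0.
have d4 : d ^+ 4 = sg ^+ 4 * (`|d| / sg) ^+ 4.
  rewrite -exprMn mulrC divfK ?gt_eqF//.
  by rewrite -normrX ger0_norm// exprn_even_ge0.
have kd : expR (k * `|d|) <= expR (k * d) + expR (- (k * d)).
  have [d0|d0] := leP 0 d; first by rewrite ger0_norm// lerDl expR_ge0.
  by rewrite ltr0_norm// mulrN lerDr expR_ge0.
apply: (@le_trans _ _ (256 * sg ^+ 4 * expR (k * `|d|))); last first.
  by rewrite ler_wpM2l// mulr_ge0// exprn_ge0// ltW.
rewrite d4 (_ : k * `|d| = `|d| / sg + g * `|d|); last by rewrite /k; ring.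
rewrite expRD; set x := `|d| / sg in x0 h *; set e := expR (g * `|d|).
have e0 : 0 <= e by exact: expR_ge0.
rewrite [leRHS](_ : _ = sg ^+ 4 * (256 * expR x * e)); last by ring.
by rewrite -mulrA ler_wpM2l ?exprn_ge0 ?(ltW sg0)// ler_wpM2r.
Qed.

End quartic_exponential.

(** * Chains driven by independent variables *)

Section image_measure.
Context d1 d2 (T1 : measurableType d1) (T2 : measurableType d2) (R : realType).
Variables (m : {measure set T1 -> \bar R}) (f : T1 -> T2).
Hypothesis mf : measurable_fun setT f.

Definition image_measure : {measure set T2 -> \bar R} :=
  measure_function_pushforward__canonical__measure_function_Measure m mf.

Lemma image_measureE A : image_measure A = m (f @^-1` A).
Proof. by []. Qed.

End image_measure.

Section rectangle_uniqueness.
Context d1 d2 (T1 : measurableType d1) (T2 : measurableType d2) (R : realType).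

Lemma finite_measure_rectangle_unique
    (m1 m2 : {measure set (T1 * T2) -> \bar R}) :
  (m1 setT < +oo)%E ->
  (forall A B, measurable A -> measurable B -> m1 (A `*` B) = m2 (A `*` B)) ->
  forall X, measurable X -> m1 X = m2 X.
Proof.
move=> m1oo m12 X mX.
pose C : set (set (T1 * T2)) := [set X | exists A B,
  [/\ measurable A, measurable B & X = A `*` B]].
apply: (measure_unique C (fun _ => setT)) => //.
- rewrite measurable_prod_measurableType; congr (<<s _ >>).
  by apply/seteqP; split => [_ [A mA [B mB <-]]|_ [A [B [mA mB ->]]]];
    [exists A, B|exists A => //; exists B].
- move=> _ _ [A1 [B1 [mA1 mB1 ->]]] [A2 [B2 [mA2 mB2 ->]]].
  exists (A1 `&` A2), (B1 `&` B2); split; [exact: measurableI..|].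
  by rewrite setXI.
- by move=> _; exists setT, setT; split => //; rewrite setXTT.
- by apply/seteqP; split => // x _; exists 0%N.
- by move=> _ [A [B [mA mB ->]]]; exact: m12.
Qed.

End rectangle_uniqueness.

Section driven_chain.
Context d (Omega : measurableType d) (R : realType) (P : probability Omega R).
Context dT (T : measurableType dT).
Variables (xi : nat -> {mfun Omega >-> R}) (Phi : T * R -> T) (z0 : T).
Hypothesis mPhi : measurable_fun setT Phi.

Fixpoint driven_chain (n : nat) (w : Omega) : T :=
  if n is n'.+1 then Phi (driven_chain n' w, xi n' w) else z0.

Lemma measurable_driven_chain n : measurable_fun setT (driven_chain n).
Proof.
elim: n => [|n ih]; first exact: measurable_cst.
by apply: measurableT_comp => //; apply/measurable_fun_pairP; split.
Qed.

Hypothesis xi_independent : forall n,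
  mutually_independent P (fun i : 'I_n => xi i : Omega -> R).

Let future n m (B : nat -> set R) : set Omega :=
  \big[setI/setT]_(j < m) (xi (n + j)%N @^-1` B j).

Let measurable_future n m B : (forall j, measurable (B j)) ->
  measurable (future n m B).
Proof.
move=> mB; apply: bigsetI_measurable => j _.
by rewrite -[X in measurable X]setTI; exact: measurable_funP.
Qed.

(** The state at time n is independent of every finite block of later innovations. Quantifying over
    the block length m makes the induction work: the case of m + 1 innovations at time n gives the
    product rule on rectangles for the pair of state and next innovation. *)
Let driven_chain_future n : forall m (A : set T) (B : nat -> set R),
  measurable A -> (forall j, measurable (B j)) ->
  P (driven_chain n @^-1` A `&` future n m B) =
  (P (driven_chain n @^-1` A) * \prod_(j < m) P (xi (n + j)%N @^-1` B j))%E.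
Proof.
elim: n => [|n ih] m A B mA mB.
- rewrite /= preimage_cst; case: ifPn => _; last first.
    by rewrite set0I measure0 mul0e.
  rewrite setTI probability_setT mul1e.
  rewrite -(@xi_independent m (fun i => B i))//; congr (P _).
  rewrite /future -(bigcap_mkord _ (fun j => xi (0 + j)%N @^-1` B j)); apply/seteqP; split => w h i.
    by move=> _; exact: (h i (ltn_ord i)).
  by move=> im; exact: (h (Ordinal im)).
- pose Z := fun w => (driven_chain n w, xi n w).
  have mZ : measurable_fun setT Z.
    apply/measurable_fun_pairP; split => //; exact: measurable_driven_chain.
  have mE := measurable_future n.+1 m mB.
  (* [m1] is the law of that pair restricted to the future event, [m2] its full law times the
     probability of the event. They agree on rectangles, hence on the preimage of A under [Phi],
     which need not be a rectangle. *)
  pose m1 := image_measure (mrestr P mE) mZ.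
  have c0 : (0 <= P (future n.+1 m B))%E by exact: measure_ge0.
  have c1 : P (future n.+1 m B) \is a fin_num by exact: fin_num_measure.
  pose c : {nonneg R} := NngNum (fine_ge0 c0).
  pose m2 := mscale c (image_measure P mZ).
  have futS B' : future n m.+1 (fun j => if j is j'.+1 then B j' else B') =
      xi n @^-1` B' `&` future n.+1 m B.
    rewrite /future big_ord_recl/= addn0; congr (_ `&` _).
    by apply: eq_bigr => j _; rewrite /= /bump/= add1n addnS addSn.
  have futureE : P (future n.+1 m B) =
      (\prod_(j < m) P (xi (n.+1 + j)%N @^-1` B j))%E.
    have := ih m.+1 setT (fun j => if j is j'.+1 then B j' else setT)
      measurableT _.
    rewrite futS !preimage_setT !setTI probability_setT mul1e => ->; last first.
      by move=> [|j]//=; exact: mB.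
    rewrite big_ord_recl/= preimage_setT probability_setT mul1e.
    by apply: eq_bigr => j _; rewrite /= /bump/= add1n addnS addSn.
  have m12 X : measurable X -> m1 X = m2 X.
    apply: finite_measure_rectangle_unique.
      rewrite /m1 image_measureE /mrestr preimage_setT.
      by rewrite -ge0_fin_numE// fin_num_measure//; exact: measurableI.
    move=> A' B' mA' mB'; change (P (Z @^-1` (A' `*` B') `&` future n.+1 m B) =
      (fine (P (future n.+1 m B)))%:E * P (Z @^-1` (A' `*` B')))%E.
    have ZAB : Z @^-1` (A' `*` B') = driven_chain n @^-1` A' `&` xi n @^-1` B'.
      by apply/seteqP; split.
    pose C0 (j : nat) := if j is j'.+1 then B j' else B'.
    pose C1 (j : nat) := if j is j'.+1 then setT : set R else B'.
    have h0 : forall j, measurable (C0 j) by move=> [|j]//=; exact: mB.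
    have h1 : forall j, measurable (C1 j) by move=> [|j]/=.
    have := ih m.+1 A' C0 mA' h0; rewrite futS setIA -ZAB => ->.
    have := ih 1%N A' C1 mA' h1; rewrite /future big_ord1 addn0 -ZAB => ->.
    rewrite fineK// futureE big_ord_recl/= big_ord1/= !addn0 [RHS]muleCA.
    congr (_ * _)%E; rewrite [RHS]muleC; congr (_ * _)%E; apply: eq_bigr => j _.
    by rewrite /= /bump/= add1n addnS addSn.
  have mPA : measurable (Phi @^-1` A).
    by rewrite -[X in measurable X]setTI; exact: mPhi.
  have := m12 (Phi @^-1` A) mPA.
  change (P (driven_chain n.+1 @^-1` A `&` future n.+1 m B) =
    (fine (P (future n.+1 m B)))%:E * P (driven_chain n.+1 @^-1` A) ->
    P (driven_chain n.+1 @^-1` A `&` future n.+1 m B) =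
    P (driven_chain n.+1 @^-1` A) * \prod_(j < m) P (xi (n.+1 + j)%N @^-1` B j))%E.
  by rewrite fineK// futureE muleC.
Qed.

(** A block of one innovation identifies the law of state and innovation as a product measure, and
    Tonelli's theorem factors the integral. *)
Lemma driven_chain_expectationM n (f : T -> \bar R) (h : R -> \bar R) :
  measurable_fun setT f -> measurable_fun setT h ->
  (forall x, 0 <= f x)%E -> (forall x, 0 <= h x)%E ->
  (\int[P]_w (f (driven_chain n w) * h (xi n w)) =
   \int[P]_w f (driven_chain n w) * \int[P]_w h (xi n w))%E.
Proof.
move=> mf mh f0 h0.
have mC := measurable_driven_chain n.
have Cm : driven_chain n \in mfun by rewrite inE.
pose C : {mfun Omega >-> T} := mfun_Sub Cm.
pose Z := fun w => (driven_chain n w, xi n w).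
have mZ : measurable_fun setT Z by apply/measurable_fun_pairP; split.
pose F (x : T * R) := (f x.1 * h x.2)%E.
have mF : measurable_fun setT F.
  by apply: emeasurable_funM; exact: measurableT_comp.
have F0 x : (0 <= F x)%E by exact: mule_ge0.
have -> : (\int[P]_w (f (driven_chain n w) * h (xi n w)) =
    \int[image_measure P mZ]_x F x)%E.
  by rewrite ge0_integral_pushforward.
rewrite (eq_measure_integral (distribution P C \x distribution P (xi n))%E).
  rewrite fubini_tonelli1// /fubini_F /F/=.
  under eq_integral do rewrite ge0_integralZl//.
  rewrite ge0_integralZr//; last by apply: integral_ge0.
  by rewrite !ge0_integral_distribution.
move=> X mX _; apply/esym/product_measure_unique => // A B mA mB.
have := driven_chain_future n 1%N (B := fun _ => B) mA (fun=> mB).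
by rewrite /future big_ord1 big_ord1 addn0.
Qed.

End driven_chain.

Section integral_density.
Context d (T : measurableType d) (R : realType).
Variables (mu nu : {sigma_finite_measure set T -> \bar R}) (p : T -> R).
Hypotheses (mp : measurable_fun setT p) (p0 : forall x, 0 <= p x).
Hypothesis nuE : forall A, measurable A ->
  nu A = (\int[mu]_(x in A) (p x)%:E)%E.

(* Layer cake: [f x] is the length of [0, f x[. *)
Lemma ge0_integral_density (f : T -> R) :
  measurable_fun setT f -> (forall x, 0 <= f x) ->
  (\int[nu]_x (f x)%:E = \int[mu]_x (f x * p x)%:E)%E.
Proof.
move=> mf f0.
pose S := [set z : T * R | (0 <= z.2) && (z.2 < f z.1)].
have mS : measurable S.
  have mb : measurable_fun setT (fun z : T * R => (0 <= z.2) && (z.2 < f z.1)).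
    apply: measurable_and; first exact: measurable_fun_ler.
    by apply: measurable_fun_ltr => //; exact: measurableT_comp.
  have mtrue : measurable [set true] by [].
  have := mb measurableT [set true] mtrue; rewrite setTI.
  by congr measurable; apply/seteqP; split => z /=.
have m1S : measurable_fun setT (fun z : T * R => (\1_S z)%:E : \bar R).
  exact/measurable_EFinP/measurable_indic.
have fE x : (f x)%:E = (\int[lebesgue_measure]_t (\1_S (x, t))%:E)%E.
  have -> : (fun t : R => (\1_S (x, t) : R)%:E) = (fun t => (\1_(`[0, f x[) t)%:E).
    apply/funext => t; rewrite !indicE.
    suff -> : ((x, t) \in S) = (t \in `[0, f x[%classic) by [].
    by apply/idP/idP; rewrite !inE.
  rewrite integral_indic//= setIT lebesgue_measure_itv/= lte_fin.
  by case: ltP => [|fx0]; [rewrite oppr0 addr0|apply/eqP; rewrite eqe eq_le fx0 f0].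
transitivity (\int[nu]_x \int[lebesgue_measure]_t (\1_S (x, t))%:E)%E.
  by apply: eq_integral => x _; rewrite fE.
rewrite (@fubini_tonelli _ _ _ _ _ nu lebesgue_measure (fun z => (\1_S z)%:E))//.
transitivity (\int[lebesgue_measure]_t \int[mu]_x (\1_S (x, t) * p x)%:E)%E.
  apply: eq_integral => t _.
  have mSt : measurable (ysection S t) by exact: measurable_ysection.
  have E x : \1_S (x, t) = \1_(ysection S t) x :> R.
    by rewrite !indicE mem_ysection.
  under eq_integral do rewrite E.
  rewrite integral_indic// setIT.
  transitivity (\int[mu]_(x in ysection S t) (p x)%:E)%E; first exact: nuE.
  rewrite integral_mkcond.
  apply: eq_integral => x _; rewrite E patchE indicE.
  by case: ifPn => _; rewrite ?mul1r ?mul0r.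
rewrite -(@fubini_tonelli _ _ _ _ _ mu lebesgue_measure
  (fun z => (\1_S z * p z.1)%:E))//.
- apply: eq_integral => x _.
  under eq_integral do rewrite EFinM muleC/=.
  rewrite ge0_integralZl//.
  + by rewrite -fE -EFinM mulrC.
  + exact: (measurableT_comp m1S (pair1_measurable x)).
  + by rewrite lee_fin.
- apply/measurable_EFinP/measurable_funM; first exact: measurable_indic.
  exact: measurableT_comp.
- by move=> z; rewrite lee_fin mulr_ge0.
Qed.

End integral_density.

Section normal_mgf.
Context {R : realType}.

Lemma normal_mgf (sg th : R) : 0 < sg ->
  (\int[normal_prob 0 sg]_x (expR (th * x))%:E =
  (expR (th ^+ 2 * sg ^+ 2 / 2))%:E)%E.
Proof.
move=> sg0; have sgn0 : sg != 0 by rewrite gt_eqF.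
rewrite (@ge0_integral_density _ _ _ lebesgue_measure (normal_prob 0 sg)
  (normal_pdf 0 sg)) //; last first.
- by apply: measurableT_comp => //; exact: measurable_funM.
- by move=> x; exact: normal_pdf_ge0.
- exact: measurable_normal_pdf.
under eq_integral => x _.
  (* Completing the square: the exponential tilt moves the mean to th sg^2. *)
  rewrite (_ : expR _ * _ =
    expR (th ^+ 2 * sg ^+ 2 / 2) * normal_pdf (th * sg ^+ 2) sg x); last first.
    rewrite !normal_pdfE// mulrCA [RHS]mulrCA; congr (_ * _).
    rewrite /normal_fun -!expRD; congr expR.
    by field.
  rewrite EFinM.
  over.
rewrite ge0_integralZl//.
- by rewrite integral_normal_pdf mule1.
- by apply/measurable_EFinP; exact: measurable_normal_pdf.
- by move=> x _; rewrite lee_fin normal_pdf_ge0.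
Qed.

End normal_mgf.

(** * Killed Gaussian walks *)

Section increment_mgf.
Context d (Omega : measurableType d) (R : realType) (P : probability Omega R).

Lemma mgf_normal_law (Y : {mfun Omega >-> R}) (sg th : R) : 0 < sg ->
  (forall A : set R, measurable A -> P (Y @^-1` A) = normal_prob 0 sg A) ->
  (\int[P]_w (expR (th * Y w))%:E = (expR (th ^+ 2 * sg ^+ 2 / 2))%:E)%E.
Proof.
move=> sg0 Y_normal; rewrite -normal_mgf//.
have mY : @measurable_fun _ _ Omega (measurableTypeR R) setT Y.
  exact: (measurable_funPT Y).
rewrite [RHS](@eq_measure_integral _ (measurableTypeR R) R setT
    (image_measure P mY)); last first.
  by move=> A mA _; exact/esym/Y_normal.
rewrite ge0_integral_pushforward//.
apply/measurable_EFinP; apply: measurableT_comp => //; exact: measurable_funM.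
Qed.

End increment_mgf.

Section killed_walk.
Context d (Omega : measurableType d) (R : realType) (P : probability Omega R).
Variables c a b : R.

(** A state outside the region is kept unchanged, so being alive at time n records survival at all
    earlier times. *)
Definition killed_step (x : (R * R) * R) : R * R :=
  if alive a b x.1 then next_state x.1 x.2 else x.1.

Definition killed_walk (xi : nat -> {mfun Omega >-> R}) :=
  driven_chain xi killed_step (0, 0).

Lemma measurable_alive : measurable_fun setT (alive a b).
Proof.
by do ![apply: measurable_and]; exact: measurable_fun_ler.
Qed.

Lemma measurable_killed_step : measurable_fun setT killed_step.
Proof.
apply: measurable_fun_ifT; last exact: measurable_fst.
- exact: (measurableT_comp measurable_alive measurable_fst).
- have m1 : measurable_fun setT (fun x : (R * R) * R => x.1.1).
    exact: (measurableT_comp measurable_fst measurable_fst).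
  have m2 : measurable_fun setT (fun x : (R * R) * R => x.1.2 - x.2).
    apply: measurable_funB; last exact: measurable_snd.
    exact: (measurableT_comp measurable_snd measurable_fst).
  apply/measurable_fun_pairP; split; last exact: measurable_maxr.
  apply: measurable_maxr => //; apply: measurable_maxr => //.
  exact: measurable_funB.
Qed.

Variables (sg : R) (xi : nat -> {mfun Omega >-> R}).
Hypothesis xi_independent : forall n,
  mutually_independent P (fun i : 'I_n => xi i : Omega -> R).
Hypothesis xi_mgf : forall i th, (\int[P]_w (expR (th * xi i w))%:E =
  (expR (th ^+ 2 * sg ^+ 2 / 2))%:E)%E.

Let S := killed_walk xi.

Let mS n : measurable_fun setT (S n).
Proof. by apply: measurable_driven_chain; exact: measurable_killed_step. Qed.

Let mexp n th : measurable_fun setT (fun w => expR (th * xi n w)).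
Proof. by apply: measurableT_comp => //; exact: measurable_funM. Qed.

Let integrable_exp n th : P.-integrable setT (fun w => (expR (th * xi n w))%:E).
Proof.
apply/integrableP; split; first exact/measurable_EFinP.
under eq_integral do rewrite gee0_abs ?lee_fin ?expR_ge0//.
by rewrite xi_mgf ltry.
Qed.

Variables (z : R * R -> R) (M : R).
Hypotheses (mz : measurable_fun setT z) (zM : forall s, `|z s| <= M).

Let M0 : 0 <= M. Proof. exact: le_trans (zM (0, 0)). Qed.

Lemma integrable_killed_walk n th :
  P.-integrable setT (fun w => (z (S n w) * expR (th * xi n w))%:E).
Proof.
apply: (@le_integrable _ _ _ P setT measurableT _
  (fun w => M%:E * (expR (th * xi n w))%:E)%E).
- apply/measurable_EFinP; apply: measurable_funM => //.
  exact: measurableT_comp.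
- move=> w _; rewrite -EFinM !abse_EFin lee_fin !normrM.
  by rewrite (ger0_norm M0) ler_wpM2r.
- exact: integrableZl.
Qed.

Lemma Rintegral_killed_walk n th :
  (\int[P]_w (z (S n w) * expR (th * xi n w)) =
   (\int[P]_w z (S n w)) * expR (th ^+ 2 * sg ^+ 2 / 2))%R.
Proof.
(* The factorization is available for nonnegative functions, so z is shifted by its bound M; the
   contribution of the constant cancels at the end. *)
have mf : measurable_fun setT (fun s => (z s + M)%:E).
  by apply/measurable_EFinP; exact: measurable_funD.
have mh : measurable_fun setT (fun x : R => (expR (th * x))%:E).
  apply/measurable_EFinP; apply: measurableT_comp => //; exact: measurable_funM.
have f0 s : (0 <= (z s + M)%:E)%E.
  by rewrite lee_fin -lerBlDr sub0r; have := zM s; rewrite ler_norml => /andP[].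
have h0 (x : R) : (0 <= (expR (th * x))%:E)%E by rewrite lee_fin expR_ge0.
have := @driven_chain_expectationM _ Omega R P _ _ xi killed_step (0, 0)
  measurable_killed_step xi_independent n _ _ mf mh f0 h0.
rewrite -/(killed_walk xi) -/S xi_mgf => h.
have iz : P.-integrable setT (EFin \o (fun w => z (S n w))).
  have := integrable_killed_walk n 0; apply: eq_integrable => // w _ /=.
  by rewrite mul0r expR0 mulr1.
have icst : P.-integrable setT (EFin \o (cst M : Omega -> R)).
  exact: finite_measure_integrable_cst.
have ie : P.-integrable setT (EFin \o (fun w => expR (th * xi n w))).
  exact: integrable_exp.
have iMe : P.-integrable setT (EFin \o (fun w => M * expR (th * xi n w))).
  exact: (integrableZl measurableT M ie).
have ize := integrable_killed_walk n th.
have := congr1 fine h; rewrite fineM//; last first.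
  exact: (integrable_fin_num _ (integrableD _ iz icst)).
have -> : fine (\int[P]_w ((z (S n w) + M)%:E * (expR (th * xi n w))%:E)) =
    (\int[P]_w (z (S n w) * expR (th * xi n w)))%R + M * expR (th ^+ 2 * sg ^+ 2 / 2).
  have -> : expR (th ^+ 2 * sg ^+ 2 / 2) = (\int[P]_w (expR (th * xi n w)))%R.
    by rewrite /Rintegral xi_mgf.
  rewrite -RintegralZl// -RintegralD//; congr fine.
  by apply: eq_integral => w _; rewrite -EFinM mulrDl.
have -> : fine (\int[P]_w (z (S n w) + M)%:E) = (\int[P]_w z (S n w))%R + M.
  rewrite [RHS](_ : _ = (\int[P]_w z (S n w) + \int[P]_w (cst M w))%R).
    by rewrite -RintegralD.
  by rewrite /cst Rintegral_cst//= probability_setT mulr1.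
by rewrite mulrDl => /addIr.
Qed.

End killed_walk.

Section discounted_sum.
Context {R : realType}.

(** A i is the survival probability, B i the mean of the test function over the survivors, v the
    payoff at killing and 1/m the discount per step. The left-hand side is, up to the truncation at
    n, the discounted payoff. Weighting step i by m^-(i+1) makes the inequalities telescope; the
    weights sum to at most 1/(m - 1), which turns the errors (m - 1) x + y into x + y/(m - 1). *)
Lemma discounted_sum_le (A B : nat -> R) (m v x y N : R) : 1 < m ->
  A 0%N = 1 -> (forall i, 0 <= A i <= 1) -> (forall i, `|B i| <= N) -> 0 <= x -> 0 <= y ->
  (forall i, B i.+1 + v * (A i - A i.+1) <= m * B i + (m - 1) * x + y) ->
  forall n, v * (1 - (1 - m^-1) * \sum_(i < n) m^-1 ^+ i * A i) <=
    B 0%N + x + y / (m - 1) + (N + `|v|) * m^-1 ^+ n.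
Proof.
move=> m1 A0 A01 BN x0 y0 step n; set q := m^-1.
have m0 : 0 < m by rewrite (lt_trans _ m1).
have mq : m * q = 1 by rewrite /q divff// gt_eqF.
have q0 : 0 < q by rewrite invr_gt0.
pose z := y / (m - 1).
have z0 : 0 <= z by rewrite divr_ge0// subr_ge0 ltW.
have yz : y = z * (m - 1) by rewrite /z divfK// subr_eq0 gt_eqF.
(* The terms still alive at time n are kept for the induction and bounded only afterwards. *)
have main : q ^+ n * B n + v * (1 - (1 - q) * (\sum_(i < n) q ^+ i * A i) -
    q ^+ n * A n) <= B 0%N + (x + z) * (1 - q ^+ n).
  elim: n => [|n ih].
    by rewrite big_ord0 !expr0 A0 !mulr0 !mul1r !subr0 subrr !mulr0 !addr0.
  rewrite big_ord_recr/=; move: ih; set s := \sum_(i < n) _ => ih.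
  have qn : 0 <= q ^+ n.+1 by rewrite exprn_ge0// ltW.
  have := ler_wpM2l qn (step n); rewrite yz.
  have qm : q ^+ n.+1 * m = q ^+ n by rewrite exprSr -mulrA (mulrC q) mq mulr1.
  set Q := q ^+ n.+1 in qm *; set Pn := q ^+ n in qm ih *.
  have qP : q * Pn = Q by rewrite /Q /Pn exprS.
  rewrite (_ : Q * (m * B n + (m - 1) * x + z * (m - 1)) =
    Pn * B n + (Pn - Q) * (x + z)); last by rewrite -qm; ring.
  rewrite (_ : (1 - q) * (s + Pn * A n) = (1 - q) * s + (Pn - Q) * A n); last first.
    by rewrite -qP; ring.
  lra.
have qn0 : 0 <= q ^+ n by rewrite exprn_ge0// ltW.
have h1 : - (N * q ^+ n) <= q ^+ n * B n.
  by rewrite mulrC -mulrN ler_wpM2l// lerNl (le_trans _ (BN n))// -normrN ler_norm.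
have h2 : - (`|v| * q ^+ n) <= - (v * (q ^+ n * A n)).
  rewrite lerN2 mulrC [leRHS]mulrC -mulrA ler_wpM2l//.
  rewrite (le_trans (ler_norm _))// normrM ler_piMl//.
  by have /andP[A0' A1] := A01 n; rewrite ger0_norm.
have h3 : (x + z) * (1 - q ^+ n) <= x + z.
  by rewrite ler_piMr ?addr_ge0// gerBl.
move: main h1 h2 h3; rewrite -/z; set s := \sum_(i < n) _; lra.
Qed.

End discounted_sum.

Section killed_walk_bound.
Local Opaque exit_value next_state exit_rate.
Context d (Omega : measurableType d) (R : realType) (P : probability Omega R).
Variables c a b : R.
Hypotheses (c0 : 0 < c) (b0 : 0 < b) (ba : b <= a).
Local Notation G := (exit_value c a b).
Local Notation g := (exit_rate c b).

(** Gaussianity is recorded through the moment generating function, since every expectation to be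
    computed is that of a function of the state times an exponential of the next increment. *)
Definition gaussian_walk (sg : R) (xi : nat -> {mfun Omega >-> R}) := [/\ 0 < sg,
  forall n, mutually_independent P (fun i : 'I_n => xi i : Omega -> R) &
  forall i th, (\int[P]_w (expR (th * xi i w))%:E =
    (expR (th ^+ 2 * sg ^+ 2 / 2))%:E)%E].

Definition survival xi n : R :=
  fine (P [set w | alive a b (killed_walk a b xi n w)]).

(** One hypothesis for both test functions: t = 1, v = 1 - eps (a + 1) for the supersolution, and t
    = -(1 - eps), v = -(1 + eps a) for the subsolution. *)
Variables t eps v K : R.
Hypotheses (eps0 : 0 <= eps) (K0 : 0 <= K).
Hypothesis test : forall s x, alive a b s ->
  (if alive a b (next_state s x)
   then t * G (next_state s x).1 (next_state s x).2 - eps * (next_state s x).1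
   else v) <=
  t * G s.1 (s.2 - x) - eps * s.1 + K * x ^+ 4 * expR (g * `|x|).

Let a0 : 0 <= a. Proof. exact: le_trans (ltW b0) ba. Qed.

Let g0 : 0 < g.
Proof. by rewrite exit_rateE mulr_gt0// divr_gt0 ?coshR_gt0// sinhR_gt0// mulr_gt0. Qed.

(** Cutting off outside the region makes the test functions bounded. *)
Let al (f : R * R -> R) s := if alive a b s then f s else 0.

Let measurable_al (f : R * R -> R) : measurable_fun setT f -> measurable_fun setT (al f).
Proof. by move=> mf; apply: measurable_fun_ifT => //; exact: measurable_alive. Qed.

Let al_le f (M : R) : 0 <= M -> (forall s, alive a b s -> `|f s| <= M) ->
  forall s, `|al f s| <= M.
Proof. by move=> M0 fM s; rewrite /al; case: ifPn => [/fM//|]; rewrite normr0. Qed.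

Let mfst : measurable_fun setT (fun s : R * R => s.1).
Proof. exact: measurable_fst. Qed.

Let msnd : measurable_fun setT (fun s : R * R => s.2).
Proof. exact: measurable_snd. Qed.

Section walk.
Variables (sg : R) (xi : nat -> {mfun Omega >-> R}).
Hypothesis gw : gaussian_walk sg xi.
Let S := killed_walk a b xi.
Let sg0 : 0 < sg. Proof. by case: gw. Qed.
Let xi_independent : forall n,
  mutually_independent P (fun i : 'I_n => xi i : Omega -> R).
Proof. by case: gw. Qed.
Let xi_mgf : forall i th, (\int[P]_w (expR (th * xi i w))%:E =
  (expR (th ^+ 2 * sg ^+ 2 / 2))%:E)%E.
Proof. by case: gw. Qed.

Let integrable_S n (f : R * R -> R) (M : R) : measurable_fun setT f -> (forall s, `|f s| <= M) ->
  P.-integrable setT (fun w => (f (S n w))%:E).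
Proof.
move=> mf fM; have := integrable_killed_walk a b xi_mgf mf fM n 0.
by apply: eq_integrable => // w _ /=; rewrite mul0r expR0 mulr1.
Qed.

Let Rintegral_S_le n (f : R * R -> R) (M : R) : measurable_fun setT f ->
  (forall s, `|f s| <= M) -> `|(\int[P]_w f (S n w))%R| <= M.
Proof.
move=> mf fM; have fi := integrable_S n mf fM.
rewrite (le_trans (le_normr_Rintegral measurableT fi))//.
rewrite (@le_trans _ _ (\int[P]_w (cst M w))%R)//; last first.
  by rewrite /cst Rintegral_cst//= probability_setT mulr1.
apply: le_Rintegral => //; first by have /integrable_norm := fi.
exact: finite_measure_integrable_cst.
Qed.

Let SE n w : S n.+1 w = if alive a b (S n w) then next_state (S n w) (xi n w)
  else S n w.
Proof. by []. Qed.

Let W := al (fun s => t * G s.1 s.2 - eps * s.1).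
Let I := al (fun=> 1).

Let IE n w : I (S n w) = (alive a b (S n w))%:R.
Proof. by rewrite /I /al; case: ifP. Qed.

Let k := g + sg^-1.
Let L := K * (256 * sg ^+ 4).

(** The pointwise inequality in the form needed for expectations: each summand on the right is a
    bounded function of the current state times an exponential of the next increment. The exponent 0
    accommodates the range term. *)
Lemma killed_walk_step (u v' : R -> R) n w :
  (forall r z, G r z = u r * expR (c * z) + v' r * expR (- (c * z))) ->
  W (S n.+1 w) + v * (I (S n w) - I (S n.+1 w)) <=
  al (fun s => t * u s.1 * expR (c * s.2)) (S n w) * expR (- c * xi n w) +
  al (fun s => t * v' s.1 * expR (- c * s.2)) (S n w) * expR (c * xi n w) +
  al (fun=> L) (S n w) * expR (k * xi n w) +
  al (fun=> L) (S n w) * expR (- k * xi n w) +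
  al (fun s => - (eps * s.1)) (S n w) * expR (0 * xi n w).
Proof.
move=> GE; rewrite SE /W /I /al; case: (boolP (alive a b (S n w))) => als /=; last first.
  by rewrite (negbTE als) subrr mulr0 !mul0r !addr0.
have := test (xi n w) als; rewrite [in leRHS]GE.
set s := S n w; set x := xi n w; set s' := next_state s x => h.
have h2 := quartic_expR_le x (ltW g0) sg0; rewrite -/k in h2.
have {h2} := ler_wpM2l K0 h2; rewrite mulrA => h2.
have -> : t * u s.1 * expR (c * s.2) * expR (- c * x) =
    t * (u s.1 * expR (c * (s.2 - x))).
  by rewrite (_ : c * (s.2 - x) = c * s.2 + - c * x) ?expRD; ring.
have -> : t * v' s.1 * expR (- c * s.2) * expR (c * x) =
    t * (v' s.1 * expR (- (c * (s.2 - x)))).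
  by rewrite (_ : - (c * (s.2 - x)) = - c * s.2 + c * x) ?expRD; ring.
have eL : K * (256 * sg ^+ 4 * (expR (k * x) + expR (- (k * x)))) =
  L * expR (k * x) + L * expR (- k * x) by rewrite /L mulNr; ring.
rewrite mul0r expR0 mulr1; move: h h2; rewrite eL mulrDr.
by case: (alive a b s'); lra.
Qed.

Let survivalE n : survival xi n = (\int[P]_w I (S n w))%R.
Proof.
pose D := [set w | alive a b (S n w)].
have mD : measurable D.
  have mtrue : measurable [set true] by [].
  have mf : measurable_fun setT (fun w => alive a b (S n w)).
    apply: measurableT_comp; first exact: measurable_alive.
    by apply: measurable_driven_chain; exact: measurable_killed_step.
  by have := mf measurableT _ mtrue; rewrite setTI.
transitivity (fine (\int[P]_w (\1_D w)%:E)); first by rewrite integral_indic// setIT.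
congr fine; apply: eq_integral => w _; rewrite IE indicE.
by suff -> : (w \in D) = alive a b (S n w) by []; apply/idP/idP; rewrite inE.
Qed.

Variables (u v' : R -> R) (M : R).
Hypotheses (mu : measurable_fun setT u) (mv : measurable_fun setT v')
  (uvM : forall r, 0 <= r -> r <= a -> `|u r| <= M /\ `|v' r| <= M)
  (GE : forall r z, G r z = u r * expR (c * z) + v' r * expR (- (c * z))).

Let M0 : 0 <= M.
Proof. by have [h _] := uvM (lexx 0) a0; exact: le_trans h. Qed.

Let N := `|t| * M * expR (c * b).

Let N0 : 0 <= N. Proof. by rewrite !mulr_ge0// expR_ge0. Qed.

Let f1 := al (fun s => t * u s.1 * expR (c * s.2)).
Let f2 := al (fun s => t * v' s.1 * expR (- c * s.2)).
Let f3 := al (fun=> L).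
Let f4 := al (fun s => - (eps * s.1)).

Let mf1 : measurable_fun setT f1.
Proof.
apply: measurable_al; apply: measurable_funM.
  by apply: measurable_funM => //; exact: measurableT_comp.
by apply: measurableT_comp => //; exact: measurable_funM.
Qed.

Let mf2 : measurable_fun setT f2.
Proof.
apply: measurable_al; apply: measurable_funM.
  by apply: measurable_funM => //; exact: measurableT_comp.
by apply: measurableT_comp => //; exact: measurable_funM.
Qed.

Let mf3 : measurable_fun setT f3.
Proof. exact: measurable_al. Qed.

Let mf4 : measurable_fun setT f4.
Proof. by apply: measurable_al; apply: measurable_funN; exact: measurable_funM. Qed.

Let f1N s : `|f1 s| <= N.
Proof.
apply: al_le => // {}s /and4P[y0 yr ra yb].
have [h _] := uvM (le_trans y0 yr) ra.
rewrite !normrM /N ler_pM// ?mulr_ge0//; first by rewrite ler_wpM2l.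
by rewrite ger0_norm ?expR_ge0// ler_expR ler_wpM2l// ltW.
Qed.

Let f2N s : `|f2 s| <= N.
Proof.
apply: al_le => // {}s /and4P[y0 yr ra yb].
have [_ h] := uvM (le_trans y0 yr) ra.
rewrite !normrM /N ler_pM// ?mulr_ge0//; first by rewrite ler_wpM2l.
rewrite ger0_norm ?expR_ge0// ler_expR mulNr (@le_trans _ _ 0)//.
  by rewrite oppr_le0 mulr_ge0// ltW.
by rewrite mulr_ge0// ltW.
Qed.

Let L0 : 0 <= L.
Proof.
exact: mulr_ge0 K0 (mulr_ge0 (ler0n _ 256) (exprn_ge0 _ (ltW sg0))).
Qed.

Let f3N s : `|f3 s| <= L.
Proof. by apply: al_le => // _ _; rewrite ger0_norm. Qed.

Let f4N s : `|f4 s| <= eps * a.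
Proof.
apply: al_le => [|{}s /and4P[y0 yr ra yb]]; first by rewrite mulr_ge0.
have r0 := le_trans y0 yr.
by rewrite normrN ger0_norm ?mulr_ge0// ler_wpM2l.
Qed.

Let WE s : W s = f1 s + f2 s + f4 s.
Proof.
rewrite /W /f1 /f2 /f4 /al GE mulNr; case: ifP => _; last by rewrite !addr0.
by ring.
Qed.

Let mW : measurable_fun setT W.
Proof.
rewrite (_ : W = (fun s => f1 s + f2 s + f4 s)); last by apply/funext => s; exact: WE.
by apply: measurable_funD => //; exact: measurable_funD.
Qed.

Let WN s : `|W s| <= N + N + eps * a.
Proof. by rewrite WE (le_trans (ler_normD _ _))// lerD// (le_trans (ler_normD _ _))// lerD. Qed.

Let mI : measurable_fun setT I.
Proof. exact: measurable_al. Qed.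

Let I1 s : `|I s| <= 1.
Proof. by apply: al_le => // _ _; rewrite normr1. Qed.

Let iW n : P.-integrable setT (EFin \o (fun w => W (S n w))).
Proof. exact: (integrable_S n mW WN). Qed.

Let iI n : P.-integrable setT (EFin \o (fun w => I (S n w))).
Proof. exact: (integrable_S n mI I1). Qed.

Lemma killed_walk_value_le n : `|(\int[P]_w W (S n w))%R| <= N + N + eps * a.
Proof.
exact: Rintegral_S_le mW WN.
Qed.

(** The exponentials with rates c and -c have the same mean m, so the part of [W] coming from G is
    multiplied exactly by m. The range term is multiplied by 1; replacing that by m costs at most (m
    - 1) eps a. *)
Lemma killed_walk_step_le n :
  let m := expR (c ^+ 2 * sg ^+ 2 / 2) in
  (\int[P]_w W (S n.+1 w))%R + v * (survival xi n - survival xi n.+1) <=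
  m * (\int[P]_w W (S n w))%R + (m - 1) * (eps * a) +
  2 * L * expR (k ^+ 2 * sg ^+ 2 / 2).
Proof.
cbv zeta; set m := expR _; set mk := expR (k ^+ 2 * _ / 2).
have J (f : R * R -> R) (M' th : R) (mf : measurable_fun setT f) (fM : forall s, `|f s| <= M') :
    P.-integrable setT (EFin \o (fun w => f (S n w) * expR (th * xi n w))).
  exact: (integrable_killed_walk a b xi_mgf mf fM).
have JE (f : R * R -> R) (M' th : R) (mf : measurable_fun setT f) (fM : forall s, `|f s| <= M') :
    (\int[P]_w (f (S n w) * expR (th * xi n w)) =
     (\int[P]_w f (S n w)) * expR (th ^+ 2 * sg ^+ 2 / 2))%R.
  exact: (Rintegral_killed_walk a b xi_independent xi_mgf mf fM).
have iD (f1' f2' : Omega -> R) : P.-integrable setT (EFin \o f1') ->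
    P.-integrable setT (EFin \o f2') ->
    P.-integrable setT (EFin \o (fun w => f1' w + f2' w : R)).
  by move=> i1 i2; exact: (integrableD measurableT i1 i2).
have j1 := J f1 N (- c) mf1 f1N; have j2 := J f2 N c mf2 f2N.
have j3 := J f3 L k mf3 f3N; have j3' := J f3 L (- k) mf3 f3N.
have j4 := J f4 (eps * a) 0 mf4 f4N.
have iIB : P.-integrable setT (EFin \o (fun w => v * (I (S n w) - I (S n.+1 w)))).
  apply: (integrableZl measurableT v (f := EFin \o (fun w => I (S n w) - I (S n.+1 w)))).
  exact: (integrableB measurableT (iI n) (iI n.+1)).
have j12 := iD _ _ j1 j2; have j123 := iD _ _ j12 j3.
have j1233 := iD _ _ j123 j3'.
have := le_Rintegral measurableT (iD _ _ (iW n.+1) iIB) (iD _ _ j1233 j4)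
  (fun w _ => killed_walk_step n w GE).
rewrite !RintegralD//.
rewrite RintegralZl//; last exact: (integrableB measurableT (iI n) (iI n.+1)).
rewrite RintegralB// -!survivalE.
rewrite (JE f1 N)// (JE f2 N)// (JE f3 L)// (JE f3 L)// (JE f4 (eps * a))//.
rewrite !sqrrN expr0n/= !mul0r expR0 mulr1 -/m -/mk.
move=> /le_trans; apply.
have -> : (\int[P]_w W (S n w) = \int[P]_w f1 (S n w) + \int[P]_w f2 (S n w) +
    \int[P]_w f4 (S n w))%R.
  rewrite -!RintegralD//; do ?[exact: (integrable_S n _ f1N)
    |exact: (integrable_S n _ f2N)|exact: (integrable_S n _ f4N)].
    by apply: eq_Rintegral => w _; rewrite WE.
  by apply: iD; [exact: (integrable_S n _ f1N)|exact: (integrable_S n _ f2N)].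
have := Rintegral_S_le n mf3 f3N; rewrite ler_norml => /andP[_ h3].
have := Rintegral_S_le n mf4 f4N; rewrite ler_norml => /andP[h4 _].
have m1 : 1 <= m.
  by rewrite -expR0 ler_expR divr_ge0// mulr_ge0// sqr_ge0.
have mk0 : 0 <= mk by exact: expR_ge0.
have m10 : 0 <= m - 1 by rewrite subr_ge0.
have := ler_wpM2r mk0 h3; have := ler_wpM2l m10 h4.
lra.
Qed.

Lemma survival_ge0_le1 n : 0 <= survival xi n <= 1.
Proof.
rewrite survivalE; apply/andP; split.
  by apply: Rintegral_ge0 => w _; rewrite IE.
exact: le_trans (ler_norm _) (Rintegral_S_le n mI I1).
Qed.

End walk.

(** The constant must not depend on sg. The quartic error per step is O(sg^4), and the discounted
    number of steps 1/(m - 1) is at most 2/(c sg)^2, so O(sg^2) remains. *)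
Lemma killed_walk_bound : exists2 K', 0 <= K' &
  forall sg (xi : nat -> {mfun Omega >-> R}), gaussian_walk sg xi -> sg <= 1 ->
  let q := expR (- (c ^+ 2 * sg ^+ 2 / 2)) in
  forall n, v * (1 - (1 - q) * \sum_(i < n) q ^+ i * survival xi i) <=
    t * G 0 0 + eps * a + K' * (sg ^+ 2 + q ^+ n).
Proof.
have [u [v' [mu mv [M uvM] GE]]] := @exit_value_decomposition R c a b c0 b0.
have [M0 _] := uvM 0 (lexx 0) a0.
pose N := `|t| * M * expR (c * b).
(* The total quartic error divided by sg^2; its exponential bounds the mean at rate g + 1/sg,
   because (g sg + 1)^2 <= (g + 1)^2 for sg <= 1. The next constant bounds the remainder at time
   n. *)
pose K1 := 4 * (K * 256) * expR ((g + 1) ^+ 2 / 2) / c ^+ 2.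
pose K2 := N + N + eps * a + `|v|.
have N0 : 0 <= N by rewrite !mulr_ge0// ?expR_ge0// (le_trans _ M0).
have K10 : 0 <= K1.
  apply: divr_ge0 (sqr_ge0 _); apply: mulr_ge0 (expR_ge0 _).
  exact: mulr_ge0 (ler0n _ 4) (mulr_ge0 K0 (ler0n _ 256)).
have K20 : 0 <= K2 by rewrite !addr_ge0// mulr_ge0.
exists (K1 + K2) => [|sg xi gw sg1 q n]; first exact: addr_ge0.
have sg0 : 0 < sg by case: gw.
pose m := expR (c ^+ 2 * sg ^+ 2 / 2).
have qE : q = m^-1 by rewrite /q expRN.
have cs : 0 < c ^+ 2 * sg ^+ 2 / 2 by rewrite divr_gt0// mulr_gt0// exprn_gt0.
have m1 : 1 < m by rewrite -expR0 ltr_expR.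
have alive0 : alive a b (0, 0) by rewrite /alive/= lexx a0 ltW.
have A0 : survival xi 0 = 1.
  rewrite /survival (_ : [set _ | _] = setT) ?probability_setT//.
  by apply/seteqP; split => w.
pose B n := (\int[P]_w (al (fun s => t * G s.1 s.2 - eps * s.1)
  (killed_walk a b xi n w)))%R.
have BN i : `|B i| <= N + N + eps * a.
  exact: (killed_walk_value_le gw mu mv uvM GE).
pose y := 2 * (K * (256 * sg ^+ 4)) * expR ((g + sg^-1) ^+ 2 * sg ^+ 2 / 2).
have K256 : 0 <= K * (256 * sg ^+ 4).
  exact: mulr_ge0 K0 (mulr_ge0 (ler0n _ 256) (exprn_ge0 _ (ltW sg0))).
have y0 : 0 <= y.
  by apply: mulr_ge0 (expR_ge0 _); exact: mulr_ge0 (ler0n _ 2) K256.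
have step i : B i.+1 + v * (survival xi i - survival xi i.+1) <=
    m * B i + (m - 1) * (eps * a) + y.
  exact: (killed_walk_step_le gw mu mv uvM GE).
have ea0 : 0 <= eps * a by rewrite mulr_ge0.
have h := discounted_sum_le m1 A0 (survival_ge0_le1 gw) BN ea0 y0 step n.
rewrite -qE in h; apply: le_trans h _.
have -> : B 0%N = t * G 0 0.
  rewrite /B /killed_walk/= /al alive0/= mulr0 subr0 Rintegral_cst//=.
  by rewrite probability_setT mulr1.
rewrite -!addrA !lerD2l.
have q0 : 0 <= q ^+ n by rewrite exprn_ge0// expR_ge0.
have -> : (K1 + K2) * (sg ^+ 2 + q ^+ n) =
  K1 * sg ^+ 2 + K2 * q ^+ n + (K1 * q ^+ n + K2 * sg ^+ 2) by ring.
rewrite -[leLHS]addr0 lerD//; last first.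
  by rewrite addr_ge0// mulr_ge0// sqr_ge0.
rewrite !addrA lerD2r.
have mcs : c ^+ 2 * sg ^+ 2 / 2 <= m - 1 by rewrite lerBrDl expR_ge1Dx.
rewrite ler_pdivrMr ?subr_gt0//.
apply: (@le_trans _ _ (K1 * sg ^+ 2 * (c ^+ 2 * sg ^+ 2 / 2))); last first.
  by rewrite ler_wpM2l// mulr_ge0// sqr_ge0.
have -> : K1 * sg ^+ 2 * (c ^+ 2 * sg ^+ 2 / 2) =
    2 * (K * (256 * sg ^+ 4)) * expR ((g + 1) ^+ 2 / 2).
  by rewrite /K1; field; rewrite gt_eqF.
apply: ler_wpM2l; first exact: mulr_ge0 (ler0n _ 2) K256.
rewrite ler_expR ler_wpM2r// -exprMn mulrDl mulVf ?gt_eqF//.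
have gsg0 := mulr_ge0 (ltW g0) (ltW sg0).
rewrite ler_pXn2r ?nnegrE ?addr_ge0 ?gsg0 ?(ltW g0)//.
by rewrite lerD2r ler_piMr// ltW.
Qed.

End killed_walk_bound.

(** * Passage to the limit in the mesh and in the perturbation *)

Section survival_limit.
Context d (Omega : measurableType d) (R : realType) (P : probability Omega R).
Variables c a b : R.
Hypotheses (c0 : 0 < c) (b0 : 0 < b) (ba : b <= a).
Variables (sg : nat -> R) (xi : nat -> nat -> {mfun Omega >-> R}).
Variables (pn : nat -> R) (p : R).
Hypothesis gw : forall m, gaussian_walk P (sg m) (xi m).
Hypothesis sg1 : forall m, sg m <= 1.
Hypothesis sg_cvg : sg m @[m --> \oo] --> (0 : R).
Hypothesis pn_cvg : pn m @[m --> \oo] --> p.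
Hypothesis pnE : forall m n, let q := expR (- (c ^+ 2 * sg m ^+ 2 / 2)) in
  `|pn m - (1 - q) * \sum_(i < n) q ^+ i * survival P a b (xi m) i| <= q ^+ n.

(** At fixed mesh n tends to infinity, removing the terms in q^n; then the mesh tends to 0, removing
    the quartic error. The perturbation eps stays. *)
Let survival_limit_le (t eps v K : R) : 0 <= eps -> 0 <= K ->
  (forall s x, alive a b s ->
    (if alive a b (next_state s x)
     then t * exit_value c a b (next_state s x).1 (next_state s x).2 -
       eps * (next_state s x).1
     else v) <=
    t * exit_value c a b s.1 (s.2 - x) - eps * s.1 +
      K * x ^+ 4 * expR (exit_rate c b * `|x|)) ->
  v * (1 - p) <= t * (1 - range_cdf c a b) + eps * a.
Proof.
move=> e0 K0 test.
have [K' K'0 hK] := killed_walk_bound P c0 b0 ba e0 K0 test.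
have h m : v * (1 - pn m) <= t * (1 - range_cdf c a b) + eps * a + K' * sg m ^+ 2.
  pose q := expR (- (c ^+ 2 * sg m ^+ 2 / 2)).
  have sgm0 : 0 < sg m by case: (gw m).
  have q0 : 0 <= q by exact: expR_ge0.
  have q1 : `|q| < 1.
    rewrite ger0_norm// -expR0 ltr_expR oppr_lt0 divr_gt0//.
    by rewrite mulr_gt0// exprn_gt0.
  have hn n : v * (1 - pn m) <= t * (1 - range_cdf c a b) + eps * a +
      K' * sg m ^+ 2 + (K' + `|v|) * q ^+ n.
    have := hK _ _ (gw m) (sg1 m) n; rewrite -/q (exit_value0 a c0 b0).
    have := pnE m n; rewrite -/q.
    set s := (1 - q) * _ => h1 h2.
    have : `|v * (pn m - s)| <= `|v| * q ^+ n by rewrite normrM ler_wpM2l.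
    rewrite ler_norml => /andP[h3 _]; lra.
  have lim0 : t * (1 - range_cdf c a b) + eps * a + K' * sg m ^+ 2 +
      (K' + `|v|) * q ^+ n @[n --> \oo] -->
      t * (1 - range_cdf c a b) + eps * a + K' * sg m ^+ 2 + (K' + `|v|) * 0.
    apply: cvgD; first exact: cvg_cst.
    by apply: cvgM; [exact: cvg_cst|exact: cvg_expr].
  rewrite mulr0 addr0 in lim0.
  apply: (ler_cvg_to _ lim0); first exact: cvg_cst.
  by near=> n; exact: hn.
have liml : v * (1 - pn m) @[m --> \oo] --> v * (1 - p).
  by apply: cvgM; [exact: cvg_cst|apply: cvgB => //; exact: cvg_cst].
have limr : t * (1 - range_cdf c a b) + eps * a + K' * sg m ^+ 2 @[m --> \oo] -->
    t * (1 - range_cdf c a b) + eps * a + K' * (0 * 0).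
  apply: cvgD; first exact: cvg_cst.
  apply: cvgM; first exact: cvg_cst.
  by under eq_fun do rewrite expr2; exact: cvgM.
rewrite !mulr0 addr0 in limr.
by apply: (ler_cvg_to liml limr); near=> n; exact: h.
Unshelve. all: by end_near. Qed.

Lemma survival_limit : p = range_cdf c a b.
Proof.
have up (eps : R) : 0 < eps ->
    (1 - eps * (a + 1)) * (1 - p) <= 1 - range_cdf c a b + eps * a.
  move=> e0; have [K K0 h] := exit_value_supersolution c0 b0 ba e0.
  have := @survival_limit_le 1 eps (1 - eps * (a + 1)) K (ltW e0) K0.
  rewrite mul1r; apply => s x als; rewrite !mul1r; exact: h.
have lo (eps : R) : 0 < eps -> eps < 1 ->
    - (1 + eps * a) * (1 - p) <= - (1 - eps) * (1 - range_cdf c a b) + eps * a.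
  move=> e0 e1; have [K K0 h] := exit_value_subsolution c0 b0 ba e0 e1.
  apply: (@survival_limit_le (- (1 - eps)) eps (- (1 + eps * a)) K (ltW e0) K0).
  by move=> s x als; exact: h.
have a0 : 0 <= a by exact: le_trans (ltW b0) ba.
have lim (k : R) : forall x y : R, (forall e, 0 < e -> e < 1 -> x <= y + e * k) -> x <= y.
  move=> x y xy; apply/ler_addgt0Pr => e e0.
  (* The bound 1/2 keeps the perturbation below 1, as the subsolution requires. *)
  pose f := Num.min (2^-1) (e / (`|k| + 1)).
  have k1 : 0 < `|k| + 1 by rewrite ltr_wpDl.
  have f0 : 0 < f by rewrite lt_min divr_gt0// invr_gt0 ltr0n.
  have f1 : f < 1 by rewrite gt_min; apply/orP; left; lra.
  rewrite (le_trans (xy f f0 f1))// lerD2l.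
  have : f <= e / (`|k| + 1) by rewrite ge_min lexx orbT.
  rewrite ler_pdivlMr// => h; apply: le_trans h.
  by rewrite ler_wpM2l ?(ltW f0)// (le_trans (ler_norm _))// lerDl.
suff : 1 - range_cdf c a b = 1 - p by move=> /addrI /oppr_inj ->.
apply/eqP; rewrite eq_le; apply/andP; split.
- apply: (lim (a + (1 - range_cdf c a b) + a * (1 - p))) => e e0 e1.
  by have := lo e e0 e1; lra.
- apply: (lim (a + (a + 1) * (1 - p))) => e e0 e1.
  by have := up e e0; lra.
Qed.

End survival_limit.

(** * Discretization of Brownian motion *)

Section dyadic_grid.
Context {R : realType}.
Implicit Types (x : R -> R) (t a b : R).

Definition dyadic_step (m : nat) : R := 2^-1 ^+ m.

Lemma dyadic_step_gt0 m : 0 < dyadic_step m.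
Proof. by rewrite exprn_gt0// invr_gt0. Qed.

Lemma dyadic_step_cvg0 : dyadic_step m @[m --> \oo] --> (0 : R).
Proof. by apply: cvg_expr; rewrite ger0_norm ?invr_ge0// invf_lt1// ltr1n. Qed.

Lemma dyadic_step_lt (e : R) : 0 < e -> exists m, dyadic_step m < e.
Proof.
move=> e0; have /cvgr0Pnorm_lt/(_ e e0)[m _ /(_ m (leqnn m))] := dyadic_step_cvg0.
by rewrite ger0_norm ?ltW ?dyadic_step_gt0//; exists m.
Qed.

Lemma dyadic_floor (u e : R) m : 0 <= u -> dyadic_step m < e ->
  exists j : nat, j%:R * dyadic_step m <= u < j.+1%:R * dyadic_step m /\
    `|u - j%:R * dyadic_step m| < e.
Proof.
move=> u0 me; have h0 := dyadic_step_gt0 m.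
have uh0 : 0 <= u / dyadic_step m by rewrite divr_ge0// ltW.
have /andP[j1 j2] := Num.Theory.truncn_itv uh0.
exists (Num.truncn (u / dyadic_step m)).
rewrite ler_pdivlMr// in j1; rewrite ltr_pdivrMr// in j2.
split; first exact/andP.
rewrite ger0_norm ?subr_ge0// (lt_trans _ me)//.
by move: j2; rewrite -natr1 mulrDl mul1r; lra.
Qed.

Definition grid_increase_le x t a m := forall j k : nat, (j <= k)%N ->
  k%:R * dyadic_step m <= t ->
  x (k%:R * dyadic_step m) - x (j%:R * dyadic_step m) <= a.

(** Rounding times down to a fine dyadic grid preserves their order and the bound t, and by
    continuity changes the increment by less than any given e. *)
Lemma max_increase_le x t a : {within `[(0 : R), +oo[, continuous x} -> 0 <= t ->
  max_increase x t <= a <-> forall m, grid_increase_le x t a m.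
Proof.
move=> cx t0; split => [xta m j k jk kt|xta].
- apply: le_trans xta; apply: ub_le_sup; last first.
    exists (j%:R * dyadic_step m, k%:R * dyadic_step m) => //=; split => //.
      by rewrite mulr_ge0// ltW// dyadic_step_gt0.
    by rewrite ler_wpM2r ?ler_nat// ltW// dyadic_step_gt0.
  (* A member is below [sup] only if the set is bounded; the extreme values of the path on [0, t]
     provide the bound. *)
  have cx' : {within `[0, t], continuous x}.
    apply: continuous_subspaceW cx; exact: subset_itvl.
  have [u _ hu] := EVT_max t0 cx'; have [v _ hv] := EVT_min t0 cx'.
  exists (x u - x v) => _ [[p q] /= [p0 pq qt] <-].
  by rewrite lerB//; [apply: hu|apply: hv]; rewrite in_itv/=; apply/andP; split;
    rewrite // ?(le_trans p0)// (le_trans pq).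
- apply: ge_sup.
    by exists (x 0 - x 0), (0, 0) => //=; split.
  move=> _ [[u v] /= [u0 uv vt] <-]; apply/ler_addgt0Pr => e e0.
  have v0 := le_trans u0 uv.
  have near_x z : 0 <= z -> exists2 d, 0 < d &
      forall z', 0 <= z' -> `|z - z'| < d -> `|x z - x z'| < e / 2.
    move=> z0; move/subspace_continuousP : cx => /(_ z).
    rewrite /= in_itv/= andbT => /(_ z0) /cvgrPdist_lt /(_ (e / 2)).
    rewrite divr_gt0// => /(_ isT) [d /= d0 hd]; exists d => // z' z'0 zz'.
    by apply: hd => //; rewrite /= in_itv/= z'0.
  have [du du0 hu] := near_x u u0; have [dv dv0 hv] := near_x v v0.
  have duv0 : 0 < Num.min du dv by rewrite lt_min du0.
  have [m] := dyadic_step_lt duv0; rewrite lt_min => /andP[mu mv].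
  have [j [/andP[j1 j2] ju]] := dyadic_floor u0 mu.
  have [k [/andP[k1 k2] kv]] := dyadic_floor v0 mv.
  have h0 := dyadic_step_gt0 m.
  have jk : (j <= k)%N.
    rewrite -ltnS -(ltr_nat R) -(ltr_pM2r h0).
    by rewrite (le_lt_trans j1)// (le_lt_trans uv).
  have := xta m j k jk (le_trans k1 vt).
  have := hu (j%:R * dyadic_step m) (mulr_ge0 (ler0n _ _) (ltW h0)) ju.
  have := hv (k%:R * dyadic_step m) (mulr_ge0 (ler0n _ _) (ltW h0)) kv.
  by rewrite !ltr_norml => /andP[? ?] /andP[? ?] ?; lra.
Qed.

Lemma max_increase_lt0 x t : t < 0 -> max_increase x t = 0.
Proof.
move=> t0; rewrite /max_increase [X in sup X](_ : _ = set0) ?sup0//.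
apply/seteqP; split => // _ [[u v] /= [u0 uv vt] _].
by have := le_lt_trans (le_trans u0 (le_trans uv vt)) t0; rewrite ltxx.
Qed.

Lemma max_decreaseE x t : max_decrease x t = max_increase (fun s => - x s) t.
Proof.
rewrite /max_decrease /max_increase; congr sup; apply/seteqP.
by split => _ [uv huv <-]; exists uv => //; rewrite opprK addrC.
Qed.

Lemma continuous_within_opp x : {within `[(0 : R), +oo[, continuous x} ->
  {within `[(0 : R), +oo[, continuous (fun s => - x s)}.
Proof. by move=> cx s; apply: cvgN; exact: cx. Qed.

Definition grid_good (h a b : R) x (i : nat) := forall j k : nat,
  (j <= k)%N -> (k <= i)%N -> x (k%:R * h) - x (j%:R * h) <= a /\
    x (j%:R * h) - x (k%:R * h) <= b.

Lemma max_increase_decrease_le x t a b :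
  {within `[(0 : R), +oo[, continuous x} -> 0 <= a -> 0 <= b ->
  (max_increase x t <= a /\ max_decrease x t <= b) <->
  (forall m i, i%:R * dyadic_step m <= t -> grid_good (dyadic_step m) a b x i).
Proof.
(* For negative t both suprema have the default value 0 and no grid index satisfies the condition on
   the right. *)
move=> cx a0 b0; have [t0|t0] := ltP t 0.
  rewrite max_decreaseE !max_increase_lt0//; split => // _ m i it.
  have := le_lt_trans it t0.
  by rewrite ltNge mulr_ge0// ltW// dyadic_step_gt0.
have kt m (i k : nat) : i%:R * dyadic_step m <= t -> (k <= i)%N ->
    k%:R * dyadic_step m <= t.
  move=> it ki; apply: le_trans it.
  by rewrite ler_wpM2r ?ler_nat// ltW// dyadic_step_gt0.
rewrite max_decreaseE max_increase_le// max_increase_le//; last first.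
  exact: continuous_within_opp.
split => [[h1 h2] m i it j k jk ki|h].
  split; first exact: h1 (kt _ _ _ it ki).
  by have := h2 m j k jk (kt _ _ _ it ki); rewrite opprK addrC.
split => m j k jk km; have [h1 h2] := h m k km j k jk (leqnn k) => //.
by rewrite opprK addrC.
Qed.

End dyadic_grid.

(** * The killed walk as range and drawdown of the sampled path *)

Section killed_walk_path.
Context d (Omega : measurableType d) (R : realType).
Variables (a b h : R) (xi : nat -> {mfun Omega >-> R}) (w : Omega) (x : R -> R).
Hypotheses (b0 : 0 < b) (ba : b <= a).
Hypothesis xiE : forall i, xi i w = x (i.+1%:R * h) - x (i%:R * h).

Let s (i : nat) := x (i%:R * h).

Let S i := killed_walk a b xi i w.

Let extrema i (M m : R) := [/\ forall j, (j <= i)%N -> m <= s j <= M,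
  exists2 j, (j <= i)%N & s j = M, exists2 j, (j <= i)%N & s j = m &
  S i = (M - m, M - s i)].

Let alive_pred i : alive a b (S i.+1) -> alive a b (S i).
Proof. by rewrite /S /killed_walk/= /killed_step/=; case: ifP => // ->. Qed.

(** While alive, the walk is the range and drawdown of the sampled path, and the running extrema are
    attained at grid indices. Survival is assumed because the state is frozen after leaving the
    region. *)
Let alive_extrema i : alive a b (S i) -> exists M m, extrema i M m.
Proof.
elim: i => [_|i ih als].
  exists (s 0%N), (s 0%N); split; [|by exists 0%N..|].
  - by move=> j; rewrite leqn0 => /eqP ->; rewrite lexx.
  - by rewrite /S /killed_walk/= !subrr.
have alsi := alive_pred als; have [M [m [mM [jM jMi sM] [jm jmi sm] Si]]] := ih alsi.
have Sn : S i.+1 = next_state (S i) (xi i w).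
  by rewrite /S /killed_walk/= /killed_step/= -/(killed_walk a b xi) -/(S i) alsi.
have si := mM i (leqnn i).
have r0 : 0 <= M - m by move: si => /andP[]; lra.
have zE : M - s i - xi i w = M - s i.+1 by rewrite xiE -/(s i.+1) -/(s i); ring.
move: Sn; rewrite /next_state Si/= zE => Sn.
have mMS (m' M' : R) : m' <= m -> M <= M' -> m' <= s i.+1 <= M' ->
    forall j, (j <= i.+1)%N -> m' <= s j <= M'.
  move=> m'm MM' hs j; rewrite leq_eqVlt => /predU1P[->//|].
  by rewrite ltnS => /mM /andP[h1 h2]; apply/andP; split; lra.
move: Sn; case: next_rangeP => // [z0 zr|t t0 zt|rz z0] Sn.
- exists M, m; split=> //; [|by exists jM => //; exact: leqW|by exists jm => //; exact: leqW].
  by apply: mMS => //; apply/andP; split; lra.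
- exists (s i.+1), m; split.
  + by apply: mMS; rewrite ?lexx//; [|apply/andP; split]; move: si => /andP[]; lra.
  + by exists i.+1.
  + by exists jm => //; exact: leqW.
  + by rewrite Sn; congr (_, _); lra.
- exists M, (s i.+1); split => //.
  + by apply: mMS; rewrite ?lexx//; [|apply/andP; split]; move: si => /andP[]; lra.
  + by exists jM => //; exact: leqW.
  + by exists i.+1.
Qed.

(** The range is the larger of the maximum increase and the maximum decrease, and the latter is
    already at most b <= a; so bounding the range by a and the drawdown by b is the same as bounding
    both. *)
Lemma alive_killed_walkP i : alive a b (S i) <-> grid_good h a b x i.
Proof.
split.
- elim: i => [_ j k jk|i ih als j k jk].
    rewrite leqn0 => /eqP k0; move: jk; rewrite k0 leqn0 => /eqP ->.
    by rewrite subrr; split; rewrite ?(ltW b0)// (le_trans (ltW b0)).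
  have [M [m [mM _ _ SE]]] := alive_extrema als.
  move: (als); rewrite SE /alive/= => /and4P[_ _ Mma Msb].
  move=> ki; have /andP[mj jM] := mM j (leq_trans jk ki).
  have /andP[mk kM] := mM k ki.
  split; first by rewrite -/(s k) -/(s j); lra.
  move: ki; rewrite leq_eqVlt => /predU1P[->|ki].
    by rewrite -/(s j) -/(s i.+1); lra.
  by have [] := ih (alive_pred als) j k jk ki.
- elim: i => [_|i ih good].
    by rewrite /S /killed_walk/= /alive/= lexx (ltW b0) (le_trans (ltW b0) ba).
  have alsi : alive a b (S i).
    by apply: ih => j k jk ki; apply: good => //; exact: leqW.
  have [M [m [mM [jM jMi sM] [jm jmi sm] Si]]] := alive_extrema alsi.
  have Sn : S i.+1 = next_state (S i) (xi i w).
    by rewrite /S /killed_walk/= /killed_step/= -/(killed_walk a b xi) -/(S i) alsi.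
  have zE : M - s i - xi i w = M - s i.+1 by rewrite xiE -/(s i.+1) -/(s i); ring.
  rewrite Sn alive_next// Si/= zE.
  have [_ h1] := good jM i.+1 (leqW jMi) (leqnn _); rewrite -/(s jM) sM in h1.
  have [h2 _] := good jm i.+1 (leqW jmi) (leqnn _); rewrite -/(s jm) sm in h2.
  have zb : M - s i.+1 <= b by [].
  rewrite zb andbT /next_range !ge_max.
  apply/and3P; split; last exact: le_trans ba.
    (* If the minimum precedes the maximum, the range is an increase, at most a; otherwise it is a
       decrease, at most b and hence at most a. *)
    have [jj|jj] := leqP jm jM.
      by have [+ _] := good jm jM jj (leqW jMi); rewrite -/(s jm) -/(s jM) sm sM.
    have [_ +] := good jM jm (ltnW jj) (leqW jmi).
    by rewrite -/(s jm) -/(s jM) sm sM => /le_trans; exact.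
  by rewrite (_ : M - m - _ = s i.+1 - m)//; ring.
Qed.

End killed_walk_path.

Section measurable_grid_good.
Context d (T : measurableType d) (R : realType).

Lemma measurable_le_set (f g : T -> R) : measurable_fun setT f ->
  measurable_fun setT g -> measurable [set w | f w <= g w].
Proof.
move=> mf mg; have mtrue : measurable [set true] by [].
by have := measurable_fun_ler mf mg measurableT mtrue; rewrite setTI.
Qed.

Lemma measurable_lt_set (f g : T -> R) : measurable_fun setT f ->
  measurable_fun setT g -> measurable [set w | f w < g w].
Proof.
move=> mf mg; have mtrue : measurable [set true] by [].
by have := measurable_fun_ltr mf mg measurableT mtrue; rewrite setTI.
Qed.

(** Abstract in the sigma-algebra: used with the ambient one, and with the one generated by the
    process, where the independence of T applies. *)
Lemma measurable_grid_good (Y : R -> T -> R) (h a b : R) i : 0 <= h ->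
  (forall t, 0 <= t -> measurable_fun setT (Y t)) ->
  measurable [set w | grid_good h a b (Y^~ w) i].
Proof.
move=> h0 mY.
pose F j k := [set w | Y (k%:R * h) w - Y (j%:R * h) w <= a] `&`
  [set w | Y (j%:R * h) w - Y (k%:R * h) w <= b].
have mF j k : measurable (F j k).
  by apply: measurableI; apply: measurable_le_set => //;
    apply: measurable_funB; apply: mY; rewrite mulr_ge0.
rewrite (_ : [set _ | _] = \bigcap_j \bigcap_k
    (if (j <= k <= i)%N then F j k else setT)).
  by apply: bigcapT_measurable => j; apply: bigcapT_measurable => k; case: ifP.
apply/seteqP; split => [w hw j _ k _|w hw j k jk ki].
  by case: ifP => // /andP[jk ki]; exact: hw.
by have := hw j I k I; rewrite jk ki.
Qed.

End measurable_grid_good.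

Section exponential_time.
Context d (Omega : measurableType d) (R : realType) (P : probability Omega R).
Variables (lambda : R) (T : {RV P >-> R}).
Hypotheses (lambda0 : 0 < lambda) (T_exp : exponentially_distributed lambda T).

Lemma prob_exponential_itv0o s : 0 <= s ->
  P (T @^-1` `[0, s[) = (1 - expR (- (lambda * s)))%:E.
Proof.
move=> s0; have mA : measurable (`[0, s[%classic : set R) by exact: measurable_itv.
have := T_exp mA; rewrite /distribution /pushforward => ->.
move: s0; rewrite le_eqVlt => /predU1P[<-|s0].
  rewrite set_itvco0 mulr0 oppr0 expR0 subrr.
  by rewrite /exponential_prob integral_set0.
have := exponential_prob_itv0c lambda s0; rewrite mulNr EFinB => <-.
rewrite /exponential_prob integral_itv_bndo_bndc//.
apply/measurable_EFinP/measurable_funTS; exact: measurable_exponential_pdf.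
Qed.

(** The number of full grid steps before T is geometric; this is where the discounted sums of
    survival probabilities come from. *)
Lemma prob_exponential_cell (h : R) (i : nat) : 0 <= h ->
  P (T @^-1` `[i%:R * h, i.+1%:R * h[) =
  ((1 - expR (- (lambda * h))) * expR (- (lambda * h)) ^+ i)%:E.
Proof.
move=> h0; have ih0 : 0 <= i%:R * h by rewrite mulr_ge0.
have ih : i%:R * h <= i.+1%:R * h by rewrite ler_wpM2r// ler_nat.
have mT (A : set R) : measurable A -> measurable (T @^-1` A).
  by move=> mA; rewrite -[X in measurable X]setTI; exact: measurable_funP.
have : P (T @^-1` `[0, i.+1%:R * h[) =
    (P (T @^-1` `[0%R, (i%:R * h)%R[) + P (T @^-1` `[(i%:R * h)%R, (i.+1%:R * h)%R[))%E.
  rewrite -measureU; [|by apply: mT; exact: measurable_itv..|].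
    congr (P _); apply/seteqP; split => w /=; rewrite !in_itv/=.
      by have [h1|h1] := ltP (T w) (i%:R * h) => /andP[-> ->]; [left|right].
    move=> [/andP[-> /lt_le_trans]|/andP[/(le_trans ih0) -> //]]; exact.
  apply/seteqP; split => // w [] /=; rewrite !in_itv/= => /andP[_ h1] /andP[h2 _].
  by have := lt_le_trans h1 h2; rewrite ltxx.
rewrite !prob_exponential_itv0o ?mulr_ge0//.
move=> /(congr1 (fun z => z - (1 - expR (- (lambda * (i%:R * h))))%R%:E)%E).
rewrite [in RHS]addeAC subee// add0e => <-; rewrite -EFinB; congr EFin.
have qE n : expR (- (lambda * (n%:R * h))) = expR (- (lambda * h)) ^+ n.
  by rewrite -expRM_natl; congr expR; ring.
by rewrite !qE exprS; ring.
Qed.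

End exponential_time.

Section brownian_increments.
Context d (Omega : measurableType d) (R : realType) (P : probability Omega R).
Variables (x0 : R) (X : R -> {RV P >-> R}).
Hypothesis bm : standard_brownian_motion_from x0 X.

Definition increment (h : R) (i : nat) : {mfun Omega >-> R} :=
  (X (i.+1%:R * h) \- X (i%:R * h))%R.

Lemma incrementE h i w : increment h i w = X (i.+1%:R * h) w - X (i%:R * h) w.
Proof. by []. Qed.

(* [k = 1] and [k = - 1] give the walks driven by [X] and [- X]. *)
Lemma gaussian_walk_increment (h k : R) : 0 < h -> k ^+ 2 = 1 ->
  gaussian_walk P (Num.sqrt h) (fun i => (k \o* increment h i)%R).
Proof.
move=> h0 k1; split => [|n A mA|i th].
- by rewrite sqrtr_gt0.
- pose B (i : 'I_n) : set R := (fun x => x * k) @^-1` A i.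
  have mB i : measurable (B i).
    have mk : measurable_fun setT (fun x : R => x * k) by exact: measurable_funM.
    by have := mk measurableT _ (mA i); rewrite setTI.
  have t0 : 0 <= (0%:R : R) * h by rewrite mul0r.
  have tmon (i : nat) : i%:R * h <= i.+1%:R * h by rewrite ler_wpM2r ?ler_nat// ltW.
  exact: (bm_independent bm t0 tmon mB).
- have sh : 0 < Num.sqrt h by rewrite sqrtr_gt0.
  have ih : i%:R * h < i.+1%:R * h by rewrite ltr_pM2r// ltr_nat.
  have ih0 : 0 <= i%:R * h by rewrite mulr_ge0// ltW.
  have law (A : set R) : measurable A ->
      P (increment h i @^-1` A) = normal_prob 0 (Num.sqrt h) A.
    move=> mA; rewrite (bm_normal bm ih0 ih mA); congr (normal_prob _ (Num.sqrt _) _).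
    by rewrite -mulrBl -natr1 addrAC subrr add0r mul1r.
  have := mgf_normal_law (th * k) sh law; rewrite exprMn k1 mulr1 => <-.
  by apply: eq_integral => w _ /=; congr (expR _)%:E; ring.
Qed.

End brownian_increments.

(** * The joint distribution function at the exponential time *)

Section max_increase_decrease_law.
Context d (Omega : measurableType d) (R : realType) (P : probability Omega R).
Variables (x0 : R) (X : R -> {RV P >-> R}) (lambda : R) (T : {RV P >-> R}).
Hypotheses (bm : standard_brownian_motion_from x0 X) (lambda0 : 0 < lambda).
Hypotheses (T_exp : exponentially_distributed lambda T).
Hypotheses (T_ind : independent_of_process T X).

Let good a b m i := [set w | grid_good (dyadic_step m) a b (fun t => X t w) i].

(** The constraints tested on the grid of level m up to time T. Grids are nested, so these events
    decrease, and their intersection is the event for the continuous path. *)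
Let approx a b m := [set w | forall i, i%:R * dyadic_step m <= T w ->
  grid_good (dyadic_step m) a b (fun t => X t w) i].

Let h0 m : 0 <= dyadic_step m :> R. Proof. exact/ltW/dyadic_step_gt0. Qed.

Let mgood a b m i : measurable (good a b m i).
Proof. by apply: (measurable_grid_good (Y := X)) => // t _; exact: measurable_funPT. Qed.

Let process_good a b m i : process_sigma_algebra X (good a b m i).
Proof.
apply: (@measurable_grid_good _ (g_sigma_algebraType (\bigcup_(t in `[(0 : R), +oo[)
  preimage_set_system setT (X t) measurable)) R X) => // t t0 _ B mB.
apply: sub_sigma_algebra; exists t; first by rewrite /= in_itv/= t0.
by exists B.
Qed.

Let approxE a b m : approx a b m =
  \bigcap_i ([set w | T w < i%:R * dyadic_step m] `|` good a b m i).
Proof.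
apply/seteqP; split => w hw i.
  by move=> _; have [h|h] := ltP (T w) (i%:R * dyadic_step m); [left|right; exact: hw].
by move=> iT; have [/= h|//] := hw i I; move: h; rewrite ltNge iT.
Qed.

Let mapprox a b m : measurable (approx a b m).
Proof.
rewrite approxE; apply: bigcapT_measurable => i; apply: measurableU => //.
by apply: measurable_lt_set => //; exact: measurable_funPT.
Qed.

Let approx_decreasing a b : nonincreasing_seq (approx a b).
Proof.
apply/nonincreasing_seqP => m; apply/subsetPset => w hw i iT j k jk ki.
have hE n : n%:R * dyadic_step m = (n.*2)%:R * dyadic_step m.+1 :> R.
  by rewrite /dyadic_step exprS -muln2 natrM; field.
have := hw i.*2; rewrite -hE => /(_ iT) /(_ j.*2 k.*2).
by rewrite !leq_double -!hE; exact.
Qed.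

Let bigcap_approx a b : 0 <= a -> 0 <= b -> \bigcap_m approx a b m =
  [set w | max_increase (fun t => X t w) (T w) <= a /\
           max_decrease (fun t => X t w) (T w) <= b].
Proof.
move=> a0 b0; apply/seteqP; split => w hw.
  apply/max_increase_decrease_le => //; first exact: bm_continuous bm w.
  by move=> m i iT; exact: (hw m I i iT).
move=> m _ i iT; move: hw => /max_increase_decrease_le; apply => //.
exact: bm_continuous bm w.
Qed.

Lemma measurable_max_increase_decrease_le a b : 0 <= a -> 0 <= b ->
  measurable [set w | max_increase (fun t => X t w) (T w) <= a /\
                      max_decrease (fun t => X t w) (T w) <= b].
Proof. by move=> a0 b0; rewrite -bigcap_approx//; exact: bigcapT_measurable. Qed.

Let mT (A : set R) : measurable A -> measurable (T @^-1` A).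
Proof. by move=> mA; rewrite -[X in measurable X]setTI; exact: measurable_funP. Qed.

Let mitv (i : interval R) : measurable (T @^-1` [set` i]).
Proof. by apply: mT; exact: measurable_itv. Qed.

Let fineU (A B : set Omega) : measurable A -> measurable B -> A `&` B = set0 ->
  fine (P (A `|` B)) = fine (P A) + fine (P B).
Proof. by move=> mA mB AB; rewrite measureU// fineD// fin_num_measure. Qed.

(** If T lies in the cell starting at grid point n, the constraint up to T is the one up to index n,
    an event of the process and hence independent of T. *)
Let approx_sum a b m n : let q := expR (- (lambda * dyadic_step m)) in
  fine (P (approx a b m `&` T @^-1` `[0, n%:R * dyadic_step m[)) =
  (1 - q) * \sum_(i < n) q ^+ i * fine (P (good a b m i)).
Proof.
move=> q; elim: n => [|n ih].
  by rewrite mul0r set_itvco0 preimage_set0 setI0 measure0 big_ord0 mulr0.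
set h := dyadic_step m in q ih *; have hh0 : 0 <= h := h0 m.
have nh0 : 0 <= n%:R * h by rewrite mulr_ge0.
have nh1 : n%:R * h <= n.+1%:R * h by rewrite ler_wpM2r ?ler_nat.
rewrite (_ : _ `&` _ = (approx a b m `&` T @^-1` `[0, n%:R * h[) `|`
    (T @^-1` `[n%:R * h, n.+1%:R * h[ `&` good a b m n)).
  rewrite fineU; [|by apply: measurableI..|].
    have mI : measurable (`[n%:R * h, n.+1%:R * h[%classic : set R).
      exact: measurable_itv.
    rewrite ih (T_ind mI (process_good a b m n)).
    rewrite (prob_exponential_cell T_exp)// fineM// ?fin_num_measure//.
    by rewrite big_ord_recr/= mulrDr -/q; ring.
  apply/seteqP; split => // w [[_ /=]] + [/=].
  by rewrite !in_itv/= => /andP[_ h1] /andP[h2 _]; have := lt_le_trans h1 h2; rewrite ltxx.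
apply/seteqP; split => w /=; rewrite !in_itv/=.
  move=> [gw /andP[T0 Tn]]; have [Tn'|Tn'] := ltP (T w) (n%:R * h).
    by left; split => //; apply/andP; split.
  by right; split; [apply/andP|exact: gw].
move=> [[gw /andP[T0 Tn]]|[/andP[T0 Tn] gw]].
  by split => //; rewrite T0 (lt_le_trans Tn).
split; last by rewrite (le_trans nh0).
move=> i iT j k jk ki; apply: gw => //; apply: (leq_trans ki).
rewrite -ltnS -(ltr_nat R) -(ltr_pM2r (dyadic_step_gt0 m)).
exact: le_lt_trans iT Tn.
Qed.

Let approx_sum_le a b m n : let q := expR (- (lambda * dyadic_step m)) in
  `|fine (P (approx a b m)) -
    (1 - q) * \sum_(i < n) q ^+ i * fine (P (good a b m i))| <= q ^+ n.
Proof.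
cbv zeta; set q := expR _; rewrite -approx_sum; set J := T @^-1` _.
have nh0 : 0 <= n%:R * dyadic_step m :> R by rewrite mulr_ge0// h0.
have mJ : measurable J by exact: mitv.
rewrite [in fine (P (approx a b m))](_ : approx a b m =
    (approx a b m `&` J) `|` (approx a b m `\` J)); last by rewrite setUIDK.
rewrite fineU; [|exact: measurableI|exact: measurableD|]; last first.
  by apply/seteqP; split => // w [[_ Jw] [_ /(_ Jw)]].
rewrite addrAC subrr add0r ger0_norm ?fine_ge0//.
have -> : q ^+ n = fine (P (~` J)).
  rewrite probability_setC// (prob_exponential_itv0o T_exp)//=.
  by rewrite opprB addrC subrK /q -expRM_natl; congr expR; ring.
have mD : measurable (approx a b m `\` J) by exact: measurableD.
have mC : measurable (~` J) by exact: measurableC.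
apply: fine_le; rewrite ?fin_num_measure//; apply: le_measure; rewrite ?inE//.
Qed.

(** For a <= b the path is reflected, which exchanges increase and decrease, so that the range
    always carries the larger bound. *)
Let survivalE a b m i (k : R) : 0 < a -> 0 < b -> k = 1 /\ b <= a \/ k = -1 /\ a <= b ->
  survival P (Num.max a b) (Num.min a b)
    (fun i => (k \o* increment X (dyadic_step m) i)%R) i = fine (P (good a b m i)).
Proof.
move=> a0 b0 kab; congr (fine (P _)); apply/seteqP.
suff E w : alive (Num.max a b) (Num.min a b) (killed_walk (Num.max a b) (Num.min a b)
    (fun i => (k \o* increment X (dyadic_step m) i)%R) i w) <->
    grid_good (dyadic_step m) a b (fun t => X t w) i.
  by split => w /E.
case: kab => -[-> ab].
- rewrite (max_idPl ab) (min_idPr ab).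
  apply: alive_killed_walkP => // j; rewrite /= mulr1; exact: incrementE.
- rewrite (max_idPr ab) (min_idPl ab).
  rewrite (@alive_killed_walkP _ _ _ b a (dyadic_step m) _ w (fun t => - X t w)) //.
    by split => gw j k' jk ki; have [] := gw j k' jk ki; rewrite ?opprK; split; lra.
  by move=> j /=; ring.
Qed.

Lemma prob_max_increase_decrease_le a b : 0 < a -> 0 < b ->
  P [set w | max_increase (fun t => X t w) (T w) <= a /\
             max_decrease (fun t => X t w) (T w) <= b] =
  (range_cdf (Num.sqrt (2 * lambda)) (Num.max a b) (Num.min a b))%:E.
Proof.
move=> a0 b0; rewrite -bigcap_approx ?ltW//.
have [k k1 kab] : exists2 k : R, k ^+ 2 = 1 & k = 1 /\ b <= a \/ k = -1 /\ a <= b.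
  have [ab|/ltW ab] := leP b a; first by exists 1; [rewrite expr1n|left].
  by exists (-1); [rewrite sqrrN expr1n|right].
have mcap : measurable (\bigcap_m approx a b m) by exact: bigcapT_measurable.
rewrite -[LHS]fineK ?fin_num_measure//; congr EFin.
have c0 : 0 < Num.sqrt (2 * lambda) by rewrite sqrtr_gt0 mulr_gt0.
have min0 : 0 < Num.min a b by rewrite lt_min a0.
have min_max : Num.min a b <= Num.max a b by rewrite ge_min le_max lexx.
apply: (@survival_limit _ _ _ P _ _ _ c0 min0 min_max
  (fun m => Num.sqrt (dyadic_step m))
  (fun m i => (k \o* increment X (dyadic_step m) i)%R)
  (fun m => fine (P (approx a b m)))).
- by move=> m; apply: (gaussian_walk_increment bm) => //; exact: dyadic_step_gt0.
- move=> m; rewrite -[leRHS]sqrtr1 ler_wsqrtr// /dyadic_step.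
  by rewrite exprn_ile1// ?invr_ge0// invf_le1// ler1n.
- rewrite -[X in _ --> X]sqrtr0; apply: continuous_cvg; first exact: sqrt_continuous.
  exact: dyadic_step_cvg0.
- apply: fine_cvg; rewrite fineK ?fin_num_measure//.
  apply: nonincreasing_cvg_mu => //.
  by rewrite -ge0_fin_numE// fin_num_measure.
- move=> m n /=.
  (* The discount that makes G invariant for the walk is the probability that the exponential clock
     does not ring during one step. *)
  have -> : Num.sqrt (2 * lambda) ^+ 2 * Num.sqrt (dyadic_step m) ^+ 2 / 2 =
      lambda * dyadic_step m.
    by rewrite !sqr_sqrtr// ?mulr_ge0 ?(ltW lambda0)//; field.
  under eq_bigr do rewrite survivalE//.
  exact: approx_sum_le.
Qed.

End max_increase_decrease_law.

(** * Integration of the density *)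

Section integral_left_open.
Context {R : realType}.
Local Notation mu := (@lebesgue_measure R).

(** The density involves 1/sinh and coth, singular at 0, so the fundamental theorem is applied on
    [e, b] and e tends to 0 by monotone convergence. The bound K y makes the lower boundary term
    vanish. *)
Lemma ge0_FTC_left_open (f F : R -> R) (b K : R) : 0 < b ->
  (forall y : R, 0 < y -> y <= b -> 0 <= f y) ->
  (forall y : R, 0 < y -> {for y, continuous f}) ->
  (forall y : R, 0 < y -> is_derive y 1 F (f y)) ->
  (forall y : R, 0 < y -> y <= b -> `|F y| <= K * y) ->
  (\int[mu]_(y in `]0%R, b]) (f y)%:E)%E = (F b)%:E.
Proof.
move=> b0 f0 cf dF FK.
(* The shift by 2 makes every left end strictly smaller than b, including the one for n = 0. *)
pose e n : R := b / n.+2%:R.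
have e0 n : 0 < e n by rewrite divr_gt0.
have eb n : e n < b by rewrite ltr_pdivrMr// ltr_pMr// ltr1n.
pose A n := `[e n, b]%classic.
have UA : \bigcup_n A n = `]0, b]%classic.
  apply/seteqP; split => [y [n _]|y]; rewrite /A/= !in_itv/=.
    by move=> /andP[h ->]; rewrite (lt_le_trans (e0 n)).
  move=> /andP[y0 yb].
  have /andP[_ h] := Num.Theory.truncn_itv (ltW (divr_gt0 b0 y0)).
  exists (Num.truncn (b / y)) => //; rewrite /A/= in_itv/= yb andbT.
  rewrite /e ler_pdivrMr// mulrC -ler_pdivrMr// (le_trans (ltW h))//.
  by rewrite ler_nat.
have ndA : nondecreasing_seq A.
  apply/nondecreasing_seqP => n; apply/subsetPset; apply: subset_itvr.
  by rewrite bnd_simp /e ler_pM2l// lef_pV2 ?posrE// ler_nat.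
have intA n : (\int[mu]_(y in A n) (f y)%:E)%E = (F b - F (e n))%:E.
  rewrite EFinB; apply: continuous_FTC2 => //.
  - apply: continuous_in_subspaceT => y; rewrite inE/= in_itv/= => /andP[h _].
    by apply: cf; exact: lt_le_trans (e0 n) h.
  - have cF (y : R) : 0 < y -> {for y, continuous F}.
      move=> y0; have [dFy _] := dF _ y0.
      exact/differentiable_continuous/derivable1_diffP.
    split.
    + move=> y; rewrite in_itv/= => /andP[h _].
      by have [] := dF _ (lt_trans (e0 n) h).
    + by apply: cvg_at_right_filter; exact: cF.
    + by apply: cvg_at_left_filter; exact: cF.
  - move=> y; rewrite in_itv/= => /andP[h _].
    have := dF _ (lt_trans (e0 n) h).
    by move=> dFy; rewrite derive1E derive_val.
have mf : measurable_fun (\bigcup_n A n) (EFin \o f).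
  apply/measurable_EFinP; rewrite UA.
  have sub : `]0, b]%classic `<=` `]0, +oo[%classic by exact: subset_itvl.
  apply: measurable_funS sub _ => //.
  apply: open_continuous_measurable_fun => //.
  by move=> y; rewrite inE/= in_itv/= andbT; exact: cf.
have fA n y : A n y -> (0 <= (f y)%:E)%E.
  rewrite /A/= in_itv/= => /andP[h yb]; rewrite lee_fin f0//.
  exact: lt_le_trans (e0 n) h.
have mA n : measurable (A n) by exact: measurable_itv.
have mfA n : measurable_fun (A n) (EFin \o f).
  by apply: measurable_funS mf => //; [exact: bigcup_measurable|exact: bigcup_sup].
have lim1 := ge0_nondecreasing_set_cvg_integral (mu := mu) ndA mA mfA fA.
rewrite UA in lim1; apply: (cvg_unique _ lim1) => //.
rewrite (_ : (fun n => _) = EFin \o (fun n => F b - F (e n))); last first.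
  by apply/funext => n; exact: intA.
apply: cvg_EFin; first by near=> n.
rewrite -[X in _ --> X]subr0; apply: cvgB; first exact: cvg_cst.
have ecvg : e n @[n --> \oo] --> (0 : R).
  rewrite -[X in _ --> X](mulr0 b); apply: cvgM; first exact: cvg_cst.
  have := @cvg_harmonic R; rewrite -cvg_shiftS; exact.
have Kcvg : `|K| * e n @[n --> \oo] --> (0 : R).
  by rewrite -[X in _ --> X](mulr0 `|K|); apply: cvgM => //; exact: cvg_cst.
apply/norm_cvg0P; apply: (squeeze_cvgr _ (cvg_cst 0) Kcvg).
near=> n; rewrite normr_ge0/= (le_trans (FK _ (e0 n) (ltW (eb n))))//.
by rewrite ler_wpM2r ?ler_norm// ltW.
Unshelve. all: by end_near. Qed.

End integral_left_open.

Section density_calculus.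
Context {R : realType}.
Local Notation mu := (@lebesgue_measure R).
Variable lambda : R.
Hypothesis lambda0 : 0 < lambda.
Let c := Num.sqrt (2 * lambda).

Let c0 : 0 < c. Proof. by rewrite sqrtr_gt0 mulr_gt0. Qed.
Let cc : c ^+ 2 = 2 * lambda. Proof. by rewrite sqr_sqrtr// mulr_ge0// ltW. Qed.

(* The maximum of the two variables has density [2 * range_half_pdf]. *)
Definition range_half_pdf (y : R) := c * sinhR (y * c) / (coshR (y * c) + 1) ^+ 2.

Definition range_half_cdf (y : R) := 2^-1 - (coshR (y * c) + 1)^-1.

(* Density in [x] of the event that the maximum increase is [x] and the maximum
   decrease is at most [y], for y <= x. *)
Definition increase_pdf (x y : R) :=
  range_half_pdf y * expR (- ((x - y) * exit_rate c y)).

Let cosh1_neq0 y : coshR (y * c) + 1 != 0.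
Proof. by rewrite gt_eqF// addr_gt0// coshR_gt0. Qed.

Let sinh_neq0 y : 0 < y -> sinhR (y * c) != 0.
Proof. by move=> y0; rewrite gt_eqF// sinhR_gt0// mulr_gt0. Qed.

Let is_derive_scale (y : R) : is_derive y 1 (fun y : R => y * c) c.
Proof.
have -> : (fun y : R => y * c) = c \*: (id : R -> R).
  by apply/funext => z; rewrite /= [RHS]mulrC.
by apply: is_derive_eq; rewrite /GRing.scale/= mulr1.
Qed.

Let is_derive_cosh_scale (y : R) :
  is_derive y 1 (fun y : R => coshR (y * c)) (c * sinhR (y * c)).
Proof.
have := @is_derive1_comp R coshR (fun y : R => y * c) y _ _
  (is_derive_coshR _) (is_derive_scale y).
by rewrite mulrC.
Qed.

Let is_derive_sinh_scale (y : R) :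
  is_derive y 1 (fun y : R => sinhR (y * c)) (c * coshR (y * c)).
Proof.
have := @is_derive1_comp R sinhR (fun y : R => y * c) y _ _
  (is_derive_sinhR _) (is_derive_scale y).
by rewrite mulrC.
Qed.

Let is_derive_cosh1 (y : R) :
  is_derive y 1 (fun y : R => coshR (y * c) + 1) (c * sinhR (y * c)).
Proof.
have d0 := is_derive_cosh_scale y.
have -> : (fun y : R => coshR (y * c) + 1) = (fun y : R => coshR (y * c)) + cst 1 by [].
by apply: is_derive_eq; rewrite addr0.
Qed.

Lemma is_derive_range_half_cdf (y : R) :
  is_derive y 1 range_half_cdf (range_half_pdf y).
Proof.
have d1 := is_derive_cosh1 y.
have d2 := @is_deriveV R (fun y : R => coshR (y * c) + 1) y _ 1 (cosh1_neq0 y) d1.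
have -> : range_half_cdf = cst 2^-1 - (fun y : R => (coshR (y * c) + 1)^-1) by [].
apply: is_derive_eq; rewrite /range_half_pdf /GRing.scale/= sub0r mulNr opprK.
by rewrite mulrC.
Qed.

Let is_derive_range_half_pdf (y : R) : is_derive y 1 range_half_pdf
  (c ^+ 2 * (2 - coshR (y * c)) / (coshR (y * c) + 1) ^+ 2).
Proof.
have d1 := is_derive_cosh1 y.
have d2 : is_derive y 1 (fun y : R => (coshR (y * c) + 1) ^+ 2)
    (2 * (coshR (y * c) + 1) * (c * sinhR (y * c))).
  have -> : (fun y : R => (coshR (y * c) + 1) ^+ 2) =
    (fun y : R => coshR (y * c) + 1) ^+ 2 :> (R -> R) by [].
  by apply: is_derive_eq; rewrite /= expr1.
have n2 : (coshR (y * c) + 1) ^+ 2 != 0 by rewrite expf_neq0.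
have d3 := @is_deriveV R (fun y : R => (coshR (y * c) + 1) ^+ 2) y _ 1 n2 d2.
have d4 := is_derive_sinh_scale y.
have -> : range_half_pdf = c \*: ((fun y : R => sinhR (y * c)) *
    (fun y : R => ((coshR (y * c) + 1) ^+ 2)^-1)).
  by apply/funext => z; rewrite /range_half_pdf /= -mulrA.
apply: is_derive_eq; rewrite /GRing.scale/=.
have := sqr_sinhR (y * c); have := cosh1_neq0 y.
set C := coshR _; set S := sinhR _ => C1 SS.
have -> : c * (S * (- ((C + 1) ^+ 2) ^- 2 * (2 * (C + 1) * (c * S))) +
   (C + 1) ^- 2 * (c * C)) =
  c ^+ 2 * (C * (C + 1) - 2 * S ^+ 2) / (C + 1) ^+ 3.
  by field.
by rewrite SS; field.
Qed.

Let is_derive_exit_rate (y : R) : 0 < y ->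
  is_derive y 1 (exit_rate c) (- (c ^+ 2) / sinhR (y * c) ^+ 2).
Proof.
move=> y0; have dV := @is_deriveV R (fun y : R => sinhR (y * c)) y _ 1
  (sinh_neq0 y0) (is_derive_sinh_scale y).
have d0 := is_derive_cosh_scale y.
have -> : exit_rate c = c \*: ((fun y : R => coshR (y * c)) *
    (fun y : R => (sinhR (y * c))^-1)) by [].
apply: is_derive_eq; rewrite /GRing.scale/=.
have := sqr_sinhR (y * c); have := sinh_neq0 y0.
set C := coshR _; set S := sinhR _ => S0 SS.
have -> : c * (C * (- S ^- 2 * (c * C)) + S^-1 * (c * S)) =
  c ^+ 2 * (S ^+ 2 - C ^+ 2) / S ^+ 2 by field.
by rewrite SS; field; rewrite -SS expf_neq0.
Qed.

(** In the smaller variable the joint density is an exact derivative, so the inner integral is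
    elementary. *)
Lemma is_derive_increase_pdf (x y : R) : 0 < y ->
  is_derive y 1 (increase_pdf x) (f_plus_minus lambda x y).
Proof.
move=> y0; have d1 := is_derive_exit_rate y0.
have d2 : is_derive y 1 (fun y : R => - ((x - y) * exit_rate c y))
    (exit_rate c y + (x - y) * (c ^+ 2 / sinhR (y * c) ^+ 2)).
  have -> : (fun y : R => - ((x - y) * exit_rate c y)) =
      - ((cst x - id) * exit_rate c) :> (R -> R) by [].
  apply: is_derive_eq; rewrite /GRing.scale/=.
  rewrite (_ : (cst x - id) y = x - y) //.
  by move: (exit_rate c y) => r; ring.
have d3 := @is_derive1_comp R expR _ y _ _ (is_derive_expR _) d2.
have d4 := is_derive_range_half_pdf y.
have -> : increase_pdf x = range_half_pdf *
    (expR \o (fun y : R => - ((x - y) * exit_rate c y))) by [].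
apply: is_derive_eq; rewrite /GRing.scale/= /f_plus_minus -/c.
rewrite (_ : (x - y) * c * cothR (y * c) = (x - y) * exit_rate c y); last first.
  by rewrite /exit_rate; ring.
rewrite -cc /range_half_pdf exit_rateE.
set e := expR _.
have := sqr_sinhR (y * c); have := sinh_neq0 y0; have := cosh1_neq0 y.
set C := coshR _; set S := sinhR _ => C1 S0 SS.
have -> : c * S / (C + 1) ^+ 2 * (e * (c * (C / S) + (x - y) * (c ^+ 2 / S ^+ 2))) +
    e * (c ^+ 2 * (2 - C) / (C + 1) ^+ 2) =
  c ^+ 2 / (C + 1) ^+ 2 * (2 + (x - y) * c / S) * e by field; rewrite C1 S0.
by [].
Qed.

Let derive_continuous (f : R -> R) (y df : R) :
  is_derive y 1 f df -> {for y, continuous f}.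
Proof. by move=> [h _]; exact/differentiable_continuous/derivable1_diffP. Qed.

Lemma f_plus_minus_continuous (x y : R) : 0 < y ->
  {for y, continuous (f_plus_minus lambda x)}.
Proof.
move=> y0; have n2 : (coshR (y * c) + 1) ^+ 2 != 0 by rewrite expf_neq0.
have cC := derive_continuous (is_derive_cosh1 y).
have cS := derive_continuous (is_derive_sinh_scale y).
have cR := derive_continuous (is_derive_exit_rate y0).
have cX : {for y, continuous (fun y : R => x - y)}.
  by apply: continuousB; [exact: cvg_cst|exact: cvg_id].
have -> : f_plus_minus lambda x = (fun y : R => 2 * lambda /
    ((coshR (y * c) + 1) * (coshR (y * c) + 1)) *
    (2 + (x - y) * c / sinhR (y * c)) *
    expR (- ((x - y) * exit_rate c y))).
  apply/funext => z; rewrite /f_plus_minus -/c -expr2.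
  by congr (_ * expR _); rewrite /exit_rate; ring.
apply: continuousM.
  apply: continuousM.
    apply: continuousM; first exact: cvg_cst.
    by apply: continuousV; [rewrite -expr2|exact: continuousM].
  apply: continuousD; first exact: cvg_cst.
  apply: continuousM; first by apply: continuousM => //; exact: cvg_cst.
  by apply: continuousV => //; exact: sinh_neq0.
apply: continuous_comp; last exact: continuous_expR.
by apply: continuousN; exact: continuousM.
Qed.

Lemma f_plus_minus_ge0 (x y : R) : 0 < y -> y <= x -> 0 <= f_plus_minus lambda x y.
Proof.
move=> y0 yx; rewrite /f_plus_minus -/c mulr_ge0 ?expR_ge0// mulr_ge0//.
  by rewrite divr_ge0 ?sqr_ge0// mulr_ge0// ltW.
have S0 : 0 <= sinhR (y * c) by apply: sinhR_ge0; rewrite mulr_ge0// ltW.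
have n0 : 0 <= (x - y) * c by rewrite mulr_ge0 ?(ltW c0)// subr_ge0.
by rewrite addr_ge0//; exact: divr_ge0.
Qed.

Lemma range_half_pdf_ge0 (y : R) : 0 < y -> 0 <= range_half_pdf y.
Proof.
move=> y0; rewrite /range_half_pdf divr_ge0 ?sqr_ge0//.
have S0 : 0 <= sinhR (y * c) by apply: sinhR_ge0; rewrite mulr_ge0// ltW.
exact: mulr_ge0 (ltW c0) S0.
Qed.

Lemma increase_pdf_ge0 (x y : R) : 0 < y -> 0 <= increase_pdf x y.
Proof. by move=> y0; rewrite mulr_ge0 ?expR_ge0// range_half_pdf_ge0. Qed.

Lemma continuous_range_half_pdf : continuous range_half_pdf.
Proof. by move=> y; exact: derive_continuous (is_derive_range_half_pdf y). Qed.

Lemma continuous_increase_pdf_left (y : R) : continuous (increase_pdf ^~ y).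
Proof.
have -> : increase_pdf ^~ y =
  (fun x : R => range_half_pdf y * expR (- ((x - y) * exit_rate c y))) by [].
move=> x; change {for x, continuous
  (fun x : R => range_half_pdf y * expR (- ((x - y) * exit_rate c y)))}.
apply: continuousM; first exact: cvg_cst.
apply: continuous_comp; last exact: continuous_expR.
apply: continuousN; apply: continuousM; last exact: cvg_cst.
by apply: continuousB; [exact: cvg_id|exact: cvg_cst].
Qed.

Lemma measurable_increase_pdf_min (a b : R) : 0 < b ->
  measurable_fun `]0, a] (fun x => (increase_pdf x (Num.min x b))%:E).
Proof.
move=> b0; have m1 : measurable_fun `]0, b]
    (fun x => (increase_pdf x (Num.min x b))%:E).
  apply: (eq_measurable_fun (fun x => (range_half_pdf x)%:E)).
    move=> x; rewrite inE/= in_itv/= => /andP[_ xb].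
    rewrite (min_idPl xb) /increase_pdf subrr mul0r oppr0 expR0.
    by rewrite mulr1.
  apply/measurable_EFinP/measurable_funTS.
  exact: (continuous_measurable_fun continuous_range_half_pdf).
have m2 : measurable_fun `]b, +oo[ (fun x => (increase_pdf x (Num.min x b))%:E).
  apply: (eq_measurable_fun (fun x => (increase_pdf x b)%:E)).
    by move=> x; rewrite inE/= in_itv/= andbT => bx; rewrite (min_idPr (ltW bx)).
  apply/measurable_EFinP/measurable_funTS.
  exact: (continuous_measurable_fun (@continuous_increase_pdf_left b)).
have sub : `]0, a]%classic `<=` `]0, b]%classic `|` `]b, +oo[%classic.
  move=> x /=; rewrite !in_itv/= andbT => /andP[-> _] /=.
  by have [] := leP x b; [left|right].
have m12 : measurable_fun (`]0, b]%classic `|` `]b, +oo[%classic)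
    (fun x => (increase_pdf x (Num.min x b))%:E).
  apply: (iffRL (measurable_funU _ (measurable_itv _) (measurable_itv _))).
  by split.
apply: measurable_funS m12 => //.
by apply: measurableU; exact: measurable_itv.
Qed.

Let exit_rate_gt0 (y : R) : 0 < y -> 0 < exit_rate c y.
Proof. by move=> y0; rewrite exit_rateE mulr_gt0// divr_gt0 ?coshR_gt0// sinhR_gt0// mulr_gt0. Qed.

Let range_half_pdf_le (y b : R) : 0 < y -> y <= b ->
  range_half_pdf y <= c ^+ 2 * expR (b * c) * y.
Proof.
move=> y0 yb; have yc0 : 0 <= y * c by rewrite mulr_ge0// ltW.
have C0 := coshR_gt0 (y * c).
rewrite /range_half_pdf ler_pdivrMr ?exprn_gt0 ?addr_gt0//.
have h1 : c * sinhR (y * c) <= c ^+ 2 * expR (b * c) * y.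
  rewrite (_ : c ^+ 2 * _ * _ = c * (y * c * expR (b * c))); last by ring.
  rewrite ler_wpM2l ?(ltW c0)// (le_trans (sinhR_le yc0))// ler_wpM2l//.
  by rewrite ler_expR ler_wpM2r// ltW.
rewrite (le_trans h1)// ler_peMr//.
  by rewrite mulr_ge0 ?(ltW y0)// mulr_ge0 ?sqr_ge0 ?expR_ge0.
by rewrite exprn_ege1// lerDr ltW.
Qed.

Lemma integral_f_plus_minus (x b : R) : 0 < b -> b <= x ->
  (\int[mu]_(y in `]0%R, b]) (f_plus_minus lambda x y)%:E)%E = (increase_pdf x b)%:E.
Proof.
move=> b0 bx; apply: (@ge0_FTC_left_open _ (f_plus_minus lambda x)
  (increase_pdf x) _ (c ^+ 2 * expR (b * c)) b0).
- by move=> y y0 yb; apply: f_plus_minus_ge0 => //; exact: le_trans bx.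
- by move=> y; exact: f_plus_minus_continuous.
- by move=> y; exact: is_derive_increase_pdf.
- move=> y y0 yb; rewrite /increase_pdf ger0_norm; last first.
    by rewrite mulr_ge0 ?expR_ge0// range_half_pdf_ge0.
  apply: le_trans (range_half_pdf_le y0 yb).
  rewrite ler_piMr ?range_half_pdf_ge0// -expR0 ler_expR oppr_le0.
  by apply: mulr_ge0; [rewrite subr_ge0 (le_trans yb)|exact: ltW (exit_rate_gt0 y0)].
Qed.

Lemma integral_range_half_pdf (b : R) : 0 < b ->
  (\int[mu]_(y in `]0%R, b]) (range_half_pdf y)%:E)%E = (range_half_cdf b)%:E.
Proof.
move=> b0; apply: (@ge0_FTC_left_open _ range_half_pdf range_half_cdf _
  (b * c ^+ 2 * expR (b * c)) b0).
- by move=> y y0 _; exact: range_half_pdf_ge0.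
- by move=> y _; exact: continuous_range_half_pdf.
- by move=> y _; exact: is_derive_range_half_cdf.
- move=> y y0 yb; have C1 := coshR_ge1 (y * c).
  have yc0 : 0 <= y * c by rewrite mulr_ge0// ltW.
  have h := coshR_sub1_le yc0.
  have -> : range_half_cdf y = (coshR (y * c) - 1) / (2 * (coshR (y * c) + 1)).
    by rewrite /range_half_cdf; field; exact: cosh1_neq0.
  rewrite ger0_norm; last by rewrite divr_ge0//; lra.
  rewrite ler_pdivrMr; last by rewrite mulr_gt0//; lra.
  have h2 : (y * c) ^+ 2 * expR (y * c) <= b * c ^+ 2 * expR (b * c) * y.
    rewrite (_ : b * _ * _ * y = (y * c * (b * c)) * expR (b * c)); last by ring.
    rewrite ler_pM ?sqr_ge0 ?expR_ge0//.
      by rewrite expr2 ler_wpM2l// ler_wpM2r// ltW.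
    by rewrite ler_expR ler_wpM2r// ltW.
  rewrite (le_trans h)// (le_trans h2)// ler_peMr//; last by lra.
  by rewrite !mulr_ge0 ?expR_ge0 ?sqr_ge0// ltW.
Qed.

Lemma integral_increase_pdf_tail (a b : R) : 0 < b -> b < a ->
  (\int[mu]_(x in `]b, a]) (increase_pdf x b)%:E)%E =
  (range_half_pdf b / exit_rate c b * (1 - expR (- ((a - b) * exit_rate c b))))%:E.
Proof.
move=> b0 ba; have g0 := exit_rate_gt0 b0; set g := exit_rate c b in g0 *.
have dE (k x : R) : is_derive x 1 (fun x : R => k * expR (- ((x - b) * g)))
    (- (k * g) * expR (- ((x - b) * g))).
  have d1 : is_derive x 1 (fun x : R => - ((x - b) * g)) (- g).
    have -> : (fun x : R => - ((x - b) * g)) = - (g \*: (id - cst b)) :> (R -> R).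
      by apply/funext => z /=; rewrite mulrC.
    by apply: is_derive_eq; rewrite /GRing.scale/= subr0 mulr1.
  have d2 := @is_derive1_comp R expR _ x _ _ (is_derive_expR _) d1.
  have -> : (fun x : R => k * expR (- ((x - b) * g))) =
    k \*: (expR \o (fun x : R => - ((x - b) * g))) by [].
  by apply: is_derive_eq; rewrite /GRing.scale/=; ring.
have cf := @continuous_increase_pdf_left b.
rewrite integral_itv_obnd_cbnd; last first.
  apply/measurable_EFinP/measurable_funTS.
  exact: (continuous_measurable_fun cf).
pose F (x : R) := - (range_half_pdf b / g) * expR (- ((x - b) * g)).
have cF : continuous F by move=> x; exact: derive_continuous (dE _ x).
rewrite (@continuous_FTC2 _ _ F)//.
- rewrite -EFinB /F subrr mul0r oppr0 expR0; congr EFin; ring.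
- exact: continuous_subspaceT.
- split.
  + by move=> x _; have [] := dE (- (range_half_pdf b / g)) x.
  + by apply: cvg_at_right_filter; exact: cF.
  + by apply: cvg_at_left_filter; exact: cF.
- move=> x _; rewrite derive1E; have dx := dE (- (range_half_pdf b / g)) x.
  by rewrite derive_val /increase_pdf -/g; field; rewrite gt_eqF.
Qed.

(** The mass of 0 < y <= x <= a, y <= b, where x is the larger variable. Up to x = b the constraint
    y <= b is void; the second summand is the part b < x <= a. *)
Definition increase_cdf (a b : R) := range_half_cdf (Num.min a b) +
  if b < a then range_half_pdf b / exit_rate c b *
    (1 - expR (- ((a - b) * exit_rate c b))) else 0.

Lemma integral_increase_pdf (a b : R) : 0 < a -> 0 < b ->
  (\int[mu]_(x in `]0%R, a]) (increase_pdf x (Num.min x b))%:E)%E =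
  (increase_cdf a b)%:E.
Proof.
move=> a0 b0; have diag (m : R) : m <= b ->
    (\int[mu]_(x in `]0%R, m]) (increase_pdf x (Num.min x b))%:E =
     \int[mu]_(x in `]0%R, m]) (range_half_pdf x)%:E)%E.
  move=> mb; apply: eq_integral => x; rewrite inE/= in_itv/= => /andP[_ xm].
  rewrite (min_idPl (le_trans xm mb)) /increase_pdf subrr mul0r oppr0 expR0.
  by rewrite mulr1.
rewrite /increase_cdf; case: ltP => [ba|ab]; last first.
  by rewrite addr0 diag// integral_range_half_pdf.
rewrite EFinD -integral_range_half_pdf//.
rewrite -(diag b)// -integral_increase_pdf_tail//.
have -> : `]0, a]%classic = `]0, b]%classic `|` `]b, a]%classic.
  by rewrite -itv_bndbnd_setU ?bnd_simp// ltW.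
have sub : `]0, b]%classic `|` `]b, a]%classic `<=` (`]0, a]%classic : set R).
  by rewrite -itv_bndbnd_setU ?bnd_simp// ltW.
apply: etrans (ge0_integral_setU mu (measurable_itv _) (measurable_itv _) _ _ _) _.
- by apply: measurable_funS sub _ => //; exact: measurable_increase_pdf_min.
- move=> x /sub; rewrite /= in_itv/= => /andP[x0 _].
  by rewrite lee_fin increase_pdf_ge0// lt_min x0.
- apply/disj_setPLR => x /=; rewrite !in_itv/= => /andP[_ xb] /andP[bx _].
  by have := lt_le_trans bx xb; rewrite ltxx.
- apply: (congr1 (adde _)); apply: eq_integral => x; rewrite inE/= in_itv/= => /andP[bx _].
  by rewrite (min_idPr (ltW bx)).
Qed.

(** The two sides of the diagonal add up to the value found for the process. For b <= a the side
    where the decrease dominates contributes only [range_half_cdf b]; S^2 = C^2 - 1 does the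
    rest. *)
Lemma increase_cdf_sum (a b : R) : 0 < a -> 0 < b ->
  increase_cdf a b + increase_cdf b a = range_cdf c (Num.max a b) (Num.min a b).
Proof.
wlog ba : a b / b <= a.
  move=> h a0 b0; case/orP: (le_total b a) => [ba|ab]; first exact: h.
  by rewrite addrC h// (maxC b) (minC b).
move=> a0 b0; rewrite (max_idPl ba) (min_idPr ba) /increase_cdf (min_idPr ba) (min_idPl ba).
rewrite (ltNge a b) ba/= addr0.
have := sqr_sinhR (b * c); have := sinh_neq0 b0; have := cosh1_neq0 b.
have : coshR (b * c) != 0 by rewrite gt_eqF// coshR_gt0.
rewrite /range_cdf /range_half_cdf /range_half_pdf exit_rateE.
set C := coshR _; set S := sinhR _ => Cn0 C1 S0 SS.
have c0' : c != 0 by rewrite gt_eqF.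
case: ltgtP ba => // [_ _|<- _]; last first.
  rewrite subrr mul0r oppr0 expR0 mulr1.
  by field; rewrite C1 Cn0.
set e := expR _.
have -> : c * S / (C + 1) ^+ 2 / (c * (C / S)) * (1 - e) =
  S ^+ 2 / ((C + 1) ^+ 2 * C) * (1 - e) by field; rewrite c0' C1 S0 Cn0.
by rewrite SS; field; rewrite C1 Cn0.
Qed.

End density_calculus.

(** * Identification of the law *)

Section quadrant_uniqueness.
Context {R : realType}.

Lemma finite_measure_cdf_unique (m1 m2 : {measure set R -> \bar R}) :
  (m1 setT < +oo)%E -> (forall a : R, m1 `]-oo, a]%classic = m2 `]-oo, a]%classic) ->
  forall A : set R, measurable A -> m1 A = m2 A.
Proof.
move=> m1oo m12 A mA.
have m1fin (B : set R) : measurable B -> (m1 B < +oo)%E.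
  by move=> mB; apply: le_lt_trans m1oo; apply: le_measure; rewrite ?inE.
have mray (a : R) : measurable (`]-oo, a]%classic : set R) by exact: measurable_itv.
have ocE (a b : R) : a < b -> `]a, b]%classic = `]-oo, b]%classic `\` `]-oo, a]%classic :> set R.
  move=> ab; apply/seteqP; split => x /=; rewrite !in_itv/=.
    by move=> /andP[ax ->]; split => //; apply/negP; rewrite -ltNge.
  by move=> [-> /negP]; rewrite -ltNge => ->.
have m12oc (a b : R) : m1 `]a, b]%classic = m2 `]a, b]%classic.
  have [ab|ba] := ltP a b; last first.
    by rewrite set_itv_ge ?measure0// bnd_simp -leNgt.
  have sub : `]-oo, b]%classic `&` `]-oo, a]%classic = `]-oo, a]%classic :> set R.
    by apply/setIidr/subset_itvl; rewrite bnd_simp ltW.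
  have D1 := measureD (mray b) (mray a) (m1fin _ (mray b)).
  have D2 : m2 (`]-oo, b]%classic `\` `]-oo, a]%classic) =
      (m2 `]-oo, b]%classic - m2 (`]-oo, b]%classic `&` `]-oo, a]%classic))%E.
    by apply: measureD => //; have := m1fin _ (mray b); rewrite m12.
  rewrite ocE// D1 D2 !sub; congr (_ - _)%E; exact: m12.
apply: (measure_unique (@ocitv R) (fun n => `](- n%:R)%R, n%:R]%classic)) => //.
- exact: ocitvI.
- by move=> n; exact: is_ocitv.
- exact: bigcup_itvT.
- by move=> _ [[a b] _ <-]; exact: m12oc.
- by move=> n; apply: m1fin; exact: measurable_itv.
Qed.

(** One coordinate at a time: with one side of a rectangle frozen, the measure of the other side is
    a finite measure on the line, determined by half-lines. *)
Lemma finite_measure_quadrant_unique (m1 m2 : {measure set (R * R) -> \bar R}) :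
  (m1 setT < +oo)%E ->
  (forall a b : R, m1 (`]-oo, a]%classic `*` `]-oo, b]%classic) =
                   m2 (`]-oo, a]%classic `*` `]-oo, b]%classic)) ->
  forall A : set (R * R), measurable A -> m1 A = m2 A.
Proof.
move=> m1oo m12; apply: finite_measure_rectangle_unique => // A B mA mB.
have m1fin (C : set (R * R)) : measurable C -> (m1 C < +oo)%E.
  by move=> mC; apply: le_lt_trans m1oo; apply: le_measure; rewrite ?inE.
have mray (a : R) : measurable (`]-oo, a]%classic : set R) by exact: measurable_itv.
have mfst (C : set R) : measurable C -> measurable (C `*` [set: R]).
  by move=> mC; exact: measurableX.
have msnd (C : set R) : measurable C -> measurable ([set: R] `*` C).
  by move=> mC; exact: measurableX.
have restrE (m : {measure set (R * R) -> \bar R}) (C : set R) (mC : measurable C) (E : set R) :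
    image_measure (mrestr m (mfst C mC)) measurable_snd E = m (C `*` E).
  by congr (m _); apply/seteqP; split => -[x y]/=; [move=> [? []]|move=> [? ?]; split].
have restrE' (m : {measure set (R * R) -> \bar R}) (C : set R) (mC : measurable C) (E : set R) :
    image_measure (mrestr m (msnd C mC)) measurable_fst E = m (E `*` C).
  by congr (m _); apply/seteqP; split => -[x y]/=; [move=> [? []]|move=> [? ?]; split].
have m12B (a : R) : m1 (`]-oo, a]%classic `*` B) = m2 (`]-oo, a]%classic `*` B).
  rewrite -!(restrE _ _ (mray a)); apply: finite_measure_cdf_unique => //.
    by rewrite restrE m1fin//; exact: measurableX.
  by move=> b; rewrite !restrE.
rewrite -!(restrE' _ _ mB); apply: finite_measure_cdf_unique => //.
  by rewrite restrE' m1fin//; exact: measurableX.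
by move=> a; rewrite !restrE'.
Qed.

End quadrant_uniqueness.

Section measurability_from_half_lines.
Context d (T : measurableType d) {R : realType}.

Lemma measurable_fun_half_lines (f : T -> R) :
  (forall a, measurable [set x | f x <= a]) -> measurable_fun setT f.
Proof.
move=> mf; apply: (measurability (RGenOInfty.G (R := R))).
  exact: RGenOInfty.measurableE.
move=> _ [_ [a ->] <-]; rewrite setTI.
rewrite (_ : f @^-1` _ = ~` [set x | f x <= a]); first exact: measurableC.
by apply/seteqP; split => x /=; rewrite in_itv/= andbT ltNge => /negP.
Qed.

End measurability_from_half_lines.

Section max_increase_nonnegative.
Context {R : realType}.
Implicit Types (x : R -> R) (t : R).

Lemma max_increase_ge0 x t : 0 <= max_increase x t.
Proof.
have [t0|t0] := ltP t 0; first by rewrite max_increase_lt0.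
(* On an unbounded set [sup] has the default value 0, so the bound holds for every path. *)
have [bd|unbd] := pselect (has_ubound [set x uv.2 - x uv.1 | uv in
    [set uv : R * R | [/\ 0 <= uv.1, uv.1 <= uv.2 & uv.2 <= t]]]).
  by apply: ub_le_sup => //; exists (0, 0); rewrite /= ?subrr.
by rewrite /max_increase sup_out// => -[].
Qed.

Lemma max_decrease_ge0 x t : 0 <= max_decrease x t.
Proof. by rewrite max_decreaseE max_increase_ge0. Qed.

End max_increase_nonnegative.

Section density_measure.
Context d (T : measurableType d) (R : realType).
Variables (m : {measure set T -> \bar R}) (f : T -> \bar R).

(** Measurability and nonnegativity are arguments so that the measure structure can be attached to
    the term itself. *)
Definition density_measure of measurable_fun setT f & (forall x, (0 <= f x)%E) :=
  fun A => (\int[m]_(x in A) f x)%E.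

Hypotheses (mf : measurable_fun setT f) (f0 : forall x, (0 <= f x)%E).

Let density_measure0 : density_measure mf f0 set0 = 0%E.
Proof. exact: integral_set0. Qed.

Let density_measure_ge0 A : (0 <= density_measure mf f0 A)%E.
Proof. by apply: integral_ge0 => x _. Qed.

Let density_measure_additive : semi_sigma_additive (density_measure mf f0).
Proof. exact: semi_sigma_additive_nng_induced. Qed.

HB.instance Definition _ := isMeasure.Build _ _ _ (density_measure mf f0)
  density_measure0 density_measure_ge0 density_measure_additive.

End density_measure.

(** * Mass of quadrants under the joint density *)

Section joint_density.
Context {R : realType}.
Local Notation mu := (@lebesgue_measure R).
Variable lambda : R.
Hypothesis lambda0 : 0 < lambda.
Let c := Num.sqrt (2 * lambda).

Let c0 : 0 < c. Proof. by rewrite sqrtr_gt0 mulr_gt0. Qed.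

Definition quadrant : set (R * R) := [set z | 0 < z.1 /\ 0 < z.2].

Definition joint_pdf (z : R * R) : R :=
  f_plus_minus lambda (Num.max z.1 z.2) (Num.min z.1 z.2).

Let measurable_snd_pos : measurable [set z : R * R | 0 < z.2].
Proof. by apply: measurable_lt_set; [exact: measurable_cst|exact: measurable_snd]. Qed.

Lemma measurable_quadrant : measurable quadrant.
Proof.
apply: measurableI measurable_snd_pos.
by apply: measurable_lt_set; [exact: measurable_cst|exact: measurable_fst].
Qed.

Let measurable_pos_comp (f : R -> R) :
  (forall y, 0 < y -> {for y, continuous f}) ->
  measurable_fun [set z : R * R | 0 < z.2] (f \o snd).
Proof.
move=> cf; apply: (@measurable_comp _ _ _ _ R R (`]0, +oo[%classic : set R)).
- exact: measurable_itv.
- by move=> _ [[x y]/= y0 <-]; rewrite in_itv/= y0.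
- apply: open_continuous_measurable_fun => //.
  by move=> y; rewrite inE/= in_itv/= andbT; exact: cf.
- exact: measurable_funTS.
Qed.

Let scale_continuous (f : R -> R) (y : R) : continuous f ->
  {for y, continuous (fun y : R => f (y * c))}.
Proof.
move=> cf; apply: continuous_comp; last exact: cf.
by apply: continuousM; [exact: cvg_id|exact: cvg_cst].
Qed.

Let inv_sinh_continuous (y : R) : 0 < y ->
  {for y, continuous (fun y : R => (sinhR (y * c))^-1)}.
Proof.
move=> y0; apply: continuousV; last exact: scale_continuous (@continuous_sinhR R).
by rewrite gt_eqF// sinhR_gt0// mulr_gt0.
Qed.

Lemma measurable_f_plus_minus :
  measurable_fun [set z : R * R | 0 < z.2] (fun z => f_plus_minus lambda z.1 z.2).
Proof.
pose u (y : R) := ((coshR (y * c) + 1) * (coshR (y * c) + 1))^-1.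
pose v (y : R) := (sinhR (y * c))^-1; pose C (y : R) := coshR (y * c).
have -> : (fun z : R * R => f_plus_minus lambda z.1 z.2) =
  (fun z => 2 * lambda * (u \o snd) z * (2 + (z.1 - z.2) * c * (v \o snd) z) *
    expR (- ((z.1 - z.2) * c * ((C \o snd) z * (v \o snd) z)))).
  by apply/funext => -[x y]; rewrite /f_plus_minus -/c /u /v /C /= -expr2.
have m_u : measurable_fun [set z : R * R | 0 < z.2] (u \o snd).
  apply: measurable_pos_comp => y _; have C1 : coshR (y * c) + 1 != 0.
    by rewrite gt_eqF// addr_gt0// coshR_gt0.
  have cC : {for y, continuous (fun y : R => coshR (y * c) + 1)}.
    apply: continuousD; last exact: cvg_cst.
    exact: scale_continuous (@continuous_coshR R).
  by apply: continuousV; [exact: mulf_neq0|exact: continuousM].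
have mv : measurable_fun [set z : R * R | 0 < z.2] (v \o snd).
  exact: measurable_pos_comp inv_sinh_continuous.
have mC : measurable_fun [set z : R * R | 0 < z.2] (C \o snd).
  by apply: measurable_pos_comp => y _; exact: scale_continuous (@continuous_coshR R).
have md : measurable_fun [set z : R * R | 0 < z.2] (fun z => (z.1 - z.2) * c).
  by apply: measurable_funM => //; apply: measurable_funB; exact: measurable_funTS.
apply: measurable_funM; first apply: measurable_funM.
- exact: measurable_funM.
- by apply: measurable_funD => //; exact: measurable_funM.
- apply: measurableT_comp => //; apply: measurableT_comp => //.
  by do 2 apply: measurable_funM => //.
Qed.

Lemma joint_pdf_ge0 z : quadrant z -> 0 <= joint_pdf z.
Proof.
move: z => [x y] [/= x0 y0]; apply: f_plus_minus_ge0 => //.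
  by rewrite lt_min x0.
by rewrite ge_min le_max lexx.
Qed.

Lemma measurable_joint_pdf : measurable_fun quadrant joint_pdf.
Proof.
apply: (measurable_comp measurable_snd_pos _ measurable_f_plus_minus
  (g := fun z : R * R => (Num.max z.1 z.2, Num.min z.1 z.2))).
  by move=> _ [[x y] [/= x0 y0] <-]; rewrite /= lt_min x0.
apply: measurable_funTS; apply: measurable_fun_pair.
  exact: measurable_maxr.
exact: measurable_minr.
Qed.

Definition joint_pdf_pos : R * R -> \bar R := (EFin \o joint_pdf) \_ quadrant.

Lemma joint_pdf_pos_ge0 z : (0 <= joint_pdf_pos z)%E.
Proof. by apply: erestrict_ge0 => t Qt; rewrite lee_fin joint_pdf_ge0. Qed.

Lemma measurable_joint_pdf_pos : measurable_fun setT joint_pdf_pos.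
Proof.
apply/(measurable_restrict _ measurable_quadrant measurableT); rewrite setTI.
by apply/measurable_EFinP; exact: measurable_joint_pdf.
Qed.

(** The diagonal is assigned to this set only, so the two parts are disjoint. Positivity of the
    first coordinate follows from the last two conditions. *)
Definition below_diagonal (a b : R) : set (R * R) :=
  [set z | [/\ z.1 <= a, 0 < z.2 & z.2 <= Num.min z.1 b]].

Definition above_diagonal (a b : R) : set (R * R) :=
  [set z | [/\ z.2 <= b, 0 < z.1, z.1 < z.2 & z.1 <= a]].

Lemma measurable_below_diagonal a b : measurable (below_diagonal a b).
Proof.
rewrite (_ : below_diagonal a b =
    [set z : R * R | z.1 <= a] `&` [set z | 0 < z.2] `&` [set z | z.2 <= Num.min z.1 b]).
  by apply: measurableI; [apply: measurableI|] => //; apply: measurable_le_set => //;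
    exact: measurable_minr.
by apply/seteqP; split => z; [case|move=> [[]]].
Qed.

Lemma measurable_above_diagonal a b : measurable (above_diagonal a b).
Proof.
rewrite (_ : above_diagonal a b = [set z : R * R | z.2 <= b] `&` [set z | 0 < z.1] `&`
    ([set z | z.1 < z.2] `&` [set z | z.1 <= a])).
  by do 2 apply: measurableI; first [exact: measurable_le_set|exact: measurable_lt_set].
by apply/seteqP; split => z; [case|move=> [[? ?] []]].
Qed.

Lemma integral_below_diagonal (a b : R) : 0 < a -> 0 < b ->
  (\int[mu \x mu]_(z in below_diagonal a b) (f_plus_minus lambda z.1 z.2)%:E)%E =
  (increase_cdf lambda a b)%:E.
Proof.
move=> a0 b0; rewrite integral_mkcond fubini_tonelli1; first last.
- apply: erestrict_ge0 => z [_ z0 zb]; rewrite lee_fin f_plus_minus_ge0//.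
  by rewrite (le_trans zb)// ge_min lexx.
- apply/(measurable_restrict _ (measurable_below_diagonal a b) measurableT).
  rewrite setTI; apply/measurable_EFinP; apply: measurable_funS measurable_f_plus_minus => //.
  by move=> z [].
rewrite -(integral_increase_pdf lambda0 a0 b0) [RHS]integral_mkcond.
apply: eq_integral => x _; rewrite /fubini_F [in RHS]patchE; case: ifPn => [|xa].
  rewrite inE/= in_itv/= => /andP[x_gt0 xa].
  rewrite -(integral_f_plus_minus lambda0) ?lt_min ?x_gt0 ?ge_min ?lexx//.
  rewrite [RHS]integral_mkcond; apply: eq_integral => y _; rewrite !patchE.
  rewrite (_ : ((x, y) \in below_diagonal a b) = (y \in `]0, Num.min x b]%classic))//.
  apply/idP/idP; rewrite !inE/= in_itv/=; first by move=> [_ -> ->].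
  by move=> /andP[y0 yb]; split.
rewrite -[RHS](integral0 mu setT); apply: eq_integral => y _.
rewrite patchE memNset// => -[/= h1 h2 h3]; move/negP: xa; apply.
by rewrite inE/= in_itv/= h1 andbT (lt_le_trans h2)// (le_trans h3)// ge_min lexx.
Qed.

Lemma integral_above_diagonal (a b : R) : 0 < a -> 0 < b ->
  (\int[mu \x mu]_(z in above_diagonal a b) (f_plus_minus lambda z.2 z.1)%:E)%E =
  (increase_cdf lambda b a)%:E.
Proof.
move=> a0 b0; rewrite integral_mkcond fubini_tonelli2; first last.
- by apply: erestrict_ge0 => z [_ z0 /ltW zb _]; rewrite lee_fin f_plus_minus_ge0.
- apply/(measurable_restrict _ (measurable_above_diagonal a b) measurableT).
  rewrite setTI; apply/measurable_EFinP.
  apply: (measurable_comp measurable_snd_pos _ measurable_f_plus_minus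
    (g := fun z : R * R => (z.2, z.1))).
    by move=> _ [z [_ z0 _ _] <-].
  by apply: measurable_funTS; exact: measurable_fun_pair.
rewrite -(integral_increase_pdf lambda0 b0 a0) [RHS]integral_mkcond.
apply: eq_integral => y _; rewrite /fubini_G [in RHS]patchE; case: ifPn => [|yb].
  rewrite inE/= in_itv/= => /andP[y0 yb].
  rewrite -(integral_f_plus_minus lambda0) ?lt_min ?y0 ?ge_min ?lexx//.
  (* If a < y, then x <= a already implies x < y and the section is []0, a]]. Otherwise it is the
     open interval []0, y[], whose right end has measure zero. *)
  have [ay|ya] := ltP a y.
    rewrite [RHS]integral_mkcond; apply: eq_integral => x _; rewrite !patchE.
    rewrite (_ : ((x, y) \in above_diagonal a b) = (x \in `]0, a]%classic))//.
    apply/idP/idP; rewrite !inE/= in_itv/=; first by move=> [_ -> _ ->].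
    by move=> /andP[x0 xa]; split => //; exact: le_lt_trans ay.
  rewrite -integral_itv_bndo_bndc; last first.
    apply/measurable_EFinP; apply: open_continuous_measurable_fun => // x.
    by rewrite inE/= in_itv/= => /andP[x0 _]; exact: f_plus_minus_continuous.
  rewrite [RHS]integral_mkcond; apply: eq_integral => x _; rewrite !patchE.
  rewrite (_ : ((x, y) \in above_diagonal a b) = (x \in `]0, y[%classic))//.
  apply/idP/idP; rewrite !inE/= in_itv/=; first by move=> [_ -> -> _].
  by move=> /andP[x0 xy]; split => //; rewrite (le_trans (ltW xy)).
rewrite -[RHS](integral0 mu setT); apply: eq_integral => x _.
rewrite patchE memNset// => -[/= h1 h2 h3 _]; move/negP: yb; apply.
by rewrite inE/= in_itv/= h1 andbT (lt_trans h2).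
Qed.

Lemma integral_joint_pdf_quadrant (a b : R) : 0 < a -> 0 < b ->
  (\int[mu \x mu]_(z in `]-oo, a]%classic `*` `]-oo, b]%classic) joint_pdf_pos z)%E =
  (range_cdf c (Num.max a b) (Num.min a b))%:E.
Proof.
move=> a0 b0; rewrite -(increase_cdf_sum lambda0 a0 b0) EFinD.
rewrite -integral_below_diagonal// -integral_above_diagonal//.
rewrite -integral_mkcondr.
have UE : `]-oo, a]%classic `*` `]-oo, b]%classic `&` quadrant =
    below_diagonal a b `|` above_diagonal a b.
  apply/seteqP; split => -[x y] /=; rewrite !in_itv/=.
    move=> [[xa yb] [/= x0 y0]]; have [yx|xy] := leP y x; [left|right]; split => //=.
    by rewrite le_min yx.
  move=> [[/= xa y0]|[/= yb x0 xy xa]]; last by do !split => //=; exact: lt_trans xy.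
  by rewrite le_min => /andP[yx yb]; do !split => //=; exact: lt_le_trans yx.
have sub : below_diagonal a b `|` above_diagonal a b `<=` quadrant.
  by rewrite -UE; exact: subIsetr.
rewrite UE; apply: etrans (ge0_integral_setU (mu \x mu)%E
  (measurable_below_diagonal a b) (measurable_above_diagonal a b) _ _ _) _.
- apply/measurable_EFinP; apply: measurable_funS sub measurable_joint_pdf.
  exact: measurable_quadrant.
- by move=> z /sub; rewrite lee_fin; exact: joint_pdf_ge0.
- apply/disj_setPLR => z [_ _]; rewrite le_min => /andP[zz _] [_ _ h _].
  by have := lt_le_trans h zz; rewrite ltxx.
apply: (congr2 adde); apply: eq_integral => z; rewrite inE => -[].
- move=> _ z0; rewrite le_min => /andP[zz _]; congr EFin.
  by rewrite /joint_pdf (max_idPl zz) (min_idPr zz).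
- move=> _ _ /ltW zz _; congr EFin.
  by rewrite /joint_pdf (max_idPr zz) (min_idPl zz).
Qed.

End joint_density.

(** Linear decay in the smaller bound, uniformly in the larger one: this excludes mass on the
    axes. *)
Lemma range_cdf_le {R : realType} (c a b : R) : 0 < c -> 0 < b -> b <= 1 ->
  range_cdf c a b <= c ^+ 2 * expR c * b.
Proof.
move=> c0 b0 b1; have bc0 : 0 <= b * c by rewrite mulr_ge0// ltW.
have C1 := coshR_ge1 (b * c); have := coshR_sub1_le bc0.
rewrite /range_cdf; move: C1; set C := coshR _; set e := expR (- _) => C1 hC.
have e0 : 0 <= e by exact: expR_ge0.
have C0 : 0 < C by exact: lt_le_trans C1.
have h1 : 0 <= (C - 1) / (C * (C + 1)) * e.
  by rewrite mulr_ge0// divr_ge0 ?subr_ge0// mulr_ge0 ?addr_ge0// ltW.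
have h2 : 1 - C^-1 <= C - 1.
  rewrite -[C in _ <= C - 1]mulr1 -subr_ge0.
  rewrite (_ : _ - _ = (C - 1) ^+ 2 / C); last by field; rewrite gt_eqF.
  by rewrite divr_ge0 ?sqr_ge0// ltW.
have h3 : (b * c) ^+ 2 * expR (b * c) <= c ^+ 2 * expR c * b.
  rewrite (_ : c ^+ 2 * _ * b = (b * c ^+ 2) * expR c); last by ring.
  rewrite ler_pM ?sqr_ge0 ?expR_ge0//.
    by rewrite exprMn ler_wpM2r ?sqr_ge0// expr2 ler_piMr// ltW.
  by rewrite ler_expR ler_piMl// ltW.
lra.
Qed.

Section law.
Context d (Omega : measurableType d) (R : realType) (P : probability Omega R).
Variables (x0 : R) (X : R -> {RV P >-> R}) (lambda : R) (T : {RV P >-> R}).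
Hypotheses (bm : standard_brownian_motion_from x0 X) (lambda0 : 0 < lambda).
Hypotheses (T_exp : exponentially_distributed lambda T).
Hypotheses (T_ind : independent_of_process T X).
Let c := Num.sqrt (2 * lambda).

Let incr w := max_increase (fun t => X t w) (T w).
Let decr w := max_decrease (fun t => X t w) (T w).

Let incr_decr_le a b := [set w | incr w <= a /\ decr w <= b].

Let incr_decr_le_neg a b : a < 0 \/ b < 0 -> incr_decr_le a b = set0.
Proof.
move=> ab; apply/seteqP; split => // w [wa wb]; case: ab => [a0|b0].
  by have := le_lt_trans (le_trans (max_increase_ge0 _ _) wa) a0; rewrite ltxx.
by have := le_lt_trans (le_trans (max_decrease_ge0 _ _) wb) b0; rewrite ltxx.
Qed.

Let measurable_incr_decr_le a b : measurable (incr_decr_le a b).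
Proof.
have [a0|a0] := ltP a 0; first by rewrite incr_decr_le_neg//; left.
have [b0|b0] := ltP b 0; first by rewrite incr_decr_le_neg//; right.
exact: (measurable_max_increase_decrease_le _ bm).
Qed.

Lemma measurable_max_increase_decrease :
  measurable_fun setT (fun w => (max_increase (fun t => X t w) (T w),
                                 max_decrease (fun t => X t w) (T w))).
Proof.
have nat_bound (x : R) : exists n : nat, x <= n%:R.
  by exists (Num.truncn x).+1; exact/ltW/truncnS_gt.
apply: measurable_fun_pair; apply: measurable_fun_half_lines => a.
- rewrite (_ : [set _ | _] = \bigcup_n incr_decr_le a n%:R).
    by apply: bigcup_measurable.
  apply/seteqP; split => [w wa|w [n _ []]//].
  by have [n wn] := nat_bound (decr w); exists n.
- rewrite (_ : [set _ | _] = \bigcup_n incr_decr_le n%:R a).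
    by apply: bigcup_measurable.
  apply/seteqP; split => [w wa|w [n _ []]//].
  by have [n wn] := nat_bound (incr w); exists n.
Qed.

(** The explicit distribution function covers positive bounds only. The event is enclosed in one
    with positive bounds whose smaller one is h, of probability at most K h, and h is arbitrarily
    small. *)
Let prob_incr_decr_le0 a b : a <= 0 \/ b <= 0 -> P (incr_decr_le a b) = 0%E.
Proof.
move=> ab; rewrite -[LHS]fineK ?fin_num_measure//; congr EFin.
apply/eqP; rewrite eq_le fine_ge0// andbT.
pose K := c ^+ 2 * expR c; have K0 : 0 < K.
  by rewrite mulr_gt0 ?expR_gt0// exprn_gt0// sqrtr_gt0 mulr_gt0.
apply/ler_addgt0Pr => e e0; rewrite add0r.
pose h := Num.min 1 (e / K).
have h0 : 0 < h by rewrite lt_min ltr01 divr_gt0.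
have h1 : h <= 1 by rewrite ge_min lexx.
have Kh : K * h <= e by rewrite mulrC -ler_pdivlMr// ge_min lexx orbT.
apply: le_trans Kh.
have bound a' b' : 0 < a' -> 0 < b' -> a <= a' -> b <= b' -> Num.min a' b' = h ->
    fine (P (incr_decr_le a b)) <= K * h.
  move=> a0 b0 aa bb mh; have mm := measurable_incr_decr_le.
  apply: (@le_trans _ _ (fine (P (incr_decr_le a' b')))).
    apply: fine_le; rewrite ?fin_num_measure//; apply: le_measure; rewrite ?inE//.
    by move=> w [wa wb]; split; [exact: le_trans aa|exact: le_trans bb].
  have -> := prob_max_increase_decrease_le bm lambda0 T_exp T_ind a0 b0; rewrite /= mh.
  by apply: range_cdf_le => //; rewrite sqrtr_gt0 mulr_gt0.
case: ab => [a0|b0].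
- apply: (bound h (Num.max 1 b)) => //.
  + by rewrite lt_max ltr01.
  + exact: le_trans (ltW h0).
  + by rewrite le_max lexx orbT.
  + by apply/min_idPl; rewrite le_max h1.
- apply: (bound (Num.max 1 a) h) => //.
  + by rewrite lt_max ltr01.
  + by rewrite le_max lexx orbT.
  + exact: le_trans (ltW h0).
  + by apply/min_idPr; rewrite le_max h1.
Qed.

Lemma law_max_increase_decrease (A : set (R * R)) : measurable A ->
  P ((fun w => (max_increase (fun t => X t w) (T w),
                max_decrease (fun t => X t w) (T w))) @^-1` A) =
  (\int[(@lebesgue_measure R) \x (@lebesgue_measure R)]_(z in A)
    joint_pdf_pos lambda z)%E.
Proof.
move=> mA; have mD := measurable_max_increase_decrease.
pose area : {measure set _ -> \bar R} := ((@lebesgue_measure R) \x (@lebesgue_measure R))%E.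
(* Lebesgue measure is carried by [measurableTypeR R]; pushing forward along the identity moves the
   density measure to the product type on which the law of the pair lives. *)
have mid : @measurable_fun _ _ (measurableTypeR R * measurableTypeR R)%type (R * R)%type setT id.
  by move=> _ Y mY; rewrite setTI.
pose nu : {measure set (R * R) -> \bar R} := image_measure (density_measure area
  (measurable_joint_pdf_pos lambda0) (joint_pdf_pos_ge0 lambda0)) mid.
suff : image_measure P mD A = nu A by [].
apply: finite_measure_quadrant_unique mA.
  by change (P setT < +oo)%E; rewrite probability_setT ltry.
move=> a b; rewrite image_measureE.
have -> : (fun w => (max_increase (fun t => X t w) (T w),
    max_decrease (fun t => X t w) (T w))) @^-1` (`]-oo, a]%classic `*` `]-oo, b]%classic) =
    incr_decr_le a b.
  by apply/seteqP; split => w /=; rewrite !in_itv.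
have -> : nu (`]-oo, a]%classic `*` `]-oo, b]%classic) =
    (\int[lebesgue_measure \x lebesgue_measure]_(z in `]-oo, a]%classic `*` `]-oo, b]%classic)
      joint_pdf_pos lambda z)%E by [].
have [[a0 b0]|ab] := pselect (0 < a /\ 0 < b).
  apply: etrans (prob_max_increase_decrease_le bm lambda0 T_exp T_ind a0 b0) _.
  by rewrite integral_joint_pdf_quadrant.
have {}ab : a <= 0 \/ b <= 0.
  have [a0|] := ltP 0 a; last by left.
  by have [b0|] := ltP 0 b; [case: ab|right].
apply: etrans (prob_incr_decr_le0 ab) _; apply: esym; apply: integral0_eq => -[x y] /=.
rewrite !in_itv/= => -[xa yb]; rewrite /joint_pdf_pos patchE memNset// => -[/= x_gt0 y_gt0].
case: ab => h.
  by have := lt_le_trans x_gt0 (le_trans xa h); rewrite ltxx.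
by have := lt_le_trans y_gt0 (le_trans yb h); rewrite ltxx.
Qed.

End law.

Theorem proposition4p6 (d : measure_display) (Omega : measurableType d)
    (R : realType) (P : probability Omega R)
    (x0 : R) (X : R -> {RV P >-> R}) (lambda : R) (T : {RV P >-> R}) :
  standard_brownian_motion_from x0 X ->
  0 < lambda ->
  exponentially_distributed lambda T ->
  independent_of_process T X ->
  let D := fun w : Omega => (max_increase (fun t => X t w) (T w),
                             max_decrease (fun t => X t w) (T w)) in
  measurable_fun setT D /\
  (forall A : set (R * R), measurable A ->
    P (D @^-1` A) =
    (\int[(@lebesgue_measure R) \x (@lebesgue_measure R)]_(z in
        A `&` [set z : R * R | (0 < z.1)%R /\ (0 < z.2)%R])
      (f_plus_minus lambda (Num.max z.1 z.2) (Num.min z.1 z.2))%:E)%E).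
Proof.
move=> bm lambda0 T_exp T_ind; split.
  by apply: (measurable_max_increase_decrease T bm).
move=> A mA; apply: etrans (law_max_increase_decrease bm lambda0 T_exp T_ind mA) _.
have := integral_mkcondr ((@lebesgue_measure R) \x (@lebesgue_measure R))%E A quadrant
  (EFin \o joint_pdf lambda).
by move=> <-.
Qed.
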